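(* The scheme $\mathcal{D}ual_{2n-2,n,n^2}$ is smooth at $[\det_n]$, and the $PGL_{n^2}$-orbit closure of $[\det_n]$ is an irreducible component of $\mathcal{D}ual_{2n-2,n,n^2}$.
   Context: $n$ is a positive integer, $W=M_n(\mathbb C)$ is the space of complex $n\times n$ matrices (of dimension $n^2$), $S^nW^*$ the space of homogeneous polynomials of degree $n$ on $W$, $\det_n\in S^nW^*$ the determinant; $PGL_{n^2}=PGL(W)$ acts on $\mathbb P(S^nW^* )$ by linear changes of variables. The scheme $\mathcal{D}ual_{2n-2,n,n^2}$ expresses the condition that $P\in S^nW^*$ divides the determinant of its Hessian restricted to every $(2n+1)$-dimensional subspace $F\subset W$, through the following explicit equations. Put $e=(2n+1)(n-2)$. For a basis $f=(f_1,\dots,f_{2n+1})$ of a $(2n+1)$-dimensional subspace $F\subset W$ and $P\in S^nW^*$, let $Q_f=\det\big(\partial_{f_i}\partial_{f_j}P\big)_{1\le i,j\le 2n+1}$, a form of degree $e$ on $W$. For linearly independent $u,v\in W$ write $$P(xu+yv)=\sum_{j=0}^n p_jx^jy^{n-j},\qquad Q_f(xu+yv)=\sum_{i=0}^e q_ix^iy^{e-i},$$ and set $$E_{f,u,v}(P)=\sum_{i=n-1}^{e}\ \sum_{r\ge 0}\ \sum_{\substack{j_1+\cdots+j_r=i-n+1\\ 1\le j_s\le n}}(-1)^r\,q_i\,p_{n-j_1}\cdots p_{n-j_r}\,p_n^{\,e-n+1-r}.$$ (For $p_n\ne0$, its vanishing means that the coefficient of $x^{n-1}$ in the remainder of the Euclidean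 division of $Q_f(xu+v)$ by $P(xu+v)$ is zero.) Each $E_{f,u,v}$ is a homogeneous polynomial of degree $2n(n-1)$ on $S^nW^*$. $\mathcal{D}ual_{2n-2,n,n^2}\subset\mathbb P(S^nW^* )$ is the closed subscheme defined by all the $E_{f,u,v}$ (all $f$, all linearly independent $u,v$). If $2n+1>n^2$ there are no such subspaces $F$, hence no equations, and the scheme is all of $\mathbb P(S^nW^* )$. *)

(* Defs.v *)
From mathcomp Require Import all_boot all_order all_fingroup all_algebra.
From mathcomp Require Import reals.
From mathcomp Require Import complex.
From mathcomp Require Import mpoly.
From mathcomp Require Import classical_sets.

Set Implicit Arguments.
Unset Strict Implicit.
Unset Printing Implicit Defensive.

Import GRing.Theory.

Local Open Scope ring_scope.
Local Open Scope classical_set_scope.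

(* A closed subscheme of projective space is given by a family of homogeneous
   equations, and its topology by its closed points, the field K being meant to
   be algebraically closed. *)

Section Projective.
Context (K : fieldType) (k : nat).

Definition proj := {L : {vspace 'rV[K]_k} | \dim L == 1%N}.

Fact proj_point_subproof (x : 'rV[K]_k) : x != 0 -> \dim <[x]> == 1%N.
Proof. by move=> x0; rewrite dim_vline x0. Qed.

Definition proj_point (x : 'rV[K]_k) (x0 : x != 0) : proj :=
  exist _ <[x]>%VS (proj_point_subproof x0).

Definition homogeneous (S : set {mpoly K[k]}) : Prop :=
  forall G, S G -> exists d : nat, G \is d.-homog.

(* Only meant for families S with [homogeneous S]: then vanishing on the line
   L amounts to vanishing at one nonzero vector of L. *)
Definition zeros (S : set {mpoly K[k]}) : set proj :=
  [set L : proj | forall G (x : 'rV[K]_k), S G -> x \in val L -> G.@[x 0] = 0].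

Definition zclosed (Z : set proj) : Prop :=
  exists S, homogeneous S /\ Z = zeros S.

Definition zclosure (A : set proj) : set proj :=
  [set L : proj | forall B, zclosed B -> A `<=` B -> B L].

Definition zirreducible (Z : set proj) : Prop :=
  Z !=set0 /\
  forall A B, zclosed A -> zclosed B -> Z `<=` A `|` B ->
    Z `<=` A \/ Z `<=` B.

Definition irreducible_component (X Z : set proj) : Prop :=
  [/\ zirreducible Z, Z `<=` X &
      forall Z', zirreducible Z' -> Z' `<=` X -> Z `<=` Z' -> Z' = Z].

(* Z 0 < Z 1 < ... < Z d, all of them irreducible closed subsets of X that
   contain the point L. *)
Definition irr_chain (X : set proj) (L : proj) (d : nat) (Z : nat -> set proj) :
    Prop :=
  (forall i, (i <= d)%N ->
     [/\ zclosed (Z i), zirreducible (Z i), Z i L & Z i `<=` X]) /\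
  (forall i, (i < d)%N -> Z i `<` Z i.+1).

(* d is the dimension of X at L, i.e. the Krull dimension of the local ring:
   primes of the local ring correspond to irreducible closed subsets through
   the point. *)
Definition dim_at (X : set proj) (L : proj) (d : nat) : Prop :=
  (exists Z, irr_chain X L d Z) /\
  (forall e Z, irr_chain X L e Z -> (e <= d)%N).

(* T is the subspace of all v killed by the differentials, at the points of
   the line L, of the equations G in S. As T_L P(K^k) = Hom(L, K^k / L), the
   Zariski tangent space at L of the scheme defined by S is Hom(L, T / L). *)
Definition tangent_cone (S : set {mpoly K[k]}) (L : proj)
    (T : {vspace 'rV[K]_k}) : Prop :=
  forall v, v \in T <->
    forall G (x : 'rV[K]_k), S G -> x \in val L -> \sum_(i < k) (G^`M(i)).@[x 0] * v 0 i = 0.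

(* The closed subscheme defined by S is smooth at its point L: its Zariski
   tangent space T / L has the dimension of the scheme at L. *)
Definition smooth_at (S : set {mpoly K[k]}) (L : proj) : Prop :=
  zeros S L /\
  exists T d, [/\ tangent_cone S L T, dim_at (zeros S) L d &
                  \dim T = (\dim (val L) + d)%N].

End Projective.

Definition monomials (N d : nat) : {set 'X_{1..N < d.+1}} :=
  [set m : 'X_{1..N < d.+1} | mdeg m == d]%SET.

Definition nforms (N d : nat) : nat := #|monomials N d|.

Definition monom (N d : nat) (i : 'I_(nforms N d)) : 'X_{1..N} :=
  bmnm (enum_val i).

Definition coefs (A : comNzRingType) (N d : nat) (P : {mpoly A[N]}) :
    'rV[A]_(nforms N d) :=
  \row_i P@_(monom i).

(* The form with indeterminate coefficients; the indeterminate 'X_i is the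
   i-th coordinate function on the space of forms. *)
Definition generic_form (A : comNzRingType) (N d : nat) :
    {mpoly {mpoly A[nforms N d]}[N]} :=
  \sum_(i < nforms N d) 'X_i *: 'X_[monom i].

(* The space W of n x n matrices has the n * n coordinates given by mxvec. The
   ring A is arbitrary so that the equations E_{f,u,v} may be computed on the
   generic form, whose coefficients are polynomials. *)

Section Equations.
Context (A : comNzRingType) (n : nat).
Implicit Types (u v w : 'M[A]_n) (P : {mpoly A[n * n]}).

Definition dirderiv w P : {mpoly A[n * n]} :=
  \sum_(i < n * n) mxvec w 0 i *: P^`M(i).

Definition hess_det (f : (2 * n + 1).-tuple 'M[A]_n) P : {mpoly A[n * n]} :=
  \det (\matrix_(i < 2 * n + 1, j < 2 * n + 1)
          dirderiv (tnth f i) (dirderiv (tnth f j) P)).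

(* P(x u + y v), a polynomial in x = 'X_0 and y = 'X_1. *)
Definition restrict u v P : {mpoly A[2]} :=
  P \mPo [tuple mxvec u 0 i *: 'X_ord0 + mxvec v 0 i *: 'X_ord_max | i < n * n].

Definition coef_xy (a b : nat) (p : {mpoly A[2]}) : A :=
  p@_(U_(ord0) *+ a + U_(ord_max) *+ b)%MM.

(* The truncated differences below are only meaningful for n >= 2, which
   holds as soon as W has a subspace of dimension 2n+1. In the inner sum
   r <= j_1 + ... + j_r = i - n + 1, so that r ranges over a finite set. *)
Definition eqE (f : (2 * n + 1).-tuple 'M[A]_n) u v P : A :=
  let e := ((2 * n + 1) * (n - 2))%N in
  let p j := coef_xy j (n - j) (restrict u v P) in
  let q i := coef_xy i (e - i) (restrict u v (hess_det f P)) in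
  \sum_((n - 1)%N <= i < e.+1) \sum_(0 <= r < (i - (n - 1)).+1)
    \sum_(j : {ffun 'I_r -> 'I_n.+1} |
            [forall s, 0 < j s]%N && (\sum_s j s == i - (n - 1))%N)
      (-1) ^+ r * q i * (\prod_s p (n - j s)%N) * p n ^+ (e - (n - 1) - r).

End Equations.

Section Dual.
Context (K : fieldType) (n : nat).

(* The equations of the scheme Dual_{2n-2,n,n^2}. A free family f is the same
   thing as a basis of a subspace F (its span). *)
Definition dual_eqs : set {mpoly K[nforms (n * n) n]} :=
  [set G | exists (f : (2 * n + 1).-tuple 'M[K]_n) (u v : 'M[K]_n),
     [/\ free f, free [:: u; v] &
         G = eqE (map_tuple (map_mx (@mpolyC _ _)) f)
                 (map_mx (@mpolyC _ _) u) (map_mx (@mpolyC _ _) v)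
                 (generic_form K (n * n) n)]].

Definition detpoly : {mpoly K[n * n]} :=
  \det (\matrix_(i < n, j < n) 'X_(mxvec_index i j)).

(* (g . P)(w) = P(g^-1 w) for g in GL(W). *)
Definition lin_act (g : 'M[K]_(n * n)) (P : {mpoly K[n * n]}) :
    {mpoly K[n * n]} :=
  P \mPo [tuple \sum_(j < n * n) invmx g i j *: 'X_j | i < n * n].

(* Scalar matrices act trivially on the projective space, so that orbits of
   PGL(W) are orbits of GL(W). *)
Definition det_orbit : set (proj K (nforms (n * n) n)) :=
  [set L : proj K (nforms (n * n) n) | exists2 g : 'M[K]_(n * n), g \in unitmx &
     val L = <[coefs n (lin_act g detpoly)]>%VS].

Lemma detpoly_homog : detpoly \is n.-homog.
Proof.
apply: rpred_sum => s _; rewrite -signr_odd mulr_sign.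
have h : \prod_(i < n) (\matrix_(i, j) 'X_(mxvec_index i j)
    : 'M[{mpoly K[n * n]}]_n) i (s i) \is n.-homog.
  rewrite [X in _ \is X.-homog](_ : n = (\sum_(i < n) 1)%N); last first.
    by rewrite sum1_card card_ord.
  elim/big_rec2: _ => [|i y1 y2 _ h]; first exact: dhomog1.
  by rewrite mxE; apply: dhomogM => //; rewrite dhomogX /= mdeg1.
by case: ifP => _ //; rewrite rpredN.
Qed.

Lemma coefs_detpoly_neq0 : coefs n detpoly != 0.
Proof.
apply/negP => /eqP c0.
have d0 : detpoly = 0.
  apply/mpolyP => m; rewrite mcoeff0.
  have [mn|mn] := eqVneq (mdeg m) n; last first.
    exact: dhomog_nemf_coeff detpoly_homog mn.
  have mlt : (mdeg m < n.+1)%N by rewrite mn.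
  have mM : BMultinom mlt \in monomials (n * n) n by rewrite inE /= mn.
  have := congr1 (fun M : 'rV_(nforms (n * n) n) => M 0 (enum_rank_in mM (BMultinom mlt))) c0.
  by rewrite !mxE /monom enum_rankK_in.
have : (detpoly).@[(mxvec (1%:M : 'M[K]_n)) 0] = 1.
  rewrite /detpoly -det_map_mx -[RHS](det1 K n); congr (\det _).
  by apply/matrixP => i j; rewrite !mxE /= mevalXU mxvecE mxE.
by rewrite d0 meval0 => /eqP; rewrite eq_sym oner_eq0.
Qed.

Definition det_point : proj K (nforms (n * n) n) :=
  proj_point coefs_detpoly_neq0.

End Dual.

Arguments dual_eqs K n : clear implicits.
Arguments det_orbit K n : clear implicits.
Arguments det_point K n : clear implicits.

(* Main.v *)
(* The dimension of the scheme at [det] is squeezed between its orbit and its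
   tangent space. Specialization along the generic points of a chain of
   irreducible closed sets through [det] yields independent tangent vectors, so
   that a chain inside the scheme is shorter than the dimension of the affine
   tangent space T at det. In the orbit closure, linear families of substitutions
   give a chain whose length is, up to the same shift, the rank of the map
   A |-> d/ds det o (1 + s A). Hence it suffices that T is the image of this map;
   it contains the image because the Hessian of det has rank at most 2n at a
   singular matrix, so that the orbit of det lies in the scheme.

   Let P be in T. The equations expanded to first order along lines through
   diagonal matrices of corank one, on which det is X (X + 1)^(n - 1) up to a
   scalar, show that P vanishes on the matrices of rank at most n - 2. By torus
   weights P may be assumed homogeneous in each row and in each column. If two
   rows have degree 0 then P = 0, and polarization reduces the other cases to
   degree 1 in every row and column: P = \sum_s c_s \prod_r X_(r, s r). As P
   vanishes on permutation matrices altered by all-ones blocks, (-1)^s c_s is of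
   the form \sum_r D_(r, s r), i.e. P = \sum_(i, j) D_(i, j) X_(i, j) d det / d X_(i, j). *)

From HB Require Import structures.
Require Import Defs.
From mathcomp Require Import all_boot all_order all_fingroup all_algebra.
From mathcomp Require Import reals complex.
From mathcomp Require Import boolp classical_sets mpoly ring_quotient spectral mxred ring zify.

Set Implicit Arguments.
Unset Strict Implicit.
Unset Printing Implicit Defensive.

Import GRing.Theory Num.Theory.
Local Open Scope ring_scope.

(** * Derivations and the Jacobian bound *)

(** Chains become linear algebra through derivations: in characteristic zero, partial derivations
    with respect to elements separating consecutive primes extend to the residue field of the
    smallest prime, and their values on the coordinates are tangent vectors at its generic point.
    The count is made on affine cones, whose vertex gives one more prime; hence the shift by one.
    The equations are exploited through a frame in which the Hessian of det along the line is
    diagonal: 2n entries are multiples of (X + 1)^(n - 2), and a single one, in the direction nu =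
    E_ba + sg E_ab, is a multiple of X (X + 1)^(n - 3). Modulo det, a first-order variation P enters
    only through its second derivative along nu and its own value, both at X = 0. The coefficient of
    X^(n - 1) in the remainder gives (d/dnu)^2 P (v) + (2 sg / s) P (v) = 0, where v is diagonal of
    corank one with one entry s. The terms odd in sg give a relation polynomial in s, and s = 0
    forces P to vanish at a matrix of corank two. *)

Section MpolyInd.
Context (n : nat) (R : comNzRingType) (P : {mpoly R[n]} -> Prop).
Hypotheses (PC : forall c, P c%:MP) (PX : forall i, P 'X_i).
Hypotheses (PD : forall p q, P p -> P q -> P (p + q)).
Hypotheses (PM : forall p q, P p -> P q -> P (p * q)).

Lemma mpoly_ring_ind p : P p.
Proof.
rewrite [p]mpolyE; elim/big_ind: _ => [||m _]; first by rewrite -mpolyC0.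
  by move=> x y; apply: PD.
rewrite -mul_mpolyC; apply: PM => //; rewrite mpolyXE_id.
elim/big_ind: _ => [||i _]; first by rewrite -mpolyC1.
  by move=> x y; apply: PM.
elim: (m i) => [|e IH]; first by rewrite expr0 -mpolyC1.
by rewrite exprS; apply: PM.
Qed.

End MpolyInd.

Lemma mmap_comp_rmorph (n : nat) (R S T : comNzRingType) (f : {rmorphism R -> S})
    (h : 'I_n -> S) (g : {rmorphism S -> T}) (g' : {rmorphism R -> T})
    (h' : 'I_n -> T) :
  (forall c, g (f c) = g' c) -> (forall i, g (h i) = h' i) ->
  forall p, g (mmap f h p) = mmap g' h' p.
Proof.
move=> gf gh; apply: mpoly_ring_ind => [c|i|p q|p q].
- by rewrite !mmapC gf.
- by rewrite !mmapX !mmap1U gh.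
- by rewrite !mmapD rmorphD => -> ->.
- by rewrite !rmorphM => -> ->.
Qed.

Lemma rmorph_mpolyE (n : nat) (R S : comNzRingType)
    (g : {rmorphism {mpoly R[n]} -> S}) (g' : {rmorphism R -> S}) (h' : 'I_n -> S) :
  (forall c, g c%:MP = g' c) -> (forall i, g 'X_i = h' i) ->
  forall p, g p = mmap g' h' p.
Proof.
move=> gf gh; apply: mpoly_ring_ind => [c|i|p q|p q].
- by rewrite mmapC gf.
- by rewrite mmapX mmap1U gh.
- by rewrite mmapD rmorphD => -> ->.
- by rewrite !rmorphM => -> ->.
Qed.

Lemma mderivXU (n : nat) (R : comNzRingType) (i j : 'I_n) :
  ('X_i : {mpoly R[n]})^`M(j) = (i == j)%:R.
Proof.
rewrite mderivX mnm1E; case: eqP => [->|_]; last by rewrite scale0r.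
by rewrite -[X in (X - _)%MM]add0m addmK mpolyX0 scale1r.
Qed.

(** Derivations are taken along [ev], with values in F seen as a B-module, so that a subring of F
    can be represented by any ring mapping onto it. *)
Definition derivation (B F : comNzRingType) (ev D : B -> F) : Prop :=
  (forall a b, D (a + b) = D a + D b) /\
  (forall a b, D (a * b) = ev a * D b + ev b * D a).

Section Derivation.
Context (B F : comNzRingType) (ev : {rmorphism B -> F}) (D : B -> F).
Hypothesis hD : derivation ev D.

Lemma dvnD a b : D (a + b) = D a + D b. Proof. exact: hD.1. Qed.
Lemma dvnM a b : D (a * b) = ev a * D b + ev b * D a. Proof. exact: hD.2. Qed.
Lemma dvn0 : D 0 = 0.
Proof. by apply: (addrI (D 0)); rewrite -dvnD !addr0. Qed.
Lemma dvn1 : D 1 = 0.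
Proof.
by apply: (addrI (D 1)); rewrite addr0 -{3}[1]mulr1 dvnM rmorph1 !mul1r.
Qed.
Lemma dvnN a : D (- a) = - D a.
Proof. by apply/eqP; rewrite -addr_eq0 -dvnD addNr dvn0. Qed.
Lemma dvnB a b : D (a - b) = D a - D b.
Proof. by rewrite dvnD dvnN. Qed.
Lemma dvn_sum I (r : seq I) (P : pred I) G :
  D (\sum_(i <- r | P i) G i) = \sum_(i <- r | P i) D (G i).
Proof.
by elim/big_rec2: _ => [|i x y _ <-]; rewrite ?dvn0 ?dvnD.
Qed.

(** The chain rule for a derivation that kills the constants; first-order expansions of substituted
    polynomials are computed with it. *)
Lemma dvn_mmap (K : comNzRingType) (k : nat) (kap : {rmorphism K -> B})
    (b : 'I_k -> B) (g : {mpoly K[k]}) :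
  (forall c, D (kap c) = 0) ->
  D (mmap kap b g) = \sum_j ev (mmap kap b g^`M(j)) * D (b j).
Proof.
move=> Dk; move: g; apply: mpoly_ring_ind => [c|i|p q IHp IHq|p q IHp IHq].
- rewrite mmapC Dk big1 // => j _.
  by rewrite mderivC mmap0 rmorph0 mul0r.
- rewrite mmapX mmap1U (bigD1 i) //= big1 ?addr0 => [|j ji].
    by rewrite mderivXU eqxx rmorph1 rmorph1 mul1r.
  by rewrite mderivXU eq_sym (negbTE ji) !rmorph0 mul0r.
- rewrite mmapD dvnD IHp IHq -big_split /=; apply: eq_bigr => j _.
  by rewrite mderivD mmapD rmorphD mulrDl.
- rewrite rmorphM dvnM IHp IHq !mulr_sumr -big_split /=.
  apply: eq_bigr => j _.
  rewrite mderivM mmapD !rmorphM rmorphD !rmorphM mulrDl addrC.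
  by congr (_ + _); rewrite !mulrA // [X in _ = X * _]mulrC.
Qed.

End Derivation.

Section Extend.
Context (B : idomainType) (F : fieldType) (ev : {rmorphism B -> F}) (t : F).
Hypothesis char0 : forall n, n.+1%:R != 0 :> F.

Definition evpoly : {poly B} -> F :=
  horner_morph (fun a => mulrC t (ev a) : GRing.comm t (ev a)).
HB.instance Definition _ := GRing.RMorphism.on evpoly.

Lemma evpolyE p : evpoly p = (map_poly ev p).[t]. Proof. by []. Qed.

Lemma evpolyC c : evpoly c%:P = ev c.
Proof. by rewrite evpolyE map_polyC hornerC. Qed.

Lemma evpolyX : evpoly 'X = t.
Proof. by rewrite evpolyE map_polyX hornerX. Qed.

(** The extension of D to B[X], along X |-> t, that sends X to w. *)
Definition dpoly (D : B -> F) (w : F) (p : {poly B}) : F :=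
  (map_poly D p).[t] + w * (map_poly ev p)^`().[t].

Section OneDerivation.
Variable D : B -> F.
Hypothesis hD : derivation ev D.

Lemma coef_mapD p i : (map_poly D p)`_i = D p`_i.
Proof. by rewrite coef_map_id0 // (dvn0 hD). Qed.

Lemma dpoly_derivation w : derivation evpoly (dpoly D w).
Proof.
split=> p q; rewrite /dpoly.
  have -> : map_poly D (p + q) = map_poly D p + map_poly D q.
    by apply/polyP=> i; rewrite coefD !coef_mapD coefD (dvnD hD).
  by rewrite rmorphD /= derivD !hornerD mulrDr addrACA.
have -> : map_poly D (p * q) = map_poly ev p * map_poly D q + map_poly ev q * map_poly D p.
  apply/polyP=> i; rewrite [map_poly ev q * _]mulrC coefD coef_mapD !coefM.
  rewrite (dvn_sum hD) -big_split /=.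
  apply: eq_bigr => j _.
  by rewrite !coef_mapD !coef_map (dvnM hD) [ev q`_ _ * _]mulrC.
rewrite !evpolyE rmorphM /= derivM !hornerD !hornerM; ring.
Qed.

Lemma dpolyC w c : dpoly D w c%:P = D c.
Proof.
rewrite /dpoly map_polyC /= derivC horner0 mulr0 addr0.
have -> : map_poly D c%:P = (D c)%:P.
  by apply/polyP => i; rewrite coef_mapD !coefC; case: eqP; rewrite ?(dvn0 hD).
by rewrite hornerC.
Qed.

(* Either t is transcendental over ev B, or w is read off a relation g of
   minimal degree, whose derivative does not vanish at t; pseudo-division by
   g shows that the choice is consistent. *)
Lemma dpoly_extend : (forall b, ev b = 0 -> D b = 0) ->
  exists w, forall p, evpoly p = 0 -> dpoly D w p = 0.
Proof.
move=> Dker.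
have small p : map_poly ev p = 0 -> forall w, dpoly D w p = 0.
  move=> p0 w; rewrite /dpoly p0 deriv0 horner0 mulr0 addr0.
  have -> : map_poly D p = 0.
    apply/polyP=> i; rewrite coef_mapD coef0 Dker //.
    by have := congr1 (fun q : {poly F} => q`_i) p0; rewrite coef_map coef0.
  by rewrite horner0.
pose Rel m := `[< exists p, [/\ evpoly p = 0, map_poly ev p != 0 &
                              size (map_poly ev p) = m] >].
have [ex|nex] := pselect (exists m, Rel m); last first.
  exists 0 => p p0; apply: small; apply/eqP/negPn/negP => pn0.
  by apply: nex; exists (size (map_poly ev p)); apply/asboolP; exists p.
case: (ex_minnP ex) => m /asboolP[g0 [g0t g0n g0s]] mmin.
(* Truncation drops the top coefficients of g0 that [ev] kills, so that g keeps its size under [ev]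
   and its leading coefficient is outside the kernel. *)
pose g := \poly_(i < m) g0`_i.
have eg : map_poly ev g = map_poly ev g0.
  apply/polyP => i; rewrite !coef_map coef_poly; case: ltnP => // im.
  by rewrite -coef_map (@nth_default _ _ (map_poly ev g0)) ?g0s ?raddf0.
have m0 : (0 < m)%N by rewrite -g0s size_poly_gt0.
have lg : ev g0`_m.-1 != 0.
  by rewrite -coef_map -g0s -lead_coefE lead_coef_eq0.
have sg : size g = m.
  apply/eqP; rewrite eqn_leq size_poly leqNgt; apply/negP => lt.
  have lt' : (size g <= m.-1)%N by rewrite -ltnS prednK.
  by move: lg; rewrite -coef_map -eg coef_map (nth_default _ lt') raddf0 eqxx.
have small_t p : evpoly p = 0 -> (size (map_poly ev p) < m)%N -> map_poly ev p = 0.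
  move=> pt ps; apply/eqP/negPn/negP => pn.
  have : Rel (size (map_poly ev p)) by apply/asboolP; exists p.
  by move/mmin; rewrite leqNgt ps.
have lgc : lead_coef g = g0`_m.-1.
  by rewrite lead_coefE sg coef_poly; case: ltnP => //; rewrite leqNgt ltn_predL m0.
have gt : evpoly g = 0 by rewrite evpolyE eg.
have g't : evpoly g^`() != 0.
  apply/eqP => g't.
  have : map_poly ev g^`() = 0.
    apply: small_t => //; rewrite -deriv_map eg -g0s; apply: lt_size_deriv.
    exact: g0n.
  move=> /(congr1 (fun q : {poly F} => q`_m.-2)); rewrite coef_map coef_deriv coef0.
  have m1 : (1 < m)%N.
    rewrite ltnNge; apply/negP => m1; have sz1 : size (map_poly ev g0) = 1%N.
      by apply/eqP; rewrite g0s eqn_leq m1 m0.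
    have [c cn cE] := size_poly1P _ (introT eqP sz1).
    by move: g0t; rewrite evpolyE cE hornerC => /eqP; rewrite (negbTE cn).
  rewrite (_ : m.-2.+1 = m.-1); last by case: (m) m1 => [|[]].
  rewrite -[in LHS]sg -lead_coefE lgc sg raddfMn /= -mulr_natr => /eqP.
  rewrite mulf_eq0 (negbTE lg) /=.
  by case: (m) m1 => [|[|m']] // _; rewrite (negbTE (char0 _)).
pose w := - (map_poly D g).[t] / evpoly g^`().
have hw := dpoly_derivation w.
have Dg : dpoly D w g = 0.
  by rewrite /dpoly deriv_map -evpolyE /w divfK // subrr.
exists w => h ht.
have /(congr1 (dpoly D w)) := Pdiv.Idomain.divp_eq h g.
have rt : evpoly (h %% g) = 0.
  have := congr1 evpoly (Pdiv.Idomain.divp_eq h g).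
  rewrite rmorphD rmorphM /= gt mulr0 add0r -mul_polyC rmorphM /= ht mulr0.
  by move=> <-.
have r0 : map_poly ev (h %% g) = 0.
  apply: small_t => //; apply: leq_ltn_trans (size_poly _ _) _.
  by rewrite -sg Pdiv.Idomain.ltn_modp -size_poly_gt0 sg.
rewrite (dvnD hw) (dvnM hw) /= gt Dg !(mulr0, mul0r) add0r (small _ r0) add0r.
rewrite -mul_polyC (dvnM hw) /= ht mul0r addr0 evpolyC lgc rmorphXn.
move=> /eqP; rewrite mulf_eq0 expf_eq0 (negbTE lg) andbF /=.
by move/eqP.
Qed.

End OneDerivation.
End Extend.

(** Vanishing on the kernel of [ev] means that D l descends to the image of [ev]; the pair (B, ev)
    stands for this subring of F. *)
Definition ext_derivs (B : idomainType) (F : fieldType) (r : nat)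
    (ev : B -> F) (D : 'I_r -> B -> F) : Prop :=
  forall l, derivation ev (D l) /\ forall b, ev b = 0 -> D l b = 0.

(** The elements of xs are adjoined one at a time: B is replaced by B[X] with X sent to the next
    element, be it algebraic or transcendental over the image. *)
Lemma ext_derivs_seq (F : fieldType) (r : nat) (xs : seq F)
    (B : idomainType) (ev : {rmorphism B -> F}) (D : 'I_r -> B -> F) :
  (forall n, n.+1%:R != 0 :> F) -> ext_derivs ev D ->
  exists (B' : idomainType) (j : {rmorphism B -> B'}) (ev' : {rmorphism B' -> F})
         (D' : 'I_r -> B' -> F),
    [/\ ext_derivs ev' D', forall b, ev' (j b) = ev b,
        forall l b, D' l (j b) = D l b & forall x, x \in xs -> exists b, ev' b = x].
Proof.
move=> char0; elim: xs B ev D => [|x xs IH] B ev D hD.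
  by exists B, idfun, ev, D; split.
have /fin_all_exists[w hw] l :
    exists w, forall p, evpoly ev x p = 0 -> dpoly ev x (D l) w p = 0.
  by apply: dpoly_extend => //; [exact: (hD l).1 | exact: (hD l).2].
have hP : ext_derivs (evpoly ev x) (fun l => dpoly ev x (D l) (w l)).
  move=> l; split; [exact: dpoly_derivation (hD l).1 _ | exact: hw].
have [B' [j [ev' [D' [h1 h2 h3 h4]]]]] := IH _ (evpoly ev x) _ hP.
exists B', (j \o polyC), ev', D'; split=> //.
- by move=> b /=; rewrite h2 -(evpolyC ev x).
- by move=> l b /=; rewrite h3 (dpolyC x (hD l).1).
move=> y; rewrite inE => /predU1P[->|/h4//].
by exists (j 'X); rewrite h2 -[RHS](evpolyX ev x).
Qed.

Section TangentVectors.
Context (K F : fieldType) (k r : nat) (iota : {rmorphism {mpoly K[k]} -> F}).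
Context (B : idomainType) (kap : {rmorphism K -> B}) (mu : {rmorphism B -> {mpoly K[k]}}).
Context (D : 'I_r -> B -> F) (b : 'I_r -> B).
Hypothesis char0 : forall n, n.+1%:R != 0 :> F.
Hypothesis mukap : forall c, mu (kap c) = c%:MP.
Hypothesis inj : forall a, iota (mu a) = 0 -> a = 0.
Hypothesis hD : forall l, derivation (iota \o mu) (D l).
Hypothesis Dkap : forall l c, D l (kap c) = 0.
Hypothesis Db : forall l i, D l (b i) = (l == i)%:R.

(** The derivations are extended to a ring whose image in F contains every coordinate iota 'X_j, and
    the rows of W are their values on these coordinates. The chain rule gives the first equations;
    the values on the b i show that the rows are independent. *)
Lemma tangent_vectors : exists W : 'M[F]_(r, k),
  (forall g, iota g = 0 -> forall l, \sum_j iota (g^`M(j)) * W l j = 0) /\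
  (forall l i, \sum_j iota ((mu (b i))^`M(j)) * W l j = (l == i)%:R).
Proof.
have hext : ext_derivs (iota \o mu) D.
  move=> l; split=> // a /inj ->; exact: (@dvn0 _ _ (iota \o mu) _ (hD l)).
have [B' [j [ev' [D' [h1 h2 h3 h4]]]]] :=
  ext_derivs_seq (codom (fun i => iota 'X_i)) char0 hext.
have /fin_all_exists[c hc] i : exists c, ev' c = iota 'X_i.
  by apply: h4; apply: codom_f.
pose kap' : {rmorphism K -> B'} := j \o kap.
have evc g : ev' (mmap kap' c g) = iota g.
  pose io : {rmorphism K -> F} := iota \o @mpolyC k K.
  rewrite (mmap_comp_rmorph (g' := io) (h' := fun i => iota 'X_i)) //=.
    by apply/esym/rmorph_mpolyE.
  by move=> a; rewrite h2 /= mukap.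
have Dk' l a : D' l (kap' a) = 0 by rewrite /= h3 Dkap.
have DE l g : D' l (mmap kap' c g) = \sum_i iota (g^`M(i)) * D' l (c i).
  rewrite (dvn_mmap (h1 l).1) //.
  by apply: eq_bigr => i _; rewrite evc.
exists (\matrix_(l, i) D' l (c i)); split=> [g g0 l|l i].
  transitivity (D' l (mmap kap' c g)).
    by rewrite DE; apply: eq_bigr => i _; rewrite mxE.
  by apply: (h1 l).2; rewrite evc.
transitivity (D' l (mmap kap' c (mu (b i)))).
  by rewrite DE; apply: eq_bigr => a _; rewrite mxE.
(* j (b i) and the substitution of c in mu (b i) have the same image in F, and the extended
   derivations only see this image. *)
rewrite -Db -h3; apply/eqP; rewrite -subr_eq0 -(dvnB (h1 l).1).
by apply/eqP/(h1 l).2; rewrite rmorphB /= evc h2 /= subrr.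
Qed.

(** The r tangent vectors are independent and orthogonal to r' independent gradients. *)
Lemma tangent_bound (r' : nat) (g : 'I_r' -> {mpoly K[k]}) :
  (forall i, iota (g i) = 0) ->
  row_free (\matrix_(i < r', j < k) iota ((g i)^`M(j))) ->
  (r + r' <= k)%N.
Proof.
move=> g0 /eqP rkJ; have [W [W1 W2]] := tangent_vectors.
set J := \matrix_(i, j) _ in rkJ.
have WJ : W *m J^T = 0.
  apply/matrixP=> l i; rewrite !mxE -[RHS](W1 _ (g0 i) l).
  by apply: eq_bigr => j _; rewrite !mxE mulrC.
have Wfree : \rank W = r.
  apply/eqP; apply/row_freeP.
  exists (\matrix_(j, i) iota ((mu (b i))^`M(j))).
  apply/matrixP=> l i; rewrite !mxE -W2.
  by apply: eq_bigr => j _; rewrite !mxE mulrC.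
have := mulmx0_rank_max WJ.
by rewrite mxrank_tr rkJ Wfree.
Qed.

End TangentVectors.

(** * Chains of irreducible closed sets *)

Definition prime_ideal (R : comNzRingType) (p : R -> Prop) : Prop :=
  [/\ p 0 /\ ~ p 1, forall a b, p a -> p b -> p (a + b),
      forall a b, p b -> p (a * b) & forall a b, p (a * b) -> p a \/ p b].

Section ResidueField.
Local Open Scope quotient_scope.
Context (R : comNzRingType) (p : R -> Prop).

Definition pmem of prime_ideal p : R -> bool := fun a => `[< p a >].

Context (hp : prime_ideal p).

Fact pmem_ideal : idealr_closed (pmem hp).
Proof.
have [[h0 h1] hD hM _] := hp; split; first exact/asboolP.
  by apply/asboolP.
move=> a u v /asboolP hu /asboolP hv; apply/asboolP.
by apply: hD => //; apply: hM.
Qed.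

HB.instance Definition _ := isIdealr.Build R (pmem hp) pmem_ideal.

Fact pmem_prime : prime_idealr_closed (pmem hp).
Proof.
move=> u v /asboolP; have [_ _ _ hP] := hp.
by case/hP => h; apply/orP; [left|right]; apply/asboolP.
Qed.

HB.instance Definition _ := isPrimeIdealrClosed.Build R (pmem hp) pmem_prime.

Definition residue_ring := {ideal_quot (pmem hp : prime_idealr R)}.
HB.instance Definition _ := GRing.ComNzRing.on residue_ring.

Definition residue_unit (x : residue_ring) : bool := `[< exists y, y * x = 1 >].
Definition residue_inv (x : residue_ring) : residue_ring :=
  if pselect (exists y, y * x = 1) is left h then projT1 (cid h) else x.

Fact residue_mulVx : {in residue_unit, left_inverse 1 residue_inv *%R}.
Proof.
move=> x /asboolP hx; rewrite /residue_inv; case: pselect => // h.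
by case: (cid h).
Qed.

Fact residue_unitPl (x y : residue_ring) : y * x = 1 -> residue_unit x.
Proof. by move=> yx; apply/asboolP; exists y. Qed.

Fact residue_inv_out : {in [predC residue_unit], residue_inv =1 id}.
Proof.
move=> x; rewrite inE => /negP hx; rewrite /residue_inv.
by case: pselect => // h; case: hx; apply/asboolP.
Qed.

HB.instance Definition _ := GRing.ComNzRing_hasMulInverse.Build residue_ring
  residue_mulVx residue_unitPl residue_inv_out.

Fact residue_idomain (x y : residue_ring) : x * y = 0 -> (x == 0) || (y == 0).
Proof. exact: Quotient.rquot_IdomainAxiom. Qed.

HB.instance Definition _ :=
  GRing.ComUnitRing_isIntegral.Build residue_ring residue_idomain.

End ResidueField.

(** F is the residue field of p, that is the fraction field of R / p. *)
Lemma generic_point (R : comNzRingType) (p : R -> Prop) : prime_ideal p ->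
  exists (F : fieldType) (iota : {rmorphism R -> F}), forall a, iota a = 0 <-> p a.
Proof.
move=> hp; pose pr : {rmorphism R -> residue_ring hp} := \pi_({ideal_quot (pmem hp : prime_idealr R)})%qT.
exists {fraction residue_ring hp}, (@FracField.tofrac _ \o pr) => a /=.
rewrite (rwP eqP) tofrac_eq0 -(rwP eqP).
have := Quotient.idealrBE (pmem hp : prime_idealr R) a 0; rewrite subr0 => E.
have -> : (0 : residue_ring hp) = pr 0 by rewrite rmorph0.
by split=> [/eqP|/asboolP pa]; [rewrite -E => /asboolP | apply/eqP; rewrite -E].
Qed.

(* The i-th element of a strictly decreasing chain of prime ideals separates
   consecutive primes; it is transcendental over the previous ones. *)
Lemma prime_chain_indep (K : fieldType) (k : nat) (p : nat -> {mpoly K[k]} -> Prop)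
    (r : nat) :
  (forall i, (i <= r)%N -> prime_ideal (p i)) ->
  (forall i, (i < r)%N -> forall g, p i.+1 g -> p i g) ->
  (forall i, (i < r)%N -> exists g, p i g /\ ~ p i.+1 g) ->
  exists (B : idomainType) (kap : {rmorphism K -> B})
         (mu : {rmorphism B -> {mpoly K[k]}}) (D : nat -> B -> B) (b : nat -> B),
    [/\ forall c, mu (kap c) = c%:MP,
        forall a, p r (mu a) -> a = 0,
        forall l, (l < r)%N -> derivation idfun (D l),
        forall l c, (l < r)%N -> D l (kap c) = 0 &
        forall l i, (l < r)%N -> (i < r)%N -> D l (b i) = (l == i)%:R].
Proof.
elim: r => [|r IH] hp hs hn.
  exists K, idfun, (@mpolyC k K), (fun _ _ => 0), (fun _ => 0); split=> // a pa.
  have [[_ p1] _ pM _] := hp 0%N (leqnn _).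
  apply/eqP/negPn/negP => a0; apply: p1.
  by rewrite -mpolyC1 -(mulVf a0) mpolyCM; apply: pM.
have [B [kap [mu [D [b [h1 h2 h3 h4 h5]]]]]] :
    exists (B : idomainType) (kap : {rmorphism K -> B})
         (mu : {rmorphism B -> {mpoly K[k]}}) (D : nat -> B -> B) (b : nat -> B),
    [/\ forall c, mu (kap c) = c%:MP,
        forall a, p r (mu a) -> a = 0,
        forall l, (l < r)%N -> derivation idfun (D l),
        forall l c, (l < r)%N -> D l (kap c) = 0 &
        forall l i, (l < r)%N -> (i < r)%N -> D l (b i) = (l == i)%:R].
  by apply: IH => i ir; [apply: hp; apply: leqW | apply: hs; apply: leqW | apply: hn; apply: leqW].
have [f [pf npf]] := hn r (leqnn _).
pose mu' : {rmorphism {poly B} -> {mpoly K[k]}} :=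
  horner_morph (fun a => mulrC f (mu a) : GRing.comm f (mu a)).
have mu'C c : mu' c%:P = mu c by rewrite /= /horner_morph map_polyC hornerC.
have mu'X : mu' 'X = f by rewrite /= /horner_morph map_polyX hornerX.
have cD l (lr : (l < r)%N) q i : (map_poly (D l) q)`_i = D l q`_i.
  by rewrite coef_map_id0 // (@dvn0 _ _ idfun _ (h3 l lr)).
exists {poly B}, (polyC \o kap), mu',
  (fun l => if (l < r)%N then map_poly (D l) else @deriv B),
  (fun i => if (i < r)%N then (b i)%:P else 'X).
split.
- by move=> c; rewrite [LHS]mu'C.
- have [[p0 _] pD pM pP] := hp r.+1 (leqnn _).
  have [[p0' _] pD' pM' _] := hp r (leqW (leqnn _)).
  (* As f lies in p r, the element q (f) f + c is congruent to c modulo p r; hence c = 0, and the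
     factor f, which is not in the prime p r.+1, can be cancelled. *)
  elim/poly_ind => // q c IHq; rewrite rmorphD rmorphM /= -/mu' => pq.
  rewrite [mu' 'X]mu'X [mu' c%:P]mu'C in pq.
  have c0 : c = 0.
    apply: h2; have := hs r (leqnn _) _ pq.
    have : p r (- (mu' q * f)) by rewrite -mulNr; apply: pM'.
    by move=> u1 u2; have := pD' _ _ u1 u2; rewrite addKr.
  move: pq; rewrite c0 rmorph0 addr0 => /pP[/IHq->|//].
  by rewrite mul0r addr0.
- move=> l; rewrite ltnS => lr; case: ltnP => [lt|_].
    have hl := h3 l lt; split=> u v; apply/polyP=> i.
      by rewrite coefD !cD // coefD (@dvnD _ _ idfun _ hl).
    rewrite coefD cD // [v * _]mulrC !coefM (@dvn_sum _ _ idfun _ hl) -big_split.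
    apply: eq_bigr => j _; rewrite !cD // (@dvnM _ _ idfun _ hl) /=.
    by rewrite [v`__ * _]mulrC.
  split=> u v; first exact: derivD.
  by rewrite derivM addrC /= [v * _]mulrC.
- move=> l c; rewrite ltnS => lr /=; case: ltnP => [lt|_]; last exact: derivC.
  apply/polyP => i; rewrite cD // coefC coef0; case: eqP => _; first exact: h4.
  exact: (@dvn0 _ _ idfun _ (h3 l lt)).
move=> l i; rewrite !ltnS => lr ir; case: ltnP => [lt|le].
  case: ltnP => [it|ie].
    apply/polyP => j; rewrite cD // coefC -polyC1 -polyCMn coefC.
    case: eqP => _; first exact: h5.
    exact: (@dvn0 _ _ idfun _ (h3 l lt)).
  have -> : l == i = false by apply/eqP => e; move: ie; rewrite leqNgt -e lt.
  apply/polyP => j; rewrite cD // coefX coef0; case: (j == 1)%N.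
    exact: (@dvn1 _ _ idfun _ (h3 l lt)).
  exact: (@dvn0 _ _ idfun _ (h3 l lt)).
have -> : l = r by apply/eqP; rewrite eqn_leq lr.
case: ltnP => [it|ie]; first by rewrite derivC gtn_eqF.
by rewrite derivX eqn_leq ie ir.
Qed.

Lemma poly0_all (K : numFieldType) (p : {poly K}) : (forall s, p.[s] = 0) -> p = 0.
Proof.
move=> p0; apply/eqP/negPn/negP => pn0.
have := @max_poly_roots _ p (map (fun i : nat => i%:R) (iota 0 (size p))) pn0.
rewrite size_map size_iota ltnn => h; suff : false by [].
apply: h; first by apply/allP => x _; rewrite /root p0.
rewrite map_inj_uniq ?iota_uniq // => i j /eqP.
by rewrite eqr_nat => /eqP.
Qed.

Lemma poly0_dense (K : numFieldType) (d p : {poly K}) :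
  d != 0 -> (forall s, d.[s] != 0 -> p.[s] = 0) -> p = 0.
Proof.
move=> d0 h; have /eqP : d * p = 0.
  apply: poly0_all => s; rewrite hornerM; have [->|/h->] := eqVneq d.[s] 0.
    by rewrite mul0r.
  by rewrite mulr0.
by rewrite mulf_eq0 (negbTE d0) => /eqP.
Qed.

Section Cones.
Context (K : numFieldType) (k : nat).
Implicit Types (Z A : set (proj K k)) (L M : proj K k) (g : {mpoly K[k]})
  (x : 'rV[K]_k).

Lemma proj_line M : exists2 x, x != 0 & val M = <[x]>%VS.
Proof.
have /eqP dM := valP M; exists (vpick (val M)).
  by rewrite vpick0 -dimv_eq0 dM.
apply/eqP; rewrite eq_sym eqEdim; apply/andP; split.
  by apply/subvP => v /vlineP[c ->]; apply/memvZ/memv_pick.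
by rewrite dM dim_vline vpick0 -dimv_eq0 dM.
Qed.

(** The restriction of g to the line through x. Its coefficients are the values at x of the
    homogeneous components of g, which lets inhomogeneous polynomials be tested on projective
    points. *)
Definition scal_poly g x : {poly K} := mmap (@polyC K) (fun i => x 0 i *: 'X) g.

Lemma horner_scal_poly g x c : (scal_poly g x).[c] = g.@[(c *: x) 0].
Proof.
rewrite /scal_poly.
have := @mmap_comp_rmorph k K {poly K} K (@polyC K)
  (fun i => x 0 i *: 'X) (horner_eval c) idfun ((c *: x) 0).
rewrite /= /horner_eval => -> //.
- by move=> a; rewrite hornerC.
- by move=> i; rewrite hornerZ hornerX mxE mulrC.
Qed.

Lemma coef_scal_poly g x d : (scal_poly g x)`_d = (pihomog mdeg d g).@[x 0].
Proof.
rewrite [g in LHS]mpolyE [g in RHS]mpolyE /scal_poly [mmap _ _ _]raddf_sum.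
rewrite [pihomog _ _ _]raddf_sum /= [RHS]raddf_sum coef_sum.
apply: eq_bigr => m _; rewrite linearZ /= pihomogX mmapZ mmapX mevalZ coefCM.
congr (_ * _).
rewrite (_ : mmap1 _ m = (\prod_i x 0 i ^+ m i) *: 'X^(mdeg m)).
  rewrite coefZ coefXn eq_sym; case: eqP => [e|]; last by rewrite mulr0 meval0.
  by rewrite mulr1 mevalX.
rewrite /mmap1 mdegE expr_sum -scaler_prod.
by apply: eq_bigr => i _; rewrite exprZn.
Qed.

Lemma scal_poly0P g x : (forall c, g.@[(c *: x) 0] = 0) <-> scal_poly g x = 0.
Proof.
split=> [h|h c]; last by rewrite -horner_scal_poly h horner0.
by apply: poly0_all => c; rewrite horner_scal_poly.
Qed.

Definition vanish Z g : Prop :=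
  forall M x, Z M -> x \in val M -> g.@[x 0] = 0.

Lemma vanish_line g x0 M : val M = <[x0]>%VS ->
  (forall x, x \in val M -> g.@[x 0] = 0) <-> scal_poly g x0 = 0.
Proof.
move=> hM; split=> [h|h x]; first by apply/scal_poly0P => c; apply: h; rewrite hM memvZ ?memv_line.
by rewrite hM => /vlineP[c ->]; apply: (proj2 (scal_poly0P g x0) h).
Qed.

Lemma vanish_homog_line g d x0 M : g \is d.-homog -> val M = <[x0]>%VS ->
  (forall x, x \in val M -> g.@[x 0] = 0) <-> g.@[x0 0] = 0.
Proof.
move=> gd hM; rewrite (vanish_line g hM); split=> [h|h].
  by rewrite -(scale1r x0) -horner_scal_poly h horner0.
apply/polyP => e; rewrite coef_scal_poly coef0.
have [<-|ne] := eqVneq d e; first by rewrite pihomog_dE.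
by rewrite (pihomog_ne0 ne gd) meval0.
Qed.

(** A polynomial vanishing on a line through the origin has all its homogeneous components vanishing
    there, so S may be replaced by these components. *)
Lemma zeros_zclosed (S : set {mpoly K[k]}) : zclosed (zeros S).
Proof.
exists (fun g => exists2 G, S G & exists d, g = pihomog mdeg d G); split.
  by move=> g [G _ [d ->]]; exists d; apply: pihomogP.
rewrite eqEsubset; split=> M hM G x.
  move=> [G' SG [d ->]] xM; rewrite -coef_scal_poly.
  suff -> : scal_poly G' x = 0 by rewrite coef0.
  by apply/scal_poly0P => c; apply: hM => //; apply: memvZ.
move=> SG xM; rewrite -(scale1r x) -horner_scal_poly.
suff -> : scal_poly G x = 0 by rewrite horner0.
apply/polyP => d; rewrite coef_scal_poly coef0; apply: hM => //.
by exists G => //; exists d.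
Qed.

Lemma zclosureP A L : zclosure A L <-> forall g, vanish A g -> forall x, x \in val L -> g.@[x 0] = 0.
Proof.
split=> [h g Ag|h B [S [_ ->]] AB G x SG xL].
  have := h (zeros [set g]%classic) (zeros_zclosed _).
  by move=> h1 x xL; apply: h1 => // M AM _ y -> ; apply: Ag.
by apply: h => // M y AM yM; apply: (AB M).
Qed.

Lemma sub_zclosure A : (A `<=` zclosure A)%classic.
Proof. by move=> L AL B _; apply. Qed.

Lemma zclosure_closed A : zclosed (zclosure A).
Proof.
suff -> : zclosure A = zeros (vanish A) by apply: zeros_zclosed.
rewrite eqEsubset; split=> L; first by move=> /zclosureP h g x Ag; apply: h.
by move=> h; apply/zclosureP => g Ag x; apply: h.
Qed.

Lemma zclosure_min A B : zclosed B -> (A `<=` B)%classic -> (zclosure A `<=` B)%classic.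
Proof. by move=> cB AB L; apply. Qed.

Lemma zclosure_irreducible A : zirreducible A -> zirreducible (zclosure A).
Proof.
move=> [[L AL] irr]; split; first by exists L; apply: sub_zclosure.
move=> B C cB cC h; have /irr[//|//|h1|h1] : (A `<=` B `|` C)%classic.
- by apply: subset_trans h; apply: sub_zclosure.
- by left; apply: zclosure_min.
- by right; apply: zclosure_min.
Qed.

(** On each line of Z the restrictions of a and b have product zero in K[X], so Z is covered by the
    zeros of a and those of b. *)
Lemma vanish_prime Z : zirreducible Z -> prime_ideal (vanish Z).
Proof.
move=> [[L ZL] irr]; split.
- split; first by move=> M x _ _; rewrite meval0.
  have [x x0 hL] := proj_line L.
  move=> /(_ L x ZL); rewrite hL memv_line meval1 => /(_ isT) /eqP.
  by rewrite oner_eq0.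
- by move=> a b ha hb M x ZM xM; rewrite mevalD (ha M) ?(hb M) ?addr0.
- by move=> a b hb M x ZM xM; rewrite mevalM (hb M) ?mulr0.
move=> a b hab.
have /irr : (Z `<=` zeros [set a] `|` zeros [set b])%classic.
  move=> M ZM; have [x x0 hM] := proj_line M.
  have : scal_poly a x * scal_poly b x = 0.
    rewrite -rmorphM -/(scal_poly (a * b) x).
    by apply: (proj1 (vanish_line _ hM)) => y; apply: hab.
  move/eqP; rewrite mulf_eq0 => /orP[]/eqP h; [left|right] => G y -> yM;
    exact: (proj2 (vanish_line _ hM) h).
by case=> [||h|h]; [exact: zeros_zclosed|exact: zeros_zclosed| left | right] => M x ZM xM; apply: (h M).
Qed.

Lemma vanish_zeros (S : set {mpoly K[k]}) Z : (Z `<=` zeros S)%classic ->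
  forall G, S G -> vanish Z G.
Proof. by move=> h G SG M x ZM xM; apply: (h M). Qed.

End Cones.

Lemma mderiv_derivation (k : nat) (K : comNzRingType) (v : 'I_k -> K) (i : 'I_k) :
  derivation (meval v) (fun g : {mpoly K[k]} => g^`M(i).@[v]).
Proof.
split=> a b; first by rewrite mderivD mevalD.
by rewrite mderivM mevalD !mevalM addrC [_.@[v] * b.@[v]]mulrC.
Qed.

Section UpperBound.
Context (K : numFieldType) (k : nat).
Implicit Types (Z A : set (proj K k)) (L M : proj K k) (g : {mpoly K[k]})
  (x v : 'rV[K]_k) (S : set {mpoly K[k]}).

Definition grad g x : 'rV[K]_k := \row_i g^`M(i).@[x 0].

(** The tangent cone asks for the differentials at all points of the line, whereas v is tested at x0
    only. For s <> 0 the rescaled equation G (s X) vanishes on Z too, and its gradient at x0 is s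
    times that of G at s x0; the value s = 0 follows as the pairing is polynomial in s. *)
Lemma grad_scale Z S (x0 v : 'rV[K]_k) : (Z `<=` zeros S)%classic ->
  (forall g, vanish Z g -> \sum_i (grad g x0) 0 i * v 0 i = 0) ->
  forall G c, S G -> \sum_i (grad G (c *: x0)) 0 i * v 0 i = 0.
Proof.
move=> ZS h G c SG.
pose q := \sum_i (v 0 i) *: scal_poly G^`M(i) x0.
have qE s : q.[s] = \sum_i (grad G (s *: x0)) 0 i * v 0 i.
  rewrite /q horner_sum; apply: eq_bigr => i _.
  by rewrite hornerZ horner_scal_poly mxE mulrC.
rewrite -qE (_ : q = 0) ?horner0 //.
apply: (@poly0_dense _ 'X); first by rewrite polyX_eq0.
move=> s; rewrite hornerX => s0.
pose Gs : {mpoly K[k]} := mmap (@mpolyC k K) (fun i => s *: 'X_i) G.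
have ev g x : (mmap (@mpolyC k K) (fun i => s *: 'X_i) g : {mpoly K[k]}).@[x 0] = g.@[(s *: x) 0].
  have := @mmap_comp_rmorph k K {mpoly K[k]} K (@mpolyC k K)
    (fun i => s *: 'X_i) (meval (x 0)) idfun ((s *: x) 0).
  rewrite /= => -> //.
  - by move=> a; rewrite mevalC.
  - by move=> i; rewrite mevalZ mevalXU mxE.
have /h : vanish Z Gs.
  move=> M x ZM xM; rewrite ev; apply: (vanish_zeros ZS SG ZM).
  exact: memvZ.
rewrite (eq_bigr (fun i => s * ((grad G (s *: x0)) 0 i * v 0 i))).
  by rewrite -mulr_sumr -qE => /eqP; rewrite mulf_eq0 (negbTE s0) => /eqP.
move=> i _; rewrite !mxE mulrA; congr (_ * _).
rewrite (dvn_mmap (mderiv_derivation (x0 0) i)) => [|a]; last by rewrite mderivC meval0.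
rewrite (bigD1 i) //= big1 => [|j ji].
  by rewrite mderivZ mderivXU eqxx mevalZ meval1 mulr1 addr0 ev mulrC.
by rewrite mderivZ mderivXU (negbTE ji) mevalZ meval0 !mulr0.
Qed.

Lemma row_free_addrow (r : nat) (J : 'M[K]_(r, k)) (u v : 'rV[K]_k) :
  row_free J -> v *m J^T = 0 -> v *m u^T != 0 -> row_free (col_mx J u).
Proof.
move=> Jf vJ vu; rewrite -row_leq_rank -addsmxE.
have nu : ~~ (u <= J)%MS.
  apply: contra vu => /submxP[w ->].
  by rewrite trmx_mul mulmxA vJ mul0mx.
have lt : (J < J + u)%MS.
  rewrite ltmxE addsmxSl /=; apply: contra nu => /(submx_trans _); apply.
  exact: addsmxSr.
by have := rank_ltmx lt; rewrite (eqP Jf) addn1.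
Qed.

(** A maximal independent family of gradients: a further gradient that does not kill v would enlarge
    it. *)
Lemma ker_tangent (P : {mpoly K[k]} -> Prop) (x0 : 'rV[K]_k) :
  exists r (g : 'I_r -> {mpoly K[k]}),
    [/\ forall i, P (g i), row_free (\matrix_(i < r) grad (g i) x0) &
        forall v : 'rV[K]_k, v *m (\matrix_(i < r) grad (g i) x0)^T = 0 ->
          forall h, P h -> \sum_i (grad h x0) 0 i * v 0 i = 0].
Proof.
pose Q r := `[< exists g : 'I_r -> {mpoly K[k]},
  (forall i, P (g i)) /\ row_free (\matrix_(i < r) grad (g i) x0) >].
have ex : exists r, Q r.
  exists 0%N; apply/asboolP; exists (fun _ => 0); split; first by case.
  by rewrite -row_leq_rank.
have bd r : Q r -> (r <= k)%N.
  by move=> /asboolP[g [_ /eqP <-]]; apply: rank_leq_col.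
case: (ex_maxnP ex bd) => r /asboolP[g [Pg gf]] rmax.
exists r, g; split=> // v vJ h Ph; apply/eqP/negPn/negP => hv.
suff : Q (r + 1)%N by move/rmax; rewrite addn1 ltnn.
apply/asboolP; exists (fun i => match split i with inl a => g a | inr _ => h end).
split; first by move=> i; case: (split i).
have -> : (\matrix_(i < r + 1) grad match split i with inl a => g a | inr _ => h end x0)
   = col_mx (\matrix_(i < r) grad (g i) x0) (grad h x0).
  apply/matrixP => i j; rewrite !mxE; case: (split i) => a; rewrite !mxE //.
apply: (row_free_addrow gf vJ).
apply: contra hv => /eqP /matrixP /(_ 0 0); rewrite !mxE => e.
by rewrite -[X in _ == X]e; apply/eqP/eq_bigr => i _; rewrite !mxE mulrC.
Qed.

(** Let r be the maximal number of independent gradients at x0 of elements of the ideal of Z e.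
    Their common kernel lies in T, so k - r <= dim T. They stay independent at the generic point of
    Z e, where the chain gives e + 1 tangent vectors, so e + 1 + r <= k. *)
Lemma irr_chain_bound S L (T : {vspace 'rV[K]_k}) e (Z : nat -> set (proj K k)) :
  tangent_cone S L T -> irr_chain (zeros S) L e Z -> (e < \dim T)%N.
Proof.
move=> hT [hZ hlt].
have [x0 x00 hL] := proj_line L.
have x0L : x0 \in val L by rewrite hL memv_line.
(* The ideal of the origin, the vertex of the cone, is put in front of the chain; it accounts for
   the strict inequality. *)
pose p i g := if i is i'.+1 then vanish (Z i') g else g.@[(0 : 'rV[K]_k) 0] = 0.
have pp i : (i <= e.+1)%N -> prime_ideal (p i).
  case: i => [_|i ie] /=; last by apply: vanish_prime; have [] := hZ i ie.
  rewrite /p; split; first by rewrite meval0 meval1; split=> //; apply/eqP/oner_neq0.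
  - by move=> a b ha hb; rewrite mevalD ha hb addr0.
  - by move=> a b hb; rewrite mevalM hb mulr0.
  - by move=> a b; rewrite mevalM => /eqP; rewrite mulf_eq0 => /orP[]/eqP; [left|right].
have ps i : (i < e.+1)%N -> forall g, p i.+1 g -> p i g.
  case: i => [_|i ie] g /= h.
    by apply: (h L); [have [] := hZ 0%N (leq0n _) | apply: mem0v].
  by move=> M x ZM; apply: (h M); apply: (hlt i ie).1.
have pn i : (i < e.+1)%N -> exists g, p i g /\ ~ p i.+1 g.
  case: i => [_|i ie] /=.
    have [j xj] : exists j, x0 0 j != 0.
      apply/existsP; apply: contraNT x00; rewrite negb_exists => /forallP h.
      by apply/eqP/rowP => j; rewrite !mxE; apply/eqP/negPn/h.
    exists 'X_j; split; first by rewrite mevalXU mxE.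
    move=> /(_ L x0) h; move: xj; rewrite -[x0 0 j](mevalXU (x0 0)) h ?eqxx //.
    by have [] := hZ 0%N (leq0n _).
  have [_ nsub] := hlt i ie; have [[SZ [_ Zi]] _ _ _] := hZ i (ltnW ie).
  apply: contrapT => hne; apply: nsub => M ZM; rewrite Zi => G x SG xM.
  apply: contrapT => Gx; apply: hne; exists G; split.
    by apply: (@vanish_zeros _ _ SZ) => //; rewrite Zi.
  by move=> /(_ M x ZM xM).
have [B [kap [mu [D [b [h1 h2 h3 h4 h5]]]]]] := prime_chain_indep pp ps pn.
have [F [iota iotaP]] := generic_point (pp e.+1 (leqnn _)).
have char0 n : n.+1%:R != 0 :> F.
  rewrite -(rmorph_nat iota) -(rmorph_nat (@mpolyC k K)); apply/eqP => /iotaP.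
  have [[_ p1] _ pM _] := pp e.+1 (leqnn _).
  move=> h; apply: p1; rewrite -mpolyC1 -(@mulVf _ (n.+1%:R : K)) ?pnatr_eq0 //.
  by rewrite mpolyCM; apply: pM.
have [r [g [Pg gf gker]]] := ker_tangent (vanish (Z e)) x0.
set J := \matrix_i _ in gf gker.
have [C JC] := row_freeP gf.
pose Jp : 'M[{mpoly K[k]}]_(r, k) := \matrix_(i, j) (g i)^`M(j).
have ZeL : Z e L by have [] := hZ e (leqnn _).
have Jf : row_free (\matrix_(i < r, j < k) iota ((g i)^`M(j))).
  apply/row_freeP.
  set J' := \matrix_(i, j) _; pose C' := map_mx iota (map_mx (@mpolyC k K) C).
  (* A right inverse of J gives an r x r determinant equal to 1 at x0; it is therefore not in the
     ideal of Z e and stays nonzero at the generic point. *)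
  suff dn0 : \det (J' *m C') != 0.
    by exists (C' *m invmx (J' *m C')); rewrite mulmxA mulmxV // unitmxE unitfE.
  have -> : J' = map_mx iota Jp by apply/matrixP => i j; rewrite !mxE.
  rewrite -map_mxM det_map_mx; apply/eqP => /iotaP /(_ L x0 ZeL x0L).
  rewrite -det_map_mx map_mxM /= -map_mx_comp.
  rewrite (_ : map_mx _ Jp = J); last by apply/matrixP => i j; rewrite !mxE.
  rewrite (_ : map_mx _ C = C); last by apply/matrixP => i j; rewrite !mxE /= mevalC.
  by rewrite JC det1 => /eqP; rewrite oner_eq0.
have rk : (e.+1 + r <= k)%N.
  apply: (@tangent_bound K F k e.+1 iota B kap mu (fun l => iota \o mu \o D l) b) Jf => //.
  - by move=> a /iotaP; apply: h2.
  - move=> l; have hl := h3 l (ltn_ord l); split=> u v /=.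
      by rewrite (@dvnD _ _ idfun _ hl) !rmorphD.
    by rewrite (@dvnM _ _ idfun _ hl) !rmorphD !rmorphM.
  - by move=> l c; rewrite /= h4 // !rmorph0.
  - by move=> l i; rewrite /= h5 // !rmorph_nat.
  - by move=> i; apply/iotaP; apply: Pg.
pose f : 'Hom('rV[K]_k, 'rV[K]_r) := linfun (mulmxr J^T).
have kerT : (lker f <= T)%VS.
  apply/subvP => v; rewrite memv_ker lfunE /= => /eqP vJ; apply/hT.
  move=> G x SG; rewrite hL => /vlineP[c ->].
  have := @grad_scale (Z e) S x0 v _ (gker v vJ) G c SG.
  rewrite (eq_bigr (fun i => G^`M(i).@[(c *: x0) 0] * v 0 i)); first by apply; have [] := hZ e (leqnn _).
  by move=> i _; rewrite mxE.
have dk : (\dim (lker f) + \dim (limg f))%N = k.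
  rewrite -[RHS]mul1n; have := limg_ker_dim f fullv.
  by rewrite capfv dimvf dim_matrix.
have dr : (\dim (limg f) <= r)%N.
  apply: leq_trans (dimvS (subvf _)) _; rewrite dimvf dim_matrix.
  by rewrite -[X in (_ <= X)%N]mul1n leqnn.
have dT := dimvS kerT; move: dk dr dT rk.
move: (\dim (lker f)) (\dim (limg f)) (\dim T) => a b' c.
move=> dk dr dT rk.
rewrite -(leq_add2r r); apply: leq_trans rk _; rewrite -dk.
by apply: leq_add.
Qed.

End UpperBound.

(** * Closures of parametrized families *)

Lemma digits_inj (b n : nat) (f g : 'I_n -> nat) :
  (forall i, (f i < b)%N) -> (forall i, (g i < b)%N) ->
  (\sum_i f i * b ^ i = \sum_i g i * b ^ i)%N -> f =1 g.
Proof.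
elim: n f g => [|n IH] f g fb gb; first by move=> _ [].
rewrite !big_ord_recl /= !expn0 !muln1.
have shift (h : 'I_n.+1 -> nat) :
    (\sum_(i < n) h (lift ord0 i) * b ^ bump 0 i = b * \sum_(i < n) h (lift ord0 i) * b ^ i)%N.
  rewrite big_distrr /=; apply: eq_bigr => i _.
  by rewrite /bump /= add1n expnS mulnCA.
rewrite !shift => e.
have b0 : (0 < b)%N by apply: leq_ltn_trans (fb ord0).
have e0 : f ord0 = g ord0.
  have := congr1 (modn^~ b) e.
  by rewrite ![(b * _)%N]mulnC !(addnC _ (_ * b)%N) !modnMDl !modn_small.
have e1 : (\sum_(i < n) f (lift ord0 i) * b ^ i = \sum_(i < n) g (lift ord0 i) * b ^ i)%N.
  by apply/eqP; rewrite -(eqn_pmul2l b0); move/eqP: e; rewrite e0 eqn_add2l.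
move=> i; case: (unliftP ord0 i) => [j ->|-> //].
exact: (IH (fun j => f (lift ord0 j)) (fun j => g (lift ord0 j))).
Qed.

Section Infinite.
Context (K : numFieldType) (n : nat).
Implicit Types (p : {mpoly K[n]}) (x : 'rV[K]_n).

Definition kron (b : nat) (m : 'X_{1..n}) : nat := (\sum_(i < n) m i * b ^ i)%N.

Lemma kron_inj p m m' : m \in msupp p -> m' \in msupp p ->
  kron (msize p) m = kron (msize p) m' -> m = m'.
Proof.
have lt q : q \in msupp p -> forall i, (q i < msize p)%N.
  move=> /msize_mdeg_lt h i; apply: leq_ltn_trans h.
  by rewrite mdegE (bigD1 i) //= leq_addr.
by move=> hm hm' /(digits_inj (lt _ hm) (lt _ hm'))/mnmP.
Qed.

(* Kronecker substitution X_i := s ^ (b ^ i). *)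
Lemma mpoly0_all p : (forall x, p.@[x 0] = 0) -> p = 0.
Proof.
move=> h; set b := msize p.
pose q : {poly K} := \sum_(m <- msupp p) p@_m *: 'X^(kron b m).
have q0 : q = 0.
  apply: poly0_all => s; rewrite -[RHS](h (\row_i s ^+ (b ^ i))) /q horner_sum mevalE.
  apply: eq_bigr => m _; rewrite hornerZ hornerXn; congr (_ * _).
  rewrite /kron expr_sum; apply: eq_bigr => i _.
  by rewrite mxE mulnC exprM.
apply/mpolyP => m; rewrite mcoeff0.
have [mp|/memN_msupp_eq0//] := boolP (m \in msupp p).
have := congr1 (fun r : {poly K} => r`_(kron b m)) q0; rewrite coef0 coef_sum.
rewrite (bigD1_seq m) ?msupp_uniq //= big_seq_cond big1 => [|m' /andP[m'p m'm]].
  by rewrite coefZ coefXn eqxx mulr1 addr0.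
rewrite coefZ coefXn; case: eqP => [e|]; last by rewrite mulr0.
by rewrite (kron_inj mp m'p e) eqxx in m'm.
Qed.

Lemma mpoly0_dense (d p : {mpoly K[n]}) : d != 0 ->
  (forall x, d.@[x 0] != 0 -> p.@[x 0] = 0) -> p = 0.
Proof.
move=> d0 h; have /eqP : d * p = 0.
  apply: mpoly0_all => x; rewrite mevalM; have [->|/h->] := eqVneq d.@[x 0] 0.
    by rewrite mul0r.
  by rewrite mulr0.
by rewrite mulf_eq0 (negbTE d0) => /eqP.
Qed.

Lemma mpoly_neq0P p : p != 0 -> exists x, p.@[x 0] != 0.
Proof.
move=> p0; apply: contrapT => h; move/eqP: p0; apply; apply: mpoly0_all => x.
by apply/eqP/negPn/negP => px; apply: h; exists x.
Qed.

Lemma mderiv_eq0_const p : (forall i, p^`M(i) = 0) -> p = (p@_0%MM)%:MP.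
Proof.
move=> h; apply/mpolyP => m; rewrite mcoeffC.
have [->|m0] := eqVneq 0%MM m; first by rewrite mulr1.
rewrite mulr0.
have [i mi] : exists i, m i != 0%N.
  apply/existsP; apply: contraNT m0; rewrite negb_exists => /forallP h'.
  by apply/eqP/mnmP => i; rewrite mnm0E; apply/esym/eqP/negPn/h'.
have := congr1 (mcoeff (m - U_(i))%MM) (h i); rewrite mcoeff0 mcoeff_deriv.
rewrite submK; last by apply/mnm_lepP => j; rewrite mnm1E; case: eqP => // <-; rewrite lt0n.
by move/eqP; rewrite mulrn_eq0 /= => /eqP.
Qed.

Lemma msize_mderiv p i (N : nat) : (msize p <= N.+1)%N -> (msize p^`M(i) <= N)%N.
Proof.
move=> h; rewrite msizeE; apply/bigmax_leqP_seq => m; rewrite mcoeff_msupp mcoeff_deriv => hm _.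
have : (m + U_(i))%MM \in msupp p.
  by rewrite mcoeff_msupp; apply: contraNneq hm => ->; rewrite mul0rn.
by move=> /msize_mdeg_lt/leq_trans/(_ h); rewrite mdegD mdeg1 addn1 ltnS.
Qed.

End Infinite.

Section JacobianIndep.
Context (K : numFieldType) (m : nat) (theta : 'I_m -> {mpoly K[m]}) (e : 'I_m -> K).
Hypothesis jac1 : \matrix_(l < m, i < m) (theta i)^`M(l).@[e] = 1%:M.

(** Differentiating a relation Q shows that J kills the vector of the partial derivatives of Q
    evaluated at theta. As det J is not the zero polynomial, each partial derivative of Q is a
    relation of smaller degree. *)
Lemma jacobian_indep (Q : {mpoly K[m]}) : mmap (@mpolyC m K) theta Q = 0 -> Q = 0.
Proof.
have [N] := ubnP (msize Q); elim: N Q => // N IH Q; rewrite ltnS => hN Q0.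
pose J := \matrix_(l < m, i < m) (theta i)^`M(l).
pose a := \col_i (mmap (@mpolyC m K) theta Q^`M(i)).
have Ja : J *m a = 0.
  apply/matrixP => l j; rewrite !mxE.
  have dl : derivation idfun (fun g : {mpoly K[m]} => g^`M(l)).
    split=> u v; first exact: mderivD.
    by rewrite mderivM addrC /= [v * _]mulrC.
  have := dvn_mmap (ev := idfun) (kap := @mpolyC m K) dl theta Q.
  rewrite Q0 mderiv0 => E; rewrite [RHS]E => [|c]; last exact: mderivC.
  by apply: eq_bigr => i _; rewrite !mxE mulrC.
have dJ : \det J != 0.
  have : (\det J).@[e] = 1.
    by rewrite -det_map_mx -[RHS](det1 K m) -jac1; congr (\det _); apply/matrixP => i j; rewrite !mxE.
  by move=> h; apply/eqP => d0; move/eqP: h; rewrite d0 meval0 eq_sym oner_eq0.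
have a0 i : mmap (@mpolyC m K) theta Q^`M(i) = 0.
  have : \det J *: a = 0 by rewrite -mul_scalar_mx -mul_adj_mx -mulmxA Ja mulmx0.
  move=> /matrixP /(_ i 0); rewrite !mxE => /eqP.
  by rewrite mulf_eq0 (negbTE dJ) => /eqP.
have Q'0 i : Q^`M(i) = 0.
  case: N IH hN => [|N] IH hN; last by apply: IH => //; rewrite ltnS msize_mderiv.
  by move: hN; rewrite leqn0 msize_poly_eq0 => /eqP->; rewrite mderiv0.
have E := mderiv_eq0_const Q'0.
by move: Q0; rewrite E mmapC => /eqP; rewrite mpolyC_eq0 => /eqP->.
Qed.

End JacobianIndep.

(** A bound on transcendence degree: [tangent_bound] at the generic point of the whole affine space,
    with no gradient. *)
Lemma indep_bound (K : numFieldType) (k m : nat) (theta : 'I_m -> {mpoly K[k]}) :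
  (forall Q, mmap (@mpolyC k K) theta Q = 0 -> Q = 0) -> (m <= k)%N.
Proof.
move=> h; pose io : {rmorphism {mpoly K[k]} -> {fraction {mpoly K[k]}}} := @FracField.tofrac _.
pose mu : {rmorphism {mpoly K[m]} -> {mpoly K[k]}} := mmap (@mpolyC k K) theta.
have io0 a : io a = 0 -> a = 0 by move/eqP; rewrite tofrac_eq0 => /eqP.
have := @tangent_bound K {fraction {mpoly K[k]}} k m io {mpoly K[m]}
   (@mpolyC m K) mu (fun l g => io (mu g^`M(l))) (fun i => 'X_i) _ _ _ _ _ _ 0 (fun _ => 0).
rewrite addn0; apply.
- move=> n; rewrite -(rmorph_nat io); apply/eqP => /io0.
  rewrite -(rmorph_nat (@mpolyC k K)) => /eqP.
  by rewrite mpolyC_eq0 pnatr_eq0.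
- by move=> c; rewrite /mu /= mmapC.
- by move=> a /io0/h.
- move=> l; split=> u v /=; first by rewrite mderivD !rmorphD.
  by rewrite mderivM !rmorphD !rmorphM addrC [X in _ + X = _]mulrC.
- by move=> l c; rewrite mderivC !rmorph0.
- by move=> l i; rewrite mderivXU eq_sym !rmorph_nat.
- by case.
- by rewrite -row_leq_rank.
Qed.

Section LowerBound.
Context (K : numFieldType) (k d : nat) (Phi : 'I_k -> {mpoly K[d.+1]}).
Context (x0 : 'rV[K]_k) (L : proj K k).

Definition phi (t : 'rV[K]_d.+1) : 'rV[K]_k := \row_i (Phi i).@[t 0].

Hypothesis phi_scale : forall c t, exists c', phi (c' *: t) = c *: phi t.
Hypothesis phi0 : phi (delta_mx 0 0) = x0.
Hypothesis x0N0 : x0 != 0.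
Hypothesis LE : val L = <[x0]>%VS.
Hypothesis phi_jac :
  row_free (\matrix_(l < d.+1, i < k) (Phi i)^`M(l).@[(delta_mx 0 0 : 'rV[K]_d.+1) 0]).

Definition ext (j : nat) (s : 'rV[K]_j.+1) : 'rV[K]_d.+1 :=
  \row_l (if (l <= j)%N then s 0 (inord l) else 0).

Definition rest (j : nat) : {mpoly K[d.+1]} -> {mpoly K[j.+1]} :=
  mmap (@mpolyC j.+1 K) (fun l : 'I_d.+1 => if (l <= j)%N then 'X_(inord l) else 0).

Lemma meval_rest j a (s : 'rV[K]_j.+1) : (rest j a).@[s 0] = a.@[ext s 0].
Proof.
have := @mmap_comp_rmorph d.+1 K {mpoly K[j.+1]} K (@mpolyC j.+1 K)
  (fun l : 'I_d.+1 => if (l <= j)%N then 'X_(inord l) else 0) (meval (s 0)) idfun (ext s 0).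
rewrite /= => -> //.
- by move=> c; rewrite mevalC.
- by move=> i; rewrite mxE; case: ifP => _; rewrite ?mevalXU ?meval0.
Qed.

Definition pull (j : nat) (G : {mpoly K[k]}) : {mpoly K[j.+1]} :=
  mmap (@mpolyC j.+1 K) (fun i => rest j (Phi i)) G.

Lemma meval_pull j G (s : 'rV[K]_j.+1) : (pull j G).@[s 0] = G.@[phi (ext s) 0].
Proof.
have := @mmap_comp_rmorph k K {mpoly K[j.+1]} K (@mpolyC j.+1 K)
  (fun i => rest j (Phi i)) (meval (s 0)) idfun (phi (ext s) 0).
rewrite /= => -> //.
- by move=> c; rewrite mevalC.
- by move=> i; rewrite meval_rest mxE.
Qed.

(** The homogeneous equations satisfied by [phi] on the subspace of the first j + 1 coordinates;
    [Zseq j] is the closure of the image of this subspace. *)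
Definition Seq (j : nat) : set {mpoly K[k]} :=
  [set G | (exists e, G \is e.-homog) /\ pull j G = 0]%classic.

Definition Zseq (j : nat) : set (proj K k) := zeros (Seq j).

Lemma ext_delta j : (j <= d)%N -> ext (delta_mx 0 0 : 'rV[K]_j.+1) = delta_mx 0 0.
Proof.
move=> jd; apply/rowP => l; rewrite !mxE /= -[(inord l : 'I_j.+1) == 0]val_eqE /=.
case: ifP => [lj|/negbT].
  by rewrite inordK ?ltnS //.
rewrite -ltnNge => jl; rewrite -val_eqE /=.
by case: (nat_of_ord l) jl.
Qed.

Lemma pt_in j (s : 'rV[K]_j.+1) M : val M = <[phi (ext s)]>%VS -> Zseq j M.
Proof.
move=> hM G x [[e Ge] G0] xM.
apply: (proj2 (vanish_homog_line Ge hM)) xM.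
by rewrite -meval_pull G0 meval0.
Qed.

Lemma Zseq_L j : (j <= d)%N -> Zseq j L.
Proof.
move=> jd; apply: (@pt_in j (delta_mx 0 0)).
by rewrite ext_delta // phi0.
Qed.

Lemma pull_ne0 j G : (exists e, G \is e.-homog) -> ~ (Zseq j `<=` zeros [set G])%classic ->
  pull j G != 0.
Proof.
move=> Gh; apply: contra_notN => /eqP G0 M ZM _ x -> xM.
by apply: ZM.
Qed.

Lemma pullM j G H : pull j (G * H) = pull j G * pull j H.
Proof. by rewrite /pull rmorphM. Qed.

Lemma sub_zeros1 Z (S : set {mpoly K[k]}) : ~ (Z `<=` zeros S)%classic ->
  exists2 G, S G & ~ (Z `<=` zeros [set G])%classic.
Proof.
move=> h; apply: contrapT => h1; apply: h => M ZM G x SG xM.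
apply: contrapT => Gx; apply: h1; exists G => // h2.
by apply: Gx; apply: (h2 M).
Qed.

Lemma x0_coord : exists i, x0 0 i != 0.
Proof.
apply/existsP; apply: contraNT x0N0; rewrite negb_exists => /forallP h.
by apply/eqP/rowP => j; rewrite !mxE; apply/eqP/negPn/h.
Qed.

Lemma coord_ne0 j i : (j <= d)%N -> x0 0 i != 0 -> pull j 'X_i != 0.
Proof.
move=> jd; apply: contraNneq => p0.
have := meval_pull 'X_i (delta_mx 0 0 : 'rV[K]_j.+1).
by rewrite p0 meval0 ext_delta // phi0 mevalXU => <-.
Qed.

(** Pulled back equations live in a polynomial ring, which has no zero divisors. The extra factor
    'X_i keeps the parameter away from the zeros of [phi], where there is no projective point. *)
Lemma Zseq_irr j : (j <= d)%N -> zirreducible (Zseq j).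
Proof.
move=> jd; split; first by exists L; apply: Zseq_L.
move=> _ _ [SA [hA ->]] [SB [hB ->]] h; apply: contrapT => /not_orP[].
move=> /sub_zeros1[GA SGA /(pull_ne0 (hA _ SGA)) nA].
move=> /sub_zeros1[GB SGB /(pull_ne0 (hB _ SGB)) nB].
have [i xi] := x0_coord.
have [s] : exists s, (pull j (GA * GB * 'X_i)).@[(s : 'rV[K]_j.+1) 0] != 0.
  by apply: mpoly_neq0P; rewrite !pullM !mulf_neq0 // coord_ne0.
rewrite meval_pull !mevalM !mulf_eq0 !negb_or => /andP[/andP[a0 b0] i0].
have p0 : phi (ext s) != 0.
  by apply: contraNneq i0 => ->; rewrite mevalXU mxE.
have ZM : Zseq j (proj_point p0) by apply: pt_in.
have pM : phi (ext s) \in val (proj_point p0) by rewrite memv_line.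
case: (h _ ZM) => [/(_ GA _ SGA pM)/eqP|/(_ GB _ SGB pM)/eqP].
  by rewrite (negbTE a0).
by rewrite (negbTE b0).
Qed.

Lemma pull_all j G : pull j G = 0 <-> forall s : 'rV[K]_j.+1, G.@[phi (ext s) 0] = 0.
Proof.
split=> [h s|h]; first by rewrite -meval_pull h meval0.
by apply: mpoly0_all => s; rewrite meval_pull.
Qed.

Lemma Seq_sub j : (j < d)%N -> (Seq j.+1 `<=` Seq j)%classic.
Proof.
move=> jd G [Gh /pull_all G0]; split=> //; apply/pull_all => s.
rewrite -[RHS](G0 (\row_l (if (l <= j)%N then s 0 (inord l) else 0))).
congr (G.@[phi _ 0]); apply/rowP => l; rewrite !mxE.
case: (leqP l j) => lj; first by rewrite leqW // inordK ?lj // ltnS leqW.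
case: ifP => // lj1; rewrite inordK //.
by rewrite leqNgt lj.
Qed.

(** By [phi_scale] the image of a coordinate subspace is a cone, so the ideal of its equations is
    homogeneous. *)
Lemma pull_pihomog j G : pull j G = 0 -> forall e, Seq j (pihomog mdeg e G).
Proof.
move=> /pull_all G0 e; split; first by exists e; apply: pihomogP.
apply/pull_all => s; rewrite -coef_scal_poly.
suff -> : scal_poly G (phi (ext s)) = 0 by rewrite coef0.
apply/scal_poly0P => c; have [c' <-] := phi_scale c (ext s).
rewrite -[RHS](G0 (c' *: s)); congr (G.@[phi _ 0]).
by apply/rowP => l; rewrite !mxE; case: ifP; rewrite ?mulr0.
Qed.

(** Equal sets would have the same equations. But j + 2 linear forms have algebraically independent
    pullbacks to j + 2 parameters; they would remain so when pulled back to j + 1 parameters,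
    against [indep_bound]. *)
Lemma Zseq_lt j : (j < d)%N -> (Zseq j `<` Zseq j.+1)%classic.
Proof.
move=> jd; split.
  by move=> M ZM G x /(Seq_sub jd) SG; apply: ZM.
move=> sub.
have hS G : Seq j G -> pull j.+1 G = 0.
  move=> SG; apply/pull_all => s.
  have [p0|p0] := eqVneq (phi (ext s)) 0.
    by rewrite p0; apply: (Zseq_L (ltnW jd) SG); apply: mem0v.
  have : Zseq j.+1 (proj_point p0) by apply: pt_in.
  by move/sub => /(_ _ _ SG); apply; rewrite memv_line.
have hP G : pull j G = 0 -> pull j.+1 G = 0.
  move=> /pull_pihomog SG; rewrite (pihomog_partitionE (leqnn (mmeasure mdeg G))).
  by rewrite /pull raddf_sum big1 // => e _; apply: hS.
have [C JC] := row_freeP phi_jac.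
pose w (l : 'I_j.+2) : 'I_d.+1 := widen_ord (jd : (j.+2 <= d.+1)%N) l.
(* Taking coefficients in the columns of a right inverse of the Jacobian makes the Jacobian of the y
   l the identity at the base point. *)
pose y (l : 'I_j.+2) : {mpoly K[k]} := \sum_i C i (w l) *: 'X_i.
suff : (j.+2 <= j.+1)%N by rewrite ltnn.
apply: (@indep_bound K j.+1 j.+2 (fun l => pull j (y l))) => Q Q0.
have comp i P : pull i (mmap (@mpolyC k K) y P) = mmap (@mpolyC i.+1 K) (fun l => pull i (y l)) P.
  pose pl : {rmorphism {mpoly K[k]} -> {mpoly K[i.+1]}} :=
    mmap (@mpolyC i.+1 K) (fun b => rest i (Phi b)).
  apply: (@mmap_comp_rmorph _ K _ _ (@mpolyC k K) y pl (@mpolyC i.+1 K)) => // c.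
  exact: mmapC.
apply: (@jacobian_indep K j.+2 (fun l => pull j.+1 (y l)) ((delta_mx 0 0 : 'rV[K]_j.+2) 0)).
  apply/matrixP => l i; rewrite mxE.
  have := congr1 (fun A : 'M_d.+1 => A (w l) (w i)) JC; rewrite !mxE.
  rewrite (_ : (w l == w i) = (l == i)); last by rewrite -!val_eqE.
  move<-.
  rewrite (_ : pull j.+1 (y i) = \sum_a C a (w i) *: rest j.+1 (Phi a)); last first.
    rewrite /pull /y raddf_sum; apply: eq_bigr => a _ /=.
    by rewrite mmapZ mmapX mmap1U mul_mpolyC.
  rewrite (raddf_sum (mderiv l)) raddf_sum /=.
  apply: eq_bigr => a _; rewrite !mxE mderivZ mevalZ mulrC.
  congr (_ * _); rewrite /rest.
  have dl := mderiv_derivation ((delta_mx 0 0 : 'rV[K]_j.+2) 0) l.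
  rewrite (dvn_mmap dl) => [|c]; last by rewrite mderivC meval0.
  rewrite (bigD1 (w l)) //= big1 => [|b bl].
    rewrite -/(rest j.+1 _) meval_rest ext_delta // -ltnS ltn_ord.
    rewrite mderivXU -val_eqE /= inordK // eqxx meval1 mulr1 addr0 //.
  case: ifP => bj; last by rewrite mderiv0 meval0 mulr0.
  rewrite mderivXU -val_eqE /= inordK //.
  case: eqP => [e|]; last by rewrite meval0 mulr0.
  by case/eqP: bl; apply: val_inj.
by rewrite -comp; apply: hP; rewrite comp.
Qed.

(** D <> 0 leaves out a proper closed set of parameters; a pulled back equation of A vanishes off
    it, hence identically. *)
Lemma Zseq_min (A : set (proj K k)) (D : {mpoly K[d.+1]}) : D != 0 -> zclosed A ->
  (forall (t : 'rV[K]_d.+1) M, D.@[t 0] != 0 -> val M = <[phi t]>%VS -> A M) ->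
  (Zseq d `<=` A)%classic.
Proof.
move=> D0 [SA [hA ->]] h M ZM G x SG xM.
apply: ZM xM => //; split; first exact: hA.
have extd (t : 'rV[K]_d.+1) : ext t = t.
  by apply/rowP => l; rewrite mxE -ltnS ltn_ord inord_val.
have [i xi] := x0_coord.
apply: (@mpoly0_dense _ _ (D * pull d 'X_i)).
  by rewrite mulf_neq0 // coord_ne0.
move=> t; rewrite mevalM !meval_pull extd mulf_eq0 negb_or => /andP[Dt pt].
have p0 : phi t != 0 by apply: contraNneq pt => ->; rewrite mevalXU mxE.
by have := h t (proj_point p0) Dt erefl; apply; rewrite // memv_line.
Qed.

Lemma Zseq_chain (X : set (proj K k)) : (Zseq d `<=` X)%classic -> irr_chain X L d Zseq.
Proof.
move=> hX; split; last exact: Zseq_lt.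
move=> i id; split.
- by apply: zeros_zclosed.
- exact: Zseq_irr.
- exact: Zseq_L.
apply: subset_trans hX.
have : forall a, (i + a <= d)%N -> (Zseq i `<=` Zseq (i + a))%classic.
  elim=> [|a IH] ia; first by rewrite addn0.
  rewrite addnS in ia *; apply: subset_trans (IH (ltnW ia)) _.
  by have [] := Zseq_lt ia.
by move=> /(_ (d - i)%N); rewrite subnKC // => /(_ (leqnn _)).
Qed.

End LowerBound.

(** * The equations under base change and linear substitution *)

Section Residue.
Context (A : comNzRingType) (n e : nat).
Implicit Types (p q h : {poly A}).

Let M := (e - (n - 1))%N.

(** Let p_n + B be the reversal X^n p (1/X). For t <= M this is the coefficient of X^t in p_n^(M +
    1) / (p_n + B), expanded as a geometric series in - B. *)
Definition resC p (t : nat) : A :=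
  \sum_(0 <= r < t.+1)
    \sum_(j : {ffun 'I_r -> 'I_n.+1} |
            [forall s, 0 < j s]%N && (\sum_s j s == t)%N)
      (-1) ^+ r * (\prod_s p`_(n - j s)) * p`_n ^+ (M - r).

(** Up to the factor p_n^(M + 1), the coefficient of 1/X in the expansion at infinity of q / p, for
    q of degree at most e. *)
Definition resE p q : A := \sum_((n - 1)%N <= i < e.+1) q`_i * resC p (i - (n - 1)).

Let B p : {poly A} := \sum_(j < n.+1 | (0 < j)%N) p`_(n - j) *: 'X^j.
Let C p : {poly A} := \sum_(r < M.+1) (- B p) ^+ r * (p`_n ^+ (M - r))%:P.

Let coefBX p r t : (B p ^+ r)`_t =
  \sum_(j : {ffun 'I_r -> 'I_n.+1} |
            [forall s, 0 < j s]%N && (\sum_s j s == t)%N) \prod_s p`_(n - j s).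
Proof.
rewrite -[r in LHS]card_ord -prodr_const bigA_distr_big coef_sum.
rewrite [RHS]big_mkcondr /=; apply: eq_big => [f|f _].
  by apply/ffun_onP/forallP => h s; have := h s.
have -> : \prod_i (p`_(n - f i) *: 'X^(f i)) = (\prod_i p`_(n - f i)) *: 'X^(\sum_s f s) :> {poly A}.
  by rewrite expr_sum -scaler_prod.
by rewrite coefZ coefXn eq_sym; case: eqP; rewrite ?mulr1 ?mulr0.
Qed.

Let coefB_lt p r t : (t < r)%N -> (B p ^+ r)`_t = 0.
Proof.
move=> tr; rewrite coefBX big1 // => f /andP[/forallP f0 /eqP ft].
suff : (r <= \sum_s f s)%N by rewrite ft leqNgt tr.
by rewrite -[X in (X <= _)%N]card_ord -sum1_card; apply: leq_sum => s _.
Qed.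

Let coef_signM r (q : {poly A}) t : ((-1) ^+ r * q)`_t = (-1) ^+ r * q`_t.
Proof. by rewrite -(rmorph_sign (@polyC A)) coefCM. Qed.

Let coefC_resC p t : (t <= M)%N -> (C p)`_t = resC p t.
Proof.
move=> tM; rewrite /resC /C coef_sum big_mkord.
rewrite [RHS](big_ord_widen M.+1 (fun r => \sum_(j : {ffun 'I_r -> 'I_n.+1} |
            [forall s, 0 < j s]%N && (\sum_s j s == t)%N)
      (-1) ^+ r * (\prod_s p`_(n - j s)) * p`_n ^+ (M - r))) // [RHS]big_mkcond.
apply: eq_bigr => r _; rewrite [(- B p) ^+ _]exprNn coefMC coef_signM.
case: ltnP => [rt|]; last by move=> tr; rewrite (@coefB_lt p r t tr) mulr0 mul0r.
by rewrite coefBX mulr_sumr mulr_suml.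
Qed.

(** The geometric series is truncated at order M, and the remaining term B^(M + 1) only starts in
    degree M + 1. *)
Let coefBC p t : (0 < t)%N -> (t <= M)%N -> (((p`_n)%:P + B p) * C p)`_t = 0.
Proof.
move=> t0 tM; have -> : ((p`_n)%:P + B p) * C p = (p`_n ^+ M.+1)%:P - (- B p) ^+ M.+1.
  rewrite rmorphXn /= subrXX -[B p in LHS]opprK; congr (_ * _).
  by apply: eq_bigr => i _; rewrite rmorphXn /= mulrC.
rewrite coefB coefC gtn_eqF // sub0r [(- B p) ^+ _]exprNn coef_signM.
by rewrite coefB_lt ?mulr0 ?oppr0.
Qed.

Lemma resE_ord p q : (n - 1 <= e)%N ->
  resE p q = \sum_(t < M.+1) q`_(t + (n - 1)) * resC p t.
Proof.
move=> ne; rewrite /resE -{1}[(n - 1)%N]add0n big_addn subSn // big_mkord.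
by apply: eq_bigr => t _; rewrite addnK.
Qed.

Lemma resED p q q' : resE p (q + q') = resE p q + resE p q'.
Proof. by rewrite /resE -big_split; apply: eq_bigr => i _; rewrite coefD mulrDl. Qed.

Lemma resEZ p c q : resE p (c *: q) = c * resE p q.
Proof. by rewrite /resE mulr_sumr; apply: eq_bigr => i _; rewrite coefZ mulrA. Qed.

Let resE_Xn p l : (0 < n)%N -> (size p <= n.+1)%N -> (l + n <= e)%N ->
  resE p ('X^l * p) = 0.
Proof.
move=> n0 sp le; rewrite resE_ord; last by lia.
have lM : (l.+1 <= M)%N by rewrite /M; lia.
rewrite -[RHS](@coefBC p l.+1) // [_ * C p]mulrC coefM.
rewrite [RHS](big_ord_widen M.+1 (fun t => (C p)`_t * ((p`_n)%:P + B p)`_(l.+1 - t))) //.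
rewrite [RHS]big_mkcond /=; apply: eq_bigr => t _.
rewrite coefC_resC; last by rewrite -ltnS ltn_ord.
rewrite coefXnM; case: (ltnP t l.+2) => tl; last first.
  case: ltnP => _; rewrite ?mul0r // nth_default ?mul0r //.
  by apply: leq_trans sp _; lia.
rewrite mulrC; congr (_ * _).
have cB j : ((p`_n)%:P + B p)`_j = if (j <= n)%N then p`_(n - j) else 0.
  rewrite coefD coefC /B coef_sum.
  have [->|j0] := eqVneq j 0%N.
    rewrite leq0n subn0 big1 ?addr0 // => i i0.
    by rewrite coefZ coefXn eq_sym gtn_eqF ?mulr0.
  rewrite add0r; case: ifP => jn.
    rewrite (bigD1 (Ordinal (jn : (j < n.+1)%N))) /=; last by rewrite lt0n.
    rewrite coefZ coefXn eqxx mulr1 big1 ?addr0 // => i /andP[_ ij].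
    rewrite coefZ coefXn; case: eqP => [ji|]; last by rewrite mulr0.
    by case/eqP: ij; apply: val_inj.
  rewrite big1 // => i i0; rewrite coefZ coefXn; case: eqP => [ji|]; last by rewrite mulr0.
  by move: jn; rewrite ji -ltnS ltn_ord.
rewrite cB; case: ltnP => h1; case: leqP => h2 //; try lia.
by congr (p`_ _); lia.
Qed.

(** The quotient of a multiple of p by p is a polynomial, with no term in 1/X; the bound on h keeps
    p h within degree e. *)
Lemma resE_mul p h : (0 < n)%N -> (size p <= n.+1)%N -> (n <= e)%N ->
  (size h <= (e - n).+1)%N -> resE p (p * h) = 0.
Proof.
move=> n0 sp ne sh; rewrite -[h]coefK poly_def mulr_sumr.
elim/big_rec: _ => [|i x _ IH].
  by rewrite /resE big1 // => i _; rewrite coef0 mul0r.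
rewrite resED IH addr0 -scalerAr resEZ mulrC [p * _]mulrC resE_Xn ?mul0r //.
by have := leq_trans (ltn_ord i) sh; lia.
Qed.

Lemma resE_lead p (q : {poly A}) : (0 < n)%N -> (n - 1 <= e)%N -> (size q <= n)%N ->
  resE p q = q`_n.-1 * p`_n ^+ M.
Proof.
move=> n0 ne sq; rewrite resE_ord // big_ord_recl /= big1 => [|i _]; last first.
  by rewrite nth_default ?mul0r //; apply: leq_trans sq _; rewrite /bump; lia.
rewrite addr0 add0n subn1; congr (_ * _).
rewrite /resC big_nat1 (bigD1 [ffun s : 'I_0 => ord0]) /=; last first.
  by rewrite big_ord0 eqxx andbT; apply/forallP => -[].
rewrite big_ord0 expr0 !mul1r subn0 big1 ?addr0 // => j /andP[_ /eqP []].
by apply/ffunP => -[].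
Qed.

End Residue.

Section Homog.
Context (A : comNzRingType).

Lemma dhomog_mderiv (n d : nat) (P : {mpoly A[n]}) i :
  P \is d.-homog -> P^`M(i) \is d.-1.-homog.
Proof.
move=> /dhomogP hP; apply/dhomogP => m; rewrite mcoeff_msupp mcoeff_deriv => hm.
have /hP /= : (m + U_(i))%MM \in msupp P.
  by rewrite mcoeff_msupp; apply: contraNneq hm => ->; rewrite mul0rn.
by rewrite mdegD mdeg1 addn1 => <-.
Qed.

Lemma dhomog_prodn (n : nat) (I : finType) (F : I -> {mpoly A[n]}) (e : I -> nat) :
  (forall i, F i \is (e i).-homog) -> \prod_i F i \is (\sum_i e i)%N.-homog.
Proof.
move=> h; elim/big_rec2: _ => [|i y1 y2 _ hy]; first exact: dhomog1.
exact: dhomogM.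
Qed.

Lemma dhomog_comp (n k d : nat) (P : {mpoly A[n]}) (t : n.-tuple {mpoly A[k]}) :
  P \is d.-homog -> (forall i, tnth t i \is 1.-homog) -> P \mPo t \is d.-homog.
Proof.
move=> /dhomogP hP ht; rewrite comp_mpolyE big_seq; apply: rpred_sum => m mP.
apply: rpredZ; rewrite -(hP m mP) /= mdegE; apply: dhomog_prodn => i.
by have := dhomogMn (m i) (ht i); rewrite mul1n.
Qed.

Lemma dhomog_det (n k d : nat) (M : 'M[{mpoly A[n]}]_k) :
  (forall i j, M i j \is d.-homog) -> \det M \is (k * d).-homog.
Proof.
move=> h; apply: rpred_sum => s _; rewrite -signr_odd mulr_sign.
have hp : \prod_i M i (s i) \is (k * d).-homog.
  have := @dhomog_prodn n 'I_k (fun i => M i (s i)) (fun=> d) (fun i => h i (s i)).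
  by rewrite sum_nat_const card_ord.
by case: ifP => _ //; rewrite rpredN.
Qed.

End Homog.

Section Lines.
Context (A : comNzRingType) (n : nat).
Implicit Types (u v w : 'M[A]_n) (P : {mpoly A[n * n]}).

(** P (X u + v), the dehomogenization of [restrict] at y = 1. *)
Definition line u v P : {poly A} :=
  mmap (@polyC A) (fun i => mxvec u 0 i *: 'X + (mxvec v 0 i)%:P) P.

Lemma horner_line u v P s : (line u v P).[s] = P.@[mxvec (s *: u + v) 0].
Proof.
have := @mmap_comp_rmorph (n * n) A {poly A} A (@polyC A)
  (fun i => mxvec u 0 i *: 'X + (mxvec v 0 i)%:P) (horner_eval s) idfun (mxvec (s *: u + v) 0).
rewrite /= /horner_eval => -> //.
- by move=> c; rewrite hornerC.
- by move=> i; rewrite hornerD hornerZ hornerX hornerC linearD linearZ !mxE mulrC.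
Qed.

Lemma coef_xy_homog d (Q : {mpoly A[2]}) j : Q \is d.-homog -> (j <= d)%N ->
  coef_xy j (d - j) Q =
  (mmap (@polyC A) (fun i : 'I_2 => if i == ord0 then 'X else 1) Q)`_j.
Proof.
move=> /dhomogP hQ jd; rewrite /coef_xy.
rewrite [Q in RHS]mpolyE raddf_sum coef_sum.
set m0 := (_ + _)%MM.
have mE m : m \in msupp Q -> (m ord0 == j) = (m == m0).
  move=> /hQ /= md; apply/eqP/eqP => [mj|->]; last first.
    by rewrite mnmDE !mulmnE !mnm1E /=; lia.
  apply/mnmP => i; rewrite mnmDE !mulmnE !mnm1E.
  have : (m ord0 + m ord_max = d)%N by rewrite -md mdegE !big_ord_recl big_ord0 addn0;
    congr (_ + m _)%N; apply: val_inj.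
  rewrite mj; case: i => -[|[|//]] hi.
    rewrite [Ordinal hi](_ : _ = ord0) /=; last exact: val_inj.
    by rewrite mj; lia.
  move=> <-; rewrite [Ordinal hi](_ : _ = ord_max) /=; last exact: val_inj.
  by lia.
rewrite (eq_big_seq (fun m => if m == m0 then Q@_m else 0)) => [|m mQ /=]; last first.
  rewrite mmapZ mmapX coefCM /mmap1 !big_ord_recl big_ord0 /= expr1n mulr1 mulr1.
  by rewrite coefXn eq_sym mE //; case: ifP; rewrite ?mulr1 ?mulr0.
have [h|h] := boolP (m0 \in msupp Q).
  rewrite (bigD1_seq m0) ?msupp_uniq //= eqxx big1 ?addr0 // => m /negbTE -> //.
rewrite (memN_msupp_eq0 h) big_seq big1 // => m mQ; case: eqP => // e.
by rewrite -e mQ in h.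
Qed.

Lemma coef_xy_line d u v P j : P \is d.-homog -> (j <= d)%N ->
  coef_xy j (d - j) (Defs.restrict u v P) = (line u v P)`_j.
Proof.
move=> hP jd; rewrite (@coef_xy_homog d) //; last first.
  apply: dhomog_comp => // i; rewrite tnth_mktuple.
  by rewrite rpredD // rpredZ // dhomogX /= mdeg1.
congr (_`_j); rewrite /Defs.restrict /comp_mpoly /line.
pose sg : {rmorphism {mpoly A[2]} -> {poly A}} :=
  mmap (@polyC A) (fun i : 'I_2 => if i == ord0 then 'X else 1).
set t := [tuple _ | _ < _].
have E := @mmap_comp_rmorph (n * n) A {mpoly A[2]} {poly A} (@mpolyC 2 A) (tnth t) sg (@polyC A)
  (fun i => mxvec u 0 i *: 'X + (mxvec v 0 i)%:P) _ _ P.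
move: E; rewrite /sg /= => E; rewrite E {E} // => [c|i]; first exact: mmapC.
rewrite /t.
by rewrite tnth_mktuple mmapD !mmapZ !mmapX !mmap1U /= mul_polyC mulr1.
Qed.

Lemma dhomog_dirderiv d w P : P \is d.-homog -> dirderiv w P \is d.-1.-homog.
Proof. by move=> hP; apply: rpred_sum => i _; apply/rpredZ/dhomog_mderiv. Qed.

Lemma dhomog_hess f P : P \is n.-homog ->
  hess_det f P \is ((2 * n + 1) * (n - 2)).-homog.
Proof.
move=> hP; apply: dhomog_det => i j; rewrite mxE.
rewrite (_ : (n - 2)%N = n.-1.-1); last by case: (n) => [|[|]] //= k; rewrite subn2.
by do 2 apply: dhomog_dirderiv.
Qed.

Lemma eqE_resE f u v P : P \is n.-homog -> (1 < n)%N ->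
  Defs.eqE f u v P = resE n ((2 * n + 1) * (n - 2)) (line u v P) (line u v (hess_det f P)).
Proof.
move=> hP n1; rewrite /Defs.eqE /resE; set e := (_ * _)%N.
rewrite big_nat_cond [RHS]big_nat_cond; apply: eq_bigr => i /andP[/andP[_ ie] _].
rewrite /resC mulr_sumr; apply: eq_bigr => r _.
rewrite mulr_sumr; apply: eq_bigr => j _.
rewrite (coef_xy_line u v (dhomog_hess f hP)) -/e; last by rewrite -ltnS.
rewrite (coef_xy_line u v hP (leqnn n)).
rewrite (eq_bigr (fun s => (line u v P)`_(n - j s))) => [|s _]; last first.
  by rewrite -(coef_xy_line u v hP) ?leq_subr.
by rewrite !mulrA [in LHS](mulrC ((-1) ^+ r)).
Qed.

End Lines.

Section Functoriality.
Context (A B : comNzRingType) (phi : {rmorphism A -> B}).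

Lemma map_mpolyXm (n : nat) (m : 'X_{1..n}) : map_mpoly phi 'X_[m] = 'X_[m].
Proof.
apply/mpolyP => m'; rewrite mcoeff_map_mpoly !mcoeffX.
by case: eqP => _; rewrite ?raddf0 //= rmorph1.
Qed.

Lemma map_mpolyZ (n : nat) c (P : {mpoly A[n]}) :
  map_mpoly phi (c *: P) = phi c *: map_mpoly phi P.
Proof. by apply/mpolyP => m; rewrite !(mcoeff_map_mpoly, mcoeffZ) /= rmorphM. Qed.

Lemma map_mderiv (n : nat) (P : {mpoly A[n]}) i :
  map_mpoly phi P^`M(i) = (map_mpoly phi P)^`M(i).
Proof.
by apply/mpolyP => m; rewrite mcoeff_map_mpoly !mcoeff_deriv mcoeff_map_mpoly /= raddfMn.
Qed.

Lemma dhomog_map (n d : nat) (P : {mpoly A[n]}) :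
  P \is d.-homog -> map_mpoly phi P \is d.-homog.
Proof.
move=> /dhomogP hP; apply/dhomogP => m; rewrite mcoeff_msupp mcoeff_map_mpoly => hm.
by apply: hP; rewrite mcoeff_msupp; apply: contraNneq hm => ->; rewrite raddf0.
Qed.

Context (n : nat).
Implicit Types (u v w : 'M[A]_n) (P : {mpoly A[n * n]}).

Lemma map_line u v P :
  map_poly phi (line u v P) = line (map_mx phi u) (map_mx phi v) (map_mpoly phi P).
Proof.
rewrite /line /map_mpoly.
pose g : {rmorphism A -> {poly B}} := @polyC B \o phi.
pose h (i : 'I_(n * n)) := mxvec (map_mx phi u) 0 i *: 'X + (mxvec (map_mx phi v) 0 i)%:P.
transitivity (mmap g h P).
  apply: mmap_comp_rmorph => [c|i]; first by rewrite /= map_polyC.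
  by rewrite /h rmorphD /= linearZ /= map_polyX map_polyC /= -!map_mxvec !mxE.
apply/esym.
have := @mmap_comp_rmorph (n * n) A {mpoly B[n * n]} {poly B} (@mpolyC (n * n) B \o phi)
  (fun i => 'X_i) (mmap (@polyC B) h) g h.
rewrite /= => -> //.
- by move=> c; rewrite mmapC.
- by move=> i; rewrite mmapX mmap1U.
Qed.

Lemma map_dirderiv w P :
  map_mpoly phi (dirderiv w P) = dirderiv (map_mx phi w) (map_mpoly phi P).
Proof.
rewrite /dirderiv raddf_sum; apply: eq_bigr => i _.
by rewrite /= map_mpolyZ map_mderiv -map_mxvec mxE.
Qed.

Lemma map_hess f P : map_mpoly phi (hess_det f P) =
  hess_det (map_tuple (map_mx phi) f) (map_mpoly phi P).
Proof.
rewrite /hess_det -det_map_mx; congr (\det _); apply/matrixP => i j.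
by rewrite !mxE /= !map_dirderiv !tnth_map.
Qed.

Lemma map_resE e p q : phi (resE n e p q) = resE n e (map_poly phi p) (map_poly phi q).
Proof.
rewrite /resE rmorph_sum; apply: eq_bigr => i _ /=.
rewrite rmorphM /= coef_map /=; congr (_ * _); rewrite /resC rmorph_sum.
apply: eq_bigr => r _; rewrite rmorph_sum; apply: eq_bigr => j _.
rewrite !rmorphM rmorph_sign rmorph_prod rmorphXn /= coef_map.
by congr (_ * _ * _); apply: eq_bigr => s _; rewrite coef_map.
Qed.

Lemma map_eqE f u v P : P \is n.-homog -> (1 < n)%N ->
  phi (Defs.eqE f u v P) = Defs.eqE (map_tuple (map_mx phi) f)
    (map_mx phi u) (map_mx phi v) (map_mpoly phi P).
Proof.
move=> hP n1; rewrite !eqE_resE ?dhomog_map //.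
by rewrite map_resE !map_line map_hess.
Qed.

End Functoriality.

(** * Forms and their coefficient vectors *)

Section Form.
Context (A : comNzRingType) (N d : nat).

Definition form (x : 'rV[A]_(nforms N d)) : {mpoly A[N]} :=
  \sum_i x 0 i *: 'X_[monom i].

Lemma mdeg_monom (i : 'I_(nforms N d)) : mdeg (monom i) = d.
Proof. by have := enum_valP i; rewrite inE => /eqP. Qed.

Lemma form_homog x : form x \is d.-homog.
Proof. by apply: rpred_sum => i _; rewrite rpredZ // dhomogX /= mdeg_monom. Qed.

Lemma monom_inj : injective (@monom N d).
Proof. by move=> i j h; apply: enum_val_inj; apply: val_inj; exact: h. Qed.

Lemma formK x : coefs d (form x) = x.
Proof.
apply/rowP => i; rewrite mxE raddf_sum /= (bigD1 i) //= big1 => [|j ji].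
  by rewrite mcoeffZ mcoeffX eqxx mulr1 addr0.
by rewrite mcoeffZ mcoeffX (inj_eq monom_inj) (negbTE ji) mulr0.
Qed.

Lemma monom_ex (m : 'X_{1..N}) : mdeg m = d -> exists i : 'I_(nforms N d), monom i = m.
Proof.
move=> md; have mlt : (mdeg m < d.+1)%N by rewrite md.
have mM : BMultinom mlt \in monomials N d by rewrite inE /= md.
by exists (enum_rank_in mM (BMultinom mlt)); rewrite /monom enum_rankK_in.
Qed.

Lemma coefsK (P : {mpoly A[N]}) : P \is d.-homog -> form (coefs d P) = P.
Proof.
move=> hP; apply/mpolyP => m; have [md|md] := eqVneq (mdeg m) d; last first.
  rewrite (dhomog_nemf_coeff hP md).
  exact: (dhomog_nemf_coeff (form_homog _) md).
have [i <-] := monom_ex md; have := congr1 (fun x : 'rV_(nforms N d) => x 0 i) (formK (coefs d P)).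
by rewrite !mxE.
Qed.

Lemma formD x y : form (x + y) = form x + form y.
Proof. by rewrite /form -big_split; apply: eq_bigr => i _; rewrite mxE scalerDl. Qed.

Lemma formZ c x : form (c *: x) = c *: form x.
Proof. by rewrite /form scaler_sumr; apply: eq_bigr => i _; rewrite mxE scalerA. Qed.

Lemma coefsD (P Q : {mpoly A[N]}) : coefs d (P + Q) = coefs d P + coefs d Q.
Proof. by apply/rowP => i; rewrite !mxE mcoeffD. Qed.

Lemma coefsZ c (P : {mpoly A[N]}) : coefs d (c *: P) = c *: coefs d P.
Proof. by apply/rowP => i; rewrite !mxE mcoeffZ. Qed.

Lemma generic_homog : generic_form A N d \is d.-homog.
Proof. by apply: rpred_sum => i _; rewrite rpredZ // dhomogX /= mdeg_monom. Qed.

End Form.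

Lemma map_form (A B : comNzRingType) (phi : {rmorphism A -> B}) N d (x : 'rV[A]_(nforms N d)) :
  map_mpoly phi (form x) = form (map_mx phi x).
Proof.
rewrite /form raddf_sum; apply: eq_bigr => i _.
by rewrite /= map_mpolyZ map_mpolyXm mxE.
Qed.

Lemma map_coefs (A B : comNzRingType) (phi : {rmorphism A -> B}) N d (P : {mpoly A[N]}) :
  map_mx phi (coefs d P) = coefs d (map_mpoly phi P).
Proof. by apply/rowP => i; rewrite !mxE mcoeff_map_mpoly. Qed.

Lemma map_generic (K B : comNzRingType) (N d : nat)
    (phi : {rmorphism {mpoly K[nforms N d]} -> B}) :
  map_mpoly phi (generic_form K N d) = form (\row_i phi 'X_i).
Proof.
rewrite /form /generic_form raddf_sum; apply: eq_bigr => i _.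
by rewrite /= map_mpolyZ map_mpolyXm mxE.
Qed.

(** A morphism on the coefficients of the generic form specializes it to an arbitrary form. With
    values in K it gives the value of an equation at a point, with values in K[X] its value along a
    curve. *)
Lemma dual_eq_morph (K B : comNzRingType) (n : nat) f (u v : 'M[K]_n)
    (phi : {rmorphism {mpoly K[nforms (n * n) n]} -> B}) (psi : {rmorphism K -> B}) :
  (1 < n)%N -> (forall c, phi c%:MP = psi c) ->
  phi (Defs.eqE (map_tuple (map_mx (@mpolyC _ _)) f)
                 (map_mx (@mpolyC _ _) u) (map_mx (@mpolyC _ _) v)
                 (generic_form K (n * n) n)) =
  Defs.eqE (map_tuple (map_mx psi) f) (map_mx psi u) (map_mx psi v)
    (form (\row_i phi 'X_i)).
Proof.
move=> n1 hc.
have E (w : 'M[K]_n) : map_mx phi (map_mx (@mpolyC _ _) w) = map_mx psi w.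
  by apply/matrixP => i j; rewrite !mxE hc.
have Ef : map_tuple (map_mx phi) (map_tuple (map_mx (@mpolyC (nforms (n * n) n) K)) f)
    = map_tuple (map_mx psi) f.
  by apply: eq_from_tnth => i; rewrite !tnth_map E.
rewrite (map_eqE phi _ _ _ (@generic_homog K (n * n) n) n1).
by rewrite map_generic Ef !E.
Qed.

Section Substitution.
Context (A : comNzRingType) (n : nat) (h : 'M[A]_(n * n)).
Implicit Types (u v w : 'M[A]_n) (P : {mpoly A[n * n]}).

(** P (h w). For [h := invmx g] this is [lin_act g P], but h may also be singular or have polynomial
    entries. *)
Definition lsub P : {mpoly A[n * n]} :=
  P \mPo [tuple \sum_(j < n * n) h i j *: 'X_j | i < n * n].

Definition lsub_mor : {rmorphism {mpoly A[n * n]} -> {mpoly A[n * n]}} :=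
  mmap (@mpolyC _ A) (tnth [tuple \sum_(j < n * n) h i j *: 'X_j | i < n * n]).

Definition lact u : 'M[A]_n := vec_mx (mxvec u *m h^T).

Lemma lactE u i : mxvec (lact u) 0 i = \sum_j h i j * mxvec u 0 j.
Proof. by rewrite vec_mxK mxE; apply: eq_bigr => j _; rewrite mxE mulrC. Qed.

Lemma lsub_homog d P : P \is d.-homog -> lsub P \is d.-homog.
Proof.
move=> hP; apply: dhomog_comp => // i; rewrite tnth_mktuple.
by apply: rpred_sum => j _; rewrite rpredZ // dhomogX /= mdeg1.
Qed.

Lemma lsub_morph (C : comNzRingType) (g : {rmorphism A -> C}) (x : 'I_(n * n) -> C) P :
  mmap g x (lsub P) = mmap g (fun i => \sum_j g (h i j) * x j) P.
Proof.
have := @mmap_comp_rmorph (n * n) A {mpoly A[n * n]} C (@mpolyC _ A)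
  (tnth [tuple \sum_(j < n * n) h i j *: 'X_j | i < n * n])
  (mmap g x) g (fun i => \sum_j g (h i j) * x j).
rewrite /lsub /comp_mpoly /= => -> //.
- by move=> c; rewrite mmapC.
- move=> i; rewrite tnth_mktuple raddf_sum /=; apply: eq_bigr => j _.
  by rewrite mmapZ mmapX mmap1U.
Qed.

Lemma line_lsub u v P : line u v (lsub P) = line (lact u) (lact v) P.
Proof.
rewrite /line lsub_morph; congr (mmap _ _ P); apply: funext => i.
rewrite !lactE rmorph_sum /= scaler_suml -big_split /=; apply: eq_bigr => j _.
by rewrite mul_polyC scalerDr scalerA -!mul_polyC !polyCM.
Qed.

Lemma dirderiv_derivation w : derivation idfun (dirderiv w).
Proof.
rewrite /dirderiv; split=> a b.
  by rewrite -big_split; apply: eq_bigr => i _; rewrite mderivD scalerDr.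
rewrite /= !mulr_sumr -big_split; apply: eq_bigr => i _.
by rewrite mderivM scalerDr addrC -!scalerAr [b * _]mulrC.
Qed.

Lemma dirderivXU w i : dirderiv w 'X_i = (mxvec w 0 i)%:MP.
Proof.
rewrite /dirderiv (bigD1 i) //= big1 => [|j ji].
  by rewrite mderivXU eqxx addr0 alg_mpolyC.
by rewrite mderivXU eq_sym (negbTE ji) scaler0.
Qed.

Lemma dirderivC w c : dirderiv w c%:MP = 0.
Proof. by rewrite /dirderiv big1 // => i _; rewrite mderivC scaler0. Qed.

Lemma dirderivZ w c P : dirderiv w (c *: P) = c *: dirderiv w P.
Proof.
by rewrite /dirderiv scaler_sumr; apply: eq_bigr => i _; rewrite mderivZ !scalerA mulrC.
Qed.

Lemma dirderiv_lsub w P : dirderiv w (lsub P) = lsub (dirderiv (lact w) P).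
Proof.
rewrite /lsub /comp_mpoly.
rewrite (dvn_mmap (ev := idfun) (dirderiv_derivation w)); last exact: dirderivC.
rewrite [dirderiv (lact w) P]/dirderiv raddf_sum; apply: eq_bigr => i _ /=.
rewrite mmapZ mulrC; congr (_ * _).
rewrite tnth_mktuple lactE (dvn_sum (ev := idfun) (dirderiv_derivation w)) rmorph_sum.
by apply: eq_bigr => j _; rewrite dirderivZ dirderivXU -mul_mpolyC -mpolyCM.
Qed.

Lemma hess_lsub f P : hess_det f (lsub P) = lsub (hess_det (map_tuple lact f) P).
Proof.
rewrite /hess_det -[lsub _]/(lsub_mor _); apply/esym.
rewrite -[LHS](det_map_mx lsub_mor).
congr (\det _); apply/matrixP => i j; rewrite !mxE.
by rewrite !dirderiv_lsub !tnth_map /=.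
Qed.

(** By the chain rule, substituting h in P amounts to moving f, u and v by h; for h invertible this
    permutes the equations. *)
Lemma eqE_lsub f u v P : P \is n.-homog -> (1 < n)%N ->
  Defs.eqE f u v (lsub P) = Defs.eqE (map_tuple lact f) (lact u) (lact v) P.
Proof.
move=> hP n1; rewrite (eqE_resE f u v (lsub_homog hP) n1).
by rewrite (eqE_resE _ _ _ hP n1) line_lsub hess_lsub line_lsub.
Qed.

End Substitution.

Lemma map_lsub (A B : comNzRingType) (phi : {rmorphism A -> B}) n (h : 'M[A]_(n * n)) P :
  map_mpoly phi (lsub h P) = lsub (map_mx phi h) (map_mpoly phi P).
Proof.
rewrite /map_mpoly lsub_morph /lsub /comp_mpoly.
pose X : 'I_(n * n) -> {mpoly B[n * n]} :=
  tnth [tuple \sum_(j < n * n) map_mx phi h i j *: 'X_j | i < n * n].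
have := @mmap_comp_rmorph (n * n) A {mpoly B[n * n]} {mpoly B[n * n]} (@mpolyC (n * n) B \o phi)
  (fun i => 'X_i) (mmap (@mpolyC (n * n) B) X) (@mpolyC (n * n) B \o phi) X.
move=> E; rewrite E => [|c|i]; last 2 first.
- by rewrite /= mmapC.
- by rewrite /= mmapX mmap1U.
congr (mmap _ _ P); apply: funext => i; rewrite /X tnth_mktuple.
by apply: eq_bigr => j _; rewrite mxE mul_mpolyC.
Qed.

(** * The determinant satisfies the equations *)

Lemma mxvec_index_eq (m n : nat) (i k : 'I_m) (j l : 'I_n) :
  (mxvec_index i j == mxvec_index k l) = (i == k) && (j == l).
Proof.
apply/eqP/andP => [e|[/eqP-> /eqP->] //].
by have [-> ->] := enum_rank_inj (cast_ord_inj e).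
Qed.

Lemma sum_mxvec (A : nmodType) (m n : nat) (F : 'I_(m * n) -> A) :
  \sum_a F a = \sum_i \sum_j F (mxvec_index i j).
Proof.
rewrite pair_bigA /= (reindex (uncurry (@mxvec_index m n))) /=; last first.
  exact: curry_mxvec_bij.
by apply: eq_bigr => -[i j].
Qed.

Section DetPoly.
Context (A : comNzRingType) (n : nat).

Definition gdet : {mpoly A[n * n]} :=
  \det (\matrix_(i < n, j < n) 'X_(mxvec_index i j)).

Lemma mmap_gdet (C : comNzRingType) (g : {rmorphism A -> C}) (x : 'I_(n * n) -> C) :
  mmap g x gdet = \det (\matrix_(i, j) x (mxvec_index i j)).
Proof.
rewrite /gdet -[LHS](det_map_mx (mmap g x)); congr (\det _).
by apply/matrixP => i j; rewrite !mxE /= mmapX mmap1U.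
Qed.

Lemma gdet_homog : gdet \is n.-homog.
Proof.
have := @dhomog_det A (n * n) n 1 (\matrix_(i < n, j < n) 'X_(mxvec_index i j)).
by rewrite muln1; apply => i j; rewrite mxE dhomogX /= mdeg1.
Qed.

Let X (i j : 'I_n) : {mpoly A[n * n]} := 'X_(mxvec_index i j).

Lemma mderiv_prodX (P : pred 'I_n) (s : 'S_n) k l :
  (\prod_(r | P r) X r (s r))^`M(mxvec_index k l) =
  if P k && (s k == l) then \prod_(r | P r && (r != k)) X r (s r) else 0.
Proof.
have d0 (Q : pred 'I_n) : ~~ Q k -> (\prod_(r | Q r) X r (s r))^`M(mxvec_index k l) = 0.
  move=> Qk; elim/big_rec: _ => [|i x Qi h]; first by rewrite -mpolyC1 mderivC.
  rewrite mderivM h mulr0 addr0 mderivXU mxvec_index_eq.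
  by case: eqP => [ik|]; rewrite ?mul0r //; rewrite -ik Qi in Qk.
case: ifP => [/andP[Pk /eqP sk]|/negbT].
  rewrite (bigD1 k) //= mderivM d0 ?eqxx ?andbF // mulr0 addr0.
  by rewrite mderivXU mxvec_index_eq eqxx sk eqxx mul1r.
have [Pk /= skl|Pk _] := boolP (P k); last by apply: d0.
rewrite (bigD1 k) //= mderivM d0 ?eqxx ?andbF // mulr0 addr0.
by rewrite mderivXU mxvec_index_eq eqxx (negbTE skl) mul0r.
Qed.

Lemma gdetE : gdet = \sum_(s : 'S_n) (-1) ^+ s * \prod_r X r (s r).
Proof.
apply: eq_bigr => s _; congr (_ * _); apply: eq_bigr => r _.
by rewrite mxE.
Qed.

Lemma mderiv_signM i (s : 'S_n) (P : {mpoly A[n * n]}) :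
  ((-1) ^+ s * P)^`M(i) = (-1) ^+ s * P^`M(i).
Proof. by rewrite -(rmorph_sign (@mpolyC (n * n) A)) mderiv_mulC. Qed.

Context (C : comNzRingType) (g : {rmorphism A -> C}) (d : 'I_n -> C).
Let x : 'I_(n * n) -> C := mxvec (diag_mx (\row_i d i)) 0.

Let ev_prodX (P : pred 'I_n) (s : 'S_n) :
  mmap g x (\prod_(r | P r) X r (s r)) =
  if [forall r, P r ==> (s r == r)] then \prod_(r | P r) d r else 0.
Proof.
rewrite rmorph_prod /=.
have E r : mmap g x (X r (s r)) = d r *+ (s r == r).
  by rewrite /X mmapX mmap1U /x mxvecE !mxE eq_sym.
case: ifP => [/forallP h|/negbT]; last rewrite negb_forall => /existsP[r].
  by apply: eq_bigr => r Pr; have /implyP/(_ Pr)/eqP sr := h r; rewrite E sr eqxx.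
rewrite negb_imply => /andP[Pr sr].
by rewrite (bigD1 r) //= E (negbTE sr) mul0r.
Qed.

(** At a diagonal matrix, only the identity and the transposition of i and k contribute to a second
    derivative in entries of the rows i and k. *)
Lemma mderiv2_gdet_diag i j k l :
  mmap g x gdet^`M(mxvec_index k l)^`M(mxvec_index i j) =
  if i == k then 0 else (\prod_(r | (r != k) && (r != i)) d r) *
    (((j == i) && (l == k))%:R - ((j == k) && (l == i))%:R).
Proof.
rewrite gdetE (raddf_sum (mderiv (mxvec_index k l))) /=.
rewrite (raddf_sum (mderiv (mxvec_index i j))) /= raddf_sum /=.
have term (s : 'S_n) : mmap g x ((-1) ^+ s * \prod_r X r (s r))^`M(mxvec_index k l)^`M(mxvec_index i j)
  = if [&& s k == l, i != k & s i == j] then (-1) ^+ s * (if [forall r, (r != k) && (r != i) ==> (s r == r)]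
       then \prod_(r | (r != k) && (r != i)) d r else 0) else 0.
  rewrite !mderiv_signM rmorphM rmorph_sign /= mderiv_prodX /=.
  case: eqP => skl /=; last by rewrite mderiv0 mmap0 mulr0.
  rewrite mderiv_prodX /=; case: ifP => _; last by rewrite mmap0 mulr0.
  by rewrite ev_prodX.
rewrite (eq_bigr _ (fun s _ => term s)) {term}.
have [->|ik] := eqVneq i k.
  by rewrite big1 // => s _; rewrite andbF.
have t1 : tperm i k != 1%g.
  by apply/eqP => /(congr1 (fun s : 'S_n => s i)); rewrite tpermL perm1 => e; rewrite e eqxx in ik.
rewrite (bigD1 (1%g : 'S_n)) //= (bigD1 (tperm i k)) //= [X in _ + (_ + X)]big1 ?addr0 => [|s /andP[s1 st]]; last first.
  case: ifP => // _; case: forallP => [h|]; last by rewrite mulr0.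
  have fix_r r : r != k -> r != i -> s r = r.
    by move=> rk ri; apply/eqP; have := h r; rewrite rk ri.
  have [si|si] := eqVneq (s i) i.
    case/eqP: s1; apply/permP => r; rewrite perm1.
    have [->//|ri] := eqVneq r i; have [->|/fix_r->//] := eqVneq r k.
    apply/eqP/negPn/negP => sk; have ski : s k != i.
      by apply: contraNneq ik => e; apply/eqP/(perm_inj (s := s)); rewrite si e.
    by have /perm_inj e := fix_r _ sk ski; rewrite e eqxx in sk.
  have sik : s i = k.
    apply/eqP/negPn/negP => h1; have /perm_inj e := fix_r _ h1 si.
    by rewrite e eqxx in si.
  case/eqP: st; apply/permP => r; case: tpermP => [->//|->|/eqP ri /eqP rk]; last exact: fix_r.
  apply/eqP/negPn/negP => h1; have h2 : s k != k.
    by apply: contraNneq ik => e; apply/eqP/(perm_inj (s := s)); rewrite sik e.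
  by have /perm_inj e := fix_r _ h2 h1; rewrite e eqxx in h2.
rewrite odd_perm1 expr0 !perm1 /= tpermL tpermR odd_tperm ik expr1.
have -> : [forall r, (r != k) && (r != i) ==> ((1%g : 'S_n) r == r)].
  by apply/forallP => r; rewrite perm1 eqxx implybT.
have -> : [forall r, (r != k) && (r != i) ==> (tperm i k r == r)].
  by apply/forallP => r; apply/implyP => /andP[rk ri]; rewrite tpermD // eq_sym.
rewrite mul1r mulN1r mulrBr ![_ == l]eq_sym ![_ == j]eq_sym.
rewrite [(l == k) && _]andbC [(l == i) && _]andbC.
by do 2 case: ifP => _; rewrite ?mulr1 ?mulr0 ?subr0 ?sub0r ?add0r ?addr0.
Qed.

(** The second differential of det at the diagonal matrix with entries d, as a symmetric bilinear
    form. *)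
Definition hb (U V : 'M[C]_n) : C :=
  \sum_i \sum_(k | k != i) (\prod_(r | (r != k) && (r != i)) d r) *
     (U i i * V k k - U i k * V k i).

Lemma hess_gdet_diag (U V : 'M[A]_n) :
  mmap g x (dirderiv U (dirderiv V gdet)) = hb (map_mx g U) (map_mx g V).
Proof.
rewrite /dirderiv raddf_sum /= sum_mxvec; apply: eq_bigr => i _.
transitivity (\sum_j \sum_k \sum_l g (U i j) * (g (V k l) *
   mmap g x gdet^`M(mxvec_index k l)^`M(mxvec_index i j))).
  apply: eq_bigr => j _; rewrite mmapZ mxvecE (raddf_sum (mderiv _)) /= raddf_sum /=.
  rewrite sum_mxvec mulr_sumr; apply: eq_bigr => k _.
  rewrite mulr_sumr; apply: eq_bigr => l _.
  by rewrite mderivZ mmapZ mxvecE.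
rewrite exchange_big /= [RHS]big_mkcond /=; apply: eq_bigr => k _.
have [ki|ki] := eqVneq k i.
  by rewrite big1 // => j _; rewrite big1 // => l _; rewrite mderiv2_gdet_diag ki eqxx !mulr0.
rewrite (eq_bigr (fun j => \sum_l (\prod_(r | (r != k) && (r != i)) d r) *
    (g (U i j) * (((j == i) && (l == k))%:R - ((j == k) && (l == i))%:R) * g (V k l)))); last first.
  move=> j _; apply: eq_bigr => l _; rewrite mderiv2_gdet_diag eq_sym (negbTE ki); ring.
rewrite (eq_bigr (fun j => (\prod_(r | (r != k) && (r != i)) d r) * \sum_l
    (g (U i j) * (((j == i) && (l == k))%:R - ((j == k) && (l == i))%:R) * g (V k l)))); last first.
  by move=> j _; rewrite mulr_sumr.
rewrite -mulr_sumr; congr (_ * _).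
rewrite (bigD1 i) //= [X in _ + X](bigD1 k) //= [X in _ + (_ + X)]big1 ?addr0 => [|j /andP[ji jk]]; last first.
  by rewrite big1 // => l _; rewrite (negbTE ji) (negbTE jk) subrr mulr0 mul0r.
rewrite (bigD1 k) //= [X in _ + X + _]big1 ?addr0 => [|l lk]; last first.
  by rewrite (negbTE lk) andbF [i == k]eq_sym (negbTE ki) subrr mulr0 mul0r.
rewrite [X in _ + X](bigD1 i) //= [X in _ + (_ + X)]big1 ?addr0 => [|l li]; last first.
  by rewrite (negbTE ki) (negbTE li) andbF subrr mulr0 mul0r.
by rewrite !eqxx [i == k]eq_sym (negbTE ki) /= !mxE subr0 sub0r mulr1 mulrN1 mulNr.
Qed.

End DetPoly.

Section Biact.
Context (A : comNzRingType) (n : nat).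
Implicit Types (u v w g h : 'M[A]_n).

(** The map u |-> g u h in the coordinates of [mxvec]; the transpose passes from row vectors to the
    convention of [lact]. *)
Definition biact g h : 'M[A]_(n * n) := (lin_mx (mulmxr h \o mulmx g))^T.

Lemma lact_biact g h u : lact (biact g h) u = g *m u *m h.
Proof. by rewrite /lact /biact trmxK mul_vec_lin mxvecK. Qed.

Lemma lsub_biact_gdet g h : lsub (biact g h) (gdet A n) = (\det g * \det h) *: gdet A n.
Proof.
rewrite /lsub /comp_mpoly mmap_gdet -mul_mpolyC.
set X := \matrix_(i, j) 'X_(mxvec_index i j) : 'M[{mpoly A[n * n]}]_n.
rewrite -[gdet A n]/(\det X) mpolyCM -!det_map_mx mulrAC -!det_mulmx.
congr (\det _); apply/matrixP => i j; rewrite !mxE tnth_mktuple sum_mxvec.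
rewrite (eq_bigr (fun k => \sum_l (g i k * h l j) *: 'X_(mxvec_index k l))); last first.
  move=> k _; apply: eq_bigr => l _; congr (_ *: _).
  rewrite /biact mxE.
  have := mul_vec_lin (mulmxr h \o mulmx g) (delta_mx k l).
  move/(congr1 (fun r : 'rV_(n * n) => r 0 (mxvec_index i j))).
  rewrite mxvecE mxvec_delta -rowE mxE /= => ->.
  rewrite mxE (bigD1 l) //= big1 ?addr0 => [|l' l'l].
    rewrite mxE (bigD1 k) //= big1 ?addr0 => [|k' k'k]; first by rewrite mxE !eqxx mulr1.
    by rewrite mxE (negbTE k'k) mulr0.
  by rewrite mxE big1 ?mul0r // => k' _; rewrite mxE (negbTE l'l) andbF mulr0.
rewrite exchange_big /=; apply: eq_bigr => l _.
rewrite !mxE mulr_suml; apply: eq_bigr => k _.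
by rewrite !mxE -mul_mpolyC mpolyCM mulrAC.
Qed.

Lemma hess_scale f c (P : {mpoly A[n * n]}) :
  hess_det f (c *: P) = c ^+ (2 * n + 1) *: hess_det f P.
Proof.
rewrite /hess_det -[RHS]mul_mpolyC (rmorphXn (@mpolyC (n * n) A)) -detZ; congr (\det _).
by apply/matrixP => i j; rewrite !mxE !dirderivZ mul_mpolyC.
Qed.

Lemma size_line d u v (P : {mpoly A[n * n]}) : P \is d.-homog -> (size (line u v P) <= d.+1)%N.
Proof.
have szM (p q : {poly A}) a b : (size p <= a.+1)%N -> (size q <= b.+1)%N -> (size (p * q)%R <= (a + b).+1)%N.
  by move=> hp hq; apply: leq_trans (size_polyMleq _ _) _; lia.
move=> /dhomogP hP; rewrite /line [P in mmap _ _ P]mpolyE [mmap _ _ _]raddf_sum big_seq.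
elim/big_ind: _ => [|p q hp hq|m mP] /=; first by rewrite size_poly0.
  by apply: leq_trans (size_polyD _ _) _; rewrite geq_max hp.
rewrite -(hP m mP) mmapZ mmapX /mmap1; apply: leq_trans (_ : (0 + mdeg m).+1 <= _)%N => //.
apply: (szM); first exact: size_polyC_leq1.
rewrite /= mdegE; elim/big_rec2: _ => [|i a p _ h]; first by rewrite size_poly1.
apply: (szM) => //; elim: (m i) => [|e IH]; first by rewrite expr0 size_poly1.
rewrite exprS; apply: (szM _ _ 1%N e) => //.
apply: leq_trans (size_polyD _ _) _; rewrite geq_max; apply/andP; split.
  by apply: leq_trans (size_scale_leq _ _) _; rewrite size_polyX.
by apply: leq_trans (size_polyC_leq1 _) _.
Qed.

Lemma line_gdet u v : line u v (gdet A n) = \det ('X *: map_mx (@polyC A) u + map_mx (@polyC A) v).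
Proof.
rewrite /line mmap_gdet; congr (\det _); apply/matrixP => i j.
by rewrite !mxE !mxvecE -mul_polyC mulrC.
Qed.

End Biact.

Section Singular.
Context (K : fieldType) (n : nat).

Lemma hb_lin (d : 'I_n -> K) (m : nat) (c : 'I_m -> K) (f : 'I_m -> 'M[K]_n) V :
  \sum_a c a * hb d (f a) V = hb d (\sum_a c a *: f a) V.
Proof.
rewrite /hb (eq_bigr (fun a => \sum_i \sum_(k | k != i) c a * ((\prod_(r | (r != k) && (r != i)) d r) *
     (f a i i * V k k - f a i k * V k i)))) => [|a _]; last first.
  by rewrite mulr_sumr; apply: eq_bigr => i _; rewrite mulr_sumr.
rewrite exchange_big; apply: eq_bigr => i _ /=.
rewrite exchange_big; apply: eq_bigr => k _ /=.
rewrite !summxE !mulr_suml -sumrB mulr_sumr; apply: eq_bigr => a _.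
by rewrite !mxE; ring.
Qed.

(** As d o = 0, only the terms of [hb] with i = o or k = o survive. So [hb] depends on U through its
    row o, its column o and the trace-like form th, that is through 2n linear forms, and 2n + 1
    vectors have a nonzero combination killed by all of them. *)
Lemma hess_diag_singular (f : (2 * n + 1).-tuple 'M[K]_n) (d : 'I_n -> K) o :
  d o = 0 -> (hess_det f (gdet K n)).@[mxvec (diag_mx (\row_i d i)) 0] = 0.
Proof.
move=> do0; rewrite /hess_det -det_map_mx.
set H := map_mx _ _.
have HE i j : H i j = hb d (tnth f i) (tnth f j).
  rewrite !mxE; have := hess_gdet_diag idfun d (tnth f i) (tnth f j).
  by rewrite !map_mx_id.
pose th (U : 'M[K]_n) := \sum_(i | i != o) (\prod_(r | (r != o) && (r != i)) d r) * U i i.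
(* The entry (o, o) already occurs in the block of the column, which frees the slot o of the block
   of the row for th. *)
pose L : 'M[K]_(2 * n + 1, n + n) := \matrix_(i, j) match split j with
  | inl k => tnth f i k o
  | inr k => if k == o then th (tnth f i) else tnth f i o k end.
have : ~~ row_free L.
  rewrite /row_free neq_ltn; apply/orP; left.
  by apply: leq_ltn_trans (rank_leq_col _) _; lia.
rewrite -kermx_eq0 => /rowV0Pn[c /sub_kermxP cL c0].
apply/eqP/det0P; exists c => //.
pose U := \sum_i c 0 i *: tnth f i.
have U1 k : U k o = 0.
  have := congr1 (fun M : 'rV_(n + n) => M 0 (lshift n k)) cL; rewrite !mxE => h.
  rewrite -[RHS]h summxE; apply: eq_bigr => i _; rewrite !mxE.
  by rewrite (_ : split _ = inl k) //; apply: (unsplitK (inl k)).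
have LU (F : 'M[K]_n -> K) k : (forall i, L i (rshift n k) = F (tnth f i)) ->
    \sum_i c 0 i * F (tnth f i) = 0.
  move=> hF; have := congr1 (fun M : 'rV_(n + n) => M 0 (rshift n k)) cL; rewrite !mxE => h.
  by rewrite -[RHS]h; apply: eq_bigr => i _; rewrite hF.
have spl k : split (rshift n k) = inr k :> 'I_n + 'I_n by exact: (unsplitK (inr k)).
have U2 k : U o k = 0.
  have [->//|ko] := eqVneq k o.
  rewrite -[RHS](@LU (fun V => V o k) k) => [|i]; last by rewrite mxE spl (negbTE ko).
  by rewrite summxE; apply: eq_bigr => i _; rewrite mxE.
have U3 : th U = 0.
  rewrite -[RHS](@LU th o) => [|i]; last by rewrite mxE spl eqxx.
  rewrite /th (eq_bigr (fun i => \sum_a c 0 a * ((\prod_(r | (r != o) && (r != i)) d r) * tnth f a i i))).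
    by rewrite exchange_big; apply: eq_bigr => a _; rewrite mulr_sumr.
  by move=> i _; rewrite summxE mulr_sumr; apply: eq_bigr => a _; rewrite !mxE; ring.
apply/rowP => j; rewrite !mxE (eq_bigr (fun i => c 0 i * hb d (tnth f i) (tnth f j))) => [|i _].
  rewrite hb_lin -/U /hb (eq_bigr (fun i => if i == o then 0 else
     (\prod_(r | (r != o) && (r != i)) d r) * (U i i * tnth f j o o))) => [|i _].
    rewrite (bigD1 o) //= eqxx add0r (eq_bigr (fun i => (\prod_(r | (r != o) && (r != i)) d r) * U i i * tnth f j o o)).
      by rewrite -mulr_suml -/(th U) U3 mul0r.
    by move=> i /negbTE->; rewrite mulrA.
  case: eqP => [->|/eqP io].
    by rewrite big1 // => k _; rewrite !U2 !mul0r subrr mulr0.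
  rewrite (bigD1 o) 1?eq_sym //= [X in _ + X]big1 ?addr0 => [|k /andP[ki ko]].
    by rewrite U1 mul0r subr0.
  by rewrite (bigD1 o) /= ?do0 ?mul0r // ![o == _]eq_sym ko io.
by rewrite HE.
Qed.

Lemma lsub_meval (A : comNzRingType) (h : 'M[A]_(n * n)) (x : 'M[A]_n) P :
  (lsub h P).@[mxvec x 0] = P.@[mxvec (lact h x) 0].
Proof.
have := lsub_morph h idfun (mxvec x 0) P; rewrite /meval => ->.
by apply: meval_eq => i; rewrite lactE.
Qed.

(** A singular matrix is equivalent to a diagonal one with a zero entry, and equivalence only
    changes det by a scalar. *)
Lemma hess_singular (f : (2 * n + 1).-tuple 'M[K]_n) (z : 'M[K]_n) :
  \det z = 0 -> (hess_det f (gdet K n)).@[mxvec z 0] = 0.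
Proof.
move=> z0; have zE := mulmx_ebase z.
set g := col_ebase z in zE; set h := row_ebase z in zE; set r := \rank z in zE.
have gu : g \in unitmx by apply: col_ebase_unit.
have hu : h \in unitmx by apply: row_ebase_unit.
have rn : (r < n)%N.
  rewrite ltn_neqAle rank_leq_row andbT; apply/negP => /eqP e.
  have : z \in unitmx by rewrite -row_full_unit /row_full -/r e.
  by rewrite unitmxE z0 unitr0.
pose y : 'M[K]_n := pid_mx r.
have yE : y = diag_mx (\row_i (i < r)%N%:R).
  apply/matrixP => i j; rewrite !mxE.
  by rewrite -val_eqE /=; case: eqP => [->|]; rewrite ?andFb ?mulr0n // mulr1n.
pose f' := map_tuple (lact (biact (invmx g) (invmx h))) f.
have -> : f = map_tuple (lact (biact g h)) f'.
  apply: eq_from_tnth => i; rewrite !tnth_map !lact_biact.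
  by rewrite !mulmxA mulmxV // mul1mx -mulmxA mulVmx // mulmx1.
have -> : z = lact (biact g h) y by rewrite lact_biact.
rewrite -lsub_meval -hess_lsub lsub_biact_gdet hess_scale mevalZ yE.
by rewrite (@hess_diag_singular _ _ (Ordinal rn)) ?mulr0 // ltnn.
Qed.

End Singular.

Lemma map_gdet (A B : comNzRingType) (phi : {rmorphism A -> B}) n :
  map_mpoly phi (gdet A n) = gdet B n.
Proof. by rewrite /map_mpoly mmap_gdet. Qed.

Section DetVanish.
Context (K : numClosedFieldType) (n : nat).
Hypothesis n2 : (2 < n)%N.
Implicit Types (u v : 'M[K]_n) (f : (2 * n + 1).-tuple 'M[K]_n).

Let n1 : (1 < n)%N. Proof. exact: ltnW. Qed.
Let n0 : (0 < n)%N. Proof. exact: ltnW. Qed.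

(** The Hessian determinant vanishes at singular matrices, hence at the n distinct roots of det on
    the line, so on this line it is a multiple of det. *)
Lemma eqE_split_roots f u v c (xi : 'I_n -> K) : c != 0 -> injective xi ->
  line u v (gdet K n) = c *: \prod_i ('X - (xi i)%:P) ->
  Defs.eqE f u v (gdet K n) = 0.
Proof.
move=> c0 xinj pE; rewrite (eqE_resE f u v (gdet_homog K n) n1).
set e := (_ * _)%N; set q := line u v (hess_det _ _).
have sp : size (line u v (gdet K n)) = n.+1.
  by rewrite pE size_scale // size_prod_XsubC [index_enum _]unlock -enumT size_enum_ord.
have rq : all (root q) (map xi (enum 'I_n)).
  apply/allP => _ /mapP[i _ ->]; apply/eqP.
  rewrite /q horner_line hess_singular //.
  have := horner_line u v (gdet K n) (xi i).
  rewrite pE hornerZ horner_prod (bigD1 i) //= hornerXsubC subrr mul0r mulr0 => h.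
  rewrite [RHS]h /meval mmap_gdet; congr (\det _).
  by apply/matrixP => a b; rewrite !mxE mxvecE !mxE.
have uq : uniq_roots (map xi (enum 'I_n)).
  by rewrite uniq_rootsE map_inj_uniq ?enum_uniq.
have [h qE] := uniq_roots_prod_XsubC rq uq.
rewrite big_map big_enum /= in qE.
have {}qE : q = line u v (gdet K n) * (c^-1 *: h).
  by rewrite qE pE -scalerAl -scalerAr scalerA mulfV // scale1r mulrC.
have [h0|h0] := eqVneq h 0.
  by rewrite qE h0 scaler0 mulr0 /resE big1 // => i _; rewrite coef0 mul0r.
have en : (n <= e)%N by rewrite /e; nia.
rewrite qE; apply: resE_mul => //; rewrite ?sp //.
have sq : (size q <= e.+1)%N by apply/size_line/dhomog_hess/gdet_homog.
have h1 : c^-1 *: h != 0 by rewrite scaler_eq0 invr_eq0 negb_or c0.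
have l0 : line u v (gdet K n) != 0 by rewrite -size_poly_gt0 sp.
move: sq; rewrite qE size_mul // sp; move: (size _) (e) en => a b; lia.
Qed.

(** Along a pencil of lines the equation is a polynomial in s: it is the same equation computed over
    K[s]. *)
Lemma eqE_dense f u v (U W : 'M[K]_n) (b : {poly K}) : b != 0 ->
  (forall s, b.[s] != 0 -> Defs.eqE f (u + s *: U) (v + s *: W) (gdet K n) = 0) ->
  Defs.eqE f u v (gdet K n) = 0.
Proof.
move=> b0 h; pose cm (M : 'M[K]_n) : 'M[{poly K}]_n := map_mx (@polyC K) M.
pose a := Defs.eqE (map_tuple cm f) (cm u + 'X *: cm U) (cm v + 'X *: cm W) (gdet {poly K} n).
have aE s : a.[s] = Defs.eqE f (u + s *: U) (v + s *: W) (gdet K n).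
  rewrite -[a.[s]]/(horner_eval s a) /a.
  rewrite (map_eqE (horner_eval s) _ _ _ (gdet_homog _ n) n1) map_gdet.
  have E M1 M2 : map_mx (horner_eval s) (cm M1 + 'X *: cm M2) = M1 + s *: M2.
    by apply/matrixP => i j; rewrite !mxE /= /horner_eval hornerD hornerM hornerX !hornerC.
  have Ef : map_tuple (map_mx (horner_eval s)) (map_tuple cm f) = f.
    apply: eq_from_tnth => i; rewrite !tnth_map; apply/matrixP => k l.
    by rewrite !mxE /= /horner_eval hornerC.
  by rewrite Ef !E.
have a0 : a = 0 by apply: (poly0_dense b0) => s /h; rewrite aE.
by have := aE 0; rewrite a0 horner0 !scale0r !addr0 => <-.
Qed.

(** By density u may be assumed invertible; u^-1 v is triangularized, and its eigenvalues are made
    distinct by adding s diag (0, 1, ..., n - 1) in the triangular basis. *)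
Lemma eqE_gdet0 f u v : Defs.eqE f u v (gdet K n) = 0.
Proof.
have main u' v' : u' \in unitmx -> Defs.eqE f u' v' (gdet K n) = 0.
  move=> uu; have [P /unitarymx_unit Pu] := Schur (invmx u' *m v') n0.
  set A := invmx u' *m v'; rewrite /similar_to => trT.
  set T := conjmx P A in trT; have TE : T = P *m A *m invmx P by rewrite /T conjumx.
  have vE : v' = u' *m invmx P *m T *m P.
    by rewrite TE /A !mulmxA !mulmxKV // mulmxV // mul1mx.
  clearbody T.
  pose D : 'M[K]_n := diag_mx (\row_i (i : nat)%:R).
  (* b (s) <> 0 says that the diagonal entries of T + s D are pairwise distinct. *)
  pose b : {poly K} := \prod_i \prod_(j | j != i)
    ((T i i - T j j)%:P + ((i : nat)%:R - (j : nat)%:R) *: 'X).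
  apply: (@eqE_dense f u' v' 0 (u' *m invmx P *m D *m P) b).
    apply/prodf_neq0 => i _; apply/prodf_neq0 => j ji.
    apply: contraNneq ji => /(congr1 (fun r : {poly K} => r`_1)).
    rewrite coefD coefC coefZ coefX coef0 /= add0r mulr1 => /eqP.
    by rewrite subr_eq0 eqr_nat => /eqP e; apply/eqP/val_inj.
  move=> s bs; rewrite scaler0 addr0.
  pose xi i := - (T i i + s * (i : nat)%:R).
  apply: (@eqE_split_roots f u' _ (\det u') xi).
  - by rewrite -unitfE -unitmxE.
  - move=> i j /eqP; rewrite eqr_opp => /eqP e; apply/eqP/negPn/negP => ij.
    move: bs; rewrite /b horner_prod (bigD1 i) //= horner_prod (bigD1 j) 1?eq_sym //=.
    rewrite hornerD hornerC hornerZ hornerX.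
    rewrite (_ : T i i - _ + _ = 0) ?mul0r ?eqxx //.
    by rewrite mulrBl [_ * s]mulrC [X in _ + (_ - X)]mulrC addrACA e -opprD subrr.
  rewrite line_gdet.
  pose c := @polyC K.
  have -> : 'X *: map_mx c u' + map_mx c (v' + s *: (u' *m invmx P *m D *m P)) =
      map_mx c u' *m (map_mx c (invmx P)) *m ('X%:M + map_mx c (T + s *: D)) *m map_mx c P.
    rewrite mulmxDr mulmxDl -!map_mxM; congr (_ + _).
      by rewrite mul_mx_scalar -scalemxAl -map_mxM mulmxKV.
    by rewrite [in LHS]vE; congr (map_mx _ _); rewrite mulmxDr mulmxDl -scalemxAr -scalemxAl.
  rewrite !det_mulmx !det_map_mx det_inv.
  rewrite -mul_polyC (_ : \det ('X%:M + _) = \prod_i ('X - (xi i)%:P)).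
    rewrite -/(c (\det u')) mulrAC -[_ * _ * c (\det P)]mulrA -rmorphM mulVf ?rmorph1 ?mulr1 //.
    by rewrite -unitfE -unitmxE.
  rewrite det_trig.
    apply: eq_bigr => i _; rewrite !mxE eqxx !mulr1n.
    by rewrite /xi rmorphN opprK.
  apply/is_trig_mxP => i j ij.
  rewrite !mxE -val_eqE ltn_eqF // !mulr0n mulr0 addr0 add0r.
  by have /is_trig_mxP -> := trT.
(* The determinant of s + u is char_poly (- u) at s, so s + u is invertible for all but finitely
   many s. *)
apply: (@eqE_dense f u v 1%:M 0 (char_poly (- u))); first exact/monic_neq0/char_poly_monic.
move=> s bs; rewrite scaler0 addr0; apply: main; rewrite unitmxE unitfE.
apply: contraNneq bs => d0; rewrite -[X in X == _]/(horner_eval s _) /char_poly -det_map_mx.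
rewrite -d0; apply/eqP; congr (\det _); apply/matrixP => i j.
rewrite !mxE /= /horner_eval hornerD hornerN hornerC hornerMn hornerX opprK addrC.
by rewrite mulr_natr.
Qed.

Lemma eqE_gdet_orbit (h : 'M[K]_(n * n)) f u v :
  Defs.eqE f u v (lsub h (gdet K n)) = 0.
Proof. by rewrite (eqE_lsub h f u v (gdet_homog K n) n1) eqE_gdet0. Qed.

End DetVanish.

(** * First-order solutions of the equations *)

Lemma coef1_derivation (K : comNzRingType) :
  derivation (horner_eval (0 : K)) (fun a : {poly K} => a`_1).
Proof.
split=> a b; first by rewrite coefD.
rewrite coefM !big_ord_recl big_ord0 addr0 /horner_eval !horner_coef0 /=.
by rewrite subn0 subnn [b`_0 * _]mulrC.
Qed.

Lemma dvn_prod (B F : comNzRingType) (ev : {rmorphism B -> F}) (D : B -> F)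
    (hD : derivation ev D) (I : finType) (P : pred I) (G : I -> B) :
  D (\prod_(i | P i) G i) =
  \sum_(k | P k) D (G k) * \prod_(i | P i && (i != k)) ev (G i).
Proof.
have H (s : seq I) : uniq s ->
    D (\prod_(i <- s | P i) G i) = \sum_(k <- s | P k) D (G k) * \prod_(i <- s | P i && (i != k)) ev (G i).
  elim: s => [|a s IH] /=; first by rewrite !big_nil (dvn1 hD).
  case/andP=> na us; rewrite !big_cons; case: ifP => Pa; last first.
    rewrite (IH us) big_seq_cond [RHS]big_seq_cond; apply: eq_bigr => k _.
    by rewrite big_cons Pa.
  rewrite (dvnM hD) (IH us) ?Pa eqxx /= addrC; congr (_ + _).
    rewrite rmorph_prod mulrC; congr (_ * _).
    rewrite big_seq_cond [RHS]big_seq_cond; apply: eq_bigl => i.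
    by have [->|] := eqVneq i a; rewrite ?(negbTE na) //= andbT.
  rewrite mulr_sumr big_seq_cond [RHS]big_seq_cond; apply: eq_bigr => k /andP[ks _].
  rewrite big_cons Pa (_ : a != k) /=; first by rewrite mulrCA.
  by apply: contraNneq na => ->.
exact: H (index_enum_uniq _).
Qed.

(** Any permutation other than the identity moves at least two indices, so its product of entries
    vanishes to second order at a diagonal matrix. *)
Lemma dvn_det_diag (B F : comNzRingType) (ev : {rmorphism B -> F}) (D : B -> F)
    (hD : derivation ev D) m (M : 'M[B]_m) (w : 'I_m -> F) :
  (forall i j, ev (M i j) = if i == j then w i else 0) ->
  D (\det M) = \sum_k D (M k k) * \prod_(i | i != k) w i.
Proof.
move=> hM.
have sgnD (s : 'S_m) b : D ((-1) ^+ s * b) = (-1) ^+ s * D b.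
  by case: (odd_perm s); rewrite ?expr0 ?expr1 ?mul1r // !mulN1r (dvnN hD).
rewrite /determinant (dvn_sum hD) (bigD1 (1%g : 'S_m)) //= [X in _ + X]big1 ?addr0 => [|s s1].
  rewrite sgnD odd_perm1 mul1r (dvn_prod hD); apply: eq_bigr => k _.
  rewrite perm1; congr (_ * _); apply: eq_bigr => i _.
  by rewrite perm1 hM eqxx.
rewrite sgnD (dvn_prod hD) big1 ?mulr0 // => k _.
have [i ik si] : exists2 i, i != k & s i != i.
  apply: contrapT => h; case/eqP: s1; apply/permP => i; rewrite perm1.
  have fix_i j : j != k -> s j = j.
    by move=> jk; apply/eqP/negPn/negP => sj; apply: h; exists j.
  have [->|/fix_i//] := eqVneq i k.
  apply/eqP/negPn/negP => sk; have /perm_inj e := fix_i _ sk.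
  by rewrite e eqxx in sk.
by rewrite [X in _ * X](bigD1 i) //= hM eq_sym (negbTE si) mul0r mulr0.
Qed.

Section Eps.
Context (K : comNzRingType).

(** In {poly {poly K}} the outer variable is the parameter of a line and the inner one an
    infinitesimal eps: [evp] sets eps = 0, [dlp] takes the coefficient of eps. *)
Definition evp : {rmorphism {poly {poly K}} -> {poly K}} := map_poly (horner_eval (0 : K)).
Definition dlp (a : {poly {poly K}}) : {poly K} := map_poly (fun b : {poly K} => b`_1) a.

Lemma coef_dlp a i : (dlp a)`_i = a`_i`_1.
Proof. by rewrite coef_map_id0 // coef0. Qed.

Lemma dlp_derivation : derivation evp dlp.
Proof.
have h := coef1_derivation K.
split=> a b; apply/polyP => i; first by rewrite coefD !coef_dlp !coefD.
rewrite coefD [evp b * _]mulrC !coefM coef_dlp coefM (dvn_sum h) -big_split.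
apply: eq_bigr => j _ /=; rewrite (dvnM h) !coef_dlp !coef_map /=.
by congr (_ + _); rewrite mulrC.
Qed.

Definition inc : {rmorphism {poly K} -> {poly {poly K}}} := map_poly (@polyC K).
Definition eps (a b : {poly K}) : {poly {poly K}} := inc a + 'X%:P * inc b.

Lemma evp_inc a : evp (inc a) = a.
Proof.
by apply/polyP => i; rewrite !coef_map /= /horner_eval hornerC.
Qed.

Lemma dlp_inc a : dlp (inc a) = 0.
Proof. by apply/polyP => i; rewrite coef_dlp coef_map /= coefC coef0. Qed.

Lemma evp_X : evp 'X%:P = 0.
Proof. by rewrite /= map_polyC /= /horner_eval hornerX. Qed.

Lemma dlp_X : dlp 'X%:P = 1.
Proof. by apply/polyP => i; rewrite coef_dlp coefC coef1; case: eqP; rewrite ?coefX ?coef0. Qed.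

Lemma evp_eps a b : evp (eps a b) = a.
Proof. by rewrite /eps rmorphD rmorphM evp_inc evp_X mul0r addr0. Qed.

Lemma dlp_eps a b : dlp (eps a b) = b.
Proof.
rewrite /eps (dvnD dlp_derivation) (dvnM dlp_derivation) !dlp_inc dlp_X.
by rewrite evp_inc mulr0 !add0r mulr1.
Qed.

End Eps.

Arguments evp {K}.
Arguments inc {K}.

Section FirstOrder.
Context (K : comNzRingType) (n : nat).
Implicit Types (u v w : 'M[K]_n) (P : {mpoly K[n * n]}) (f : (2 * n + 1).-tuple 'M[K]_n).

Let cst w : 'M[{poly K}]_n := map_mx (@polyC K) w.
Let lft P : {mpoly {poly K}[n * n]} := map_mpoly (@polyC K) P.

Definition first_order P0 P1 : {mpoly {poly K}[n * n]} := lft P0 + 'X *: lft P1.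

Lemma dirderiv_first_order w P0 P1 :
  dirderiv (cst w) (first_order P0 P1) = first_order (dirderiv w P0) (dirderiv w P1).
Proof.
rewrite /first_order (dvnD (ev := idfun) (dirderiv_derivation (cst w))) dirderivZ.
by rewrite /lft !map_dirderiv.
Qed.

Lemma line_first_order u v P0 P1 :
  line (cst u) (cst v) (first_order P0 P1) = eps (line u v P0) (line u v P1).
Proof.
by rewrite /first_order /line mmapD mmapZ -!/(line _ _ _) -!map_line.
Qed.

Lemma line_hess (A : comNzRingType) (u v : 'M[A]_n) (f : (2 * n + 1).-tuple 'M[A]_n) (P : {mpoly A[n * n]}) :
  line u v (hess_det f P) =
  \det (\matrix_(i, j) line u v (dirderiv (tnth f i) (dirderiv (tnth f j) P))).
Proof.
rewrite /hess_det /line -[LHS](det_map_mx (mmap _ _)); congr (\det _).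
by apply/matrixP => i j; rewrite !mxE.
Qed.

Lemma line_hess_first_order u v f P0 P1 :
  line (cst u) (cst v) (hess_det (map_tuple cst f) (first_order P0 P1)) =
  \det (\matrix_(i, j) eps (line u v (dirderiv (tnth f i) (dirderiv (tnth f j) P0)))
                           (line u v (dirderiv (tnth f i) (dirderiv (tnth f j) P1)))).
Proof.
rewrite line_hess; congr (\det _); apply/matrixP => i j.
by rewrite !mxE !tnth_map !dirderiv_first_order line_first_order.
Qed.

Let e := ((2 * n + 1) * (n - 2))%N.

(** Subtracting the multiple p h, with h constant in eps, leaves the residue unchanged and makes the
    dividend vanish at eps = 0; hence only the order zero part of the divisor p matters. *)
Lemma eqE_first_order f u v P0 P1 (h : {poly K}) : (1 < n)%N -> (n <= e)%N ->
  P0 \is n.-homog -> P1 \is n.-homog ->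
  line u v (hess_det f P0) = line u v P0 * h -> (size h <= (e - n).+1)%N ->
  (Defs.eqE (map_tuple cst f) (cst u) (cst v) (first_order P0 P1))`_1 =
  resE n e (line u v P0)
    (dlp (line (cst u) (cst v) (hess_det (map_tuple cst f) (first_order P0 P1))) - line u v P1 * h).
Proof.
move=> n1 ne h0 h1 qh sh.
have hP : first_order P0 P1 \is n.-homog.
  by apply: rpredD; [apply: dhomog_map | apply: rpredZ; apply: dhomog_map].
rewrite (eqE_resE _ _ _ hP n1) -/e.
set pe := line _ _ (first_order _ _); set qe := line _ _ (hess_det _ _).
have evpe : evp pe = line u v P0 by rewrite /pe line_first_order evp_eps.
have dlpe : dlp pe = line u v P1 by rewrite /pe line_first_order dlp_eps.
have evqe : evp qe = line u v P0 * h.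
  rewrite -qh /qe line_hess_first_order line_hess -[LHS](det_map_mx evp); congr (\det _).
  by apply/matrixP => i j; rewrite !mxE [LHS]evp_eps.
pose r := qe - pe * inc h.
have -> : resE n e pe qe = resE n e pe r.
  rewrite -[qe](subrK (pe * inc h)) resED resE_mul ?addr0 //; first exact: ltnW.
    exact: size_line.
  by apply: leq_trans sh; apply: size_poly.
have evr : evp r = 0 by rewrite /r rmorphB rmorphM /= -/(evp _) evqe evpe evp_inc subrr.
have hd := coef1_derivation K.
have -> : dlp qe - line u v P1 * h = dlp r.
  rewrite /r (dvnB (@dlp_derivation K)) (dvnM (@dlp_derivation K)) dlp_inc dlpe evp_inc.
  by rewrite mulr0 add0r mulrC.
rewrite -evpe {1}/resE (dvn_sum hd) /resE; apply: eq_bigr => i _.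
rewrite (dvnM hd) coef_dlp.
have r0 : (r`_i).[0] = 0.
  by have := congr1 (fun a : {poly K} => a`_i) evr; rewrite coef_map coef0.
rewrite /= {1}/horner_eval r0 mul0r add0r mulrC; congr (_ * _).
rewrite /resC rmorph_sum; apply: eq_bigr => k _.
rewrite rmorph_sum; apply: eq_bigr => j _.
rewrite !rmorphM rmorph_sign rmorph_prod rmorphXn /= coef_map.
by congr (_ * _ * _); apply: eq_bigr => l _; rewrite coef_map.
Qed.

End FirstOrder.

(** * A frame diagonalizing the Hessian of the determinant *)

Section HbForm.
Context (C : comNzRingType) (n : nat) (d : 'I_n -> C).
Implicit Types (U V : 'M[C]_n).

Lemma hbDl U U' V : hb d (U + U') V = hb d U V + hb d U' V.
Proof.
rewrite /hb -big_split; apply: eq_bigr => i _; rewrite -big_split; apply: eq_bigr => k _.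
by rewrite !mxE /=; ring.
Qed.

Lemma hbDr U V V' : hb d U (V + V') = hb d U V + hb d U V'.
Proof.
rewrite /hb -big_split; apply: eq_bigr => i _; rewrite -big_split; apply: eq_bigr => k _.
by rewrite !mxE /=; ring.
Qed.

Lemma hbZl c U V : hb d (c *: U) V = c * hb d U V.
Proof.
rewrite /hb mulr_sumr; apply: eq_bigr => i _; rewrite mulr_sumr; apply: eq_bigr => k _.
by rewrite !mxE /=; ring.
Qed.

Lemma hbZr c U V : hb d U (c *: V) = c * hb d U V.
Proof.
rewrite /hb mulr_sumr; apply: eq_bigr => i _; rewrite mulr_sumr; apply: eq_bigr => k _.
by rewrite !mxE /=; ring.
Qed.

Lemma hb0l V : hb d 0 V = 0.
Proof. by rewrite -(scale0r (0 : 'M[C]_n)) hbZl mul0r. Qed.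

Lemma hb_suml m (F : 'I_m -> 'M[C]_n) V : hb d (\sum_i F i) V = \sum_i hb d (F i) V.
Proof.
elim/big_rec2: _ => [|i x y _ <-]; first exact: hb0l.
by rewrite hbDl.
Qed.

Definition prod2 (k l : 'I_n) : C := \prod_(r | (r != l) && (r != k)) d r.

Lemma hb_delta k l i j : hb d (delta_mx k l) (delta_mx i j) =
  if k == l then (if (i == j) && (i != k) then prod2 k i else 0)
  else (if (i == l) && (j == k) then - prod2 k l else 0).
Proof.
rewrite /hb (bigD1 k) //= [X in _ + X]big1 ?addr0 => [|p pk]; last first.
  by rewrite big1 // => q _; rewrite !mxE (negbTE pk) !mul0r subrr mulr0.
have [<-|kl] := eqVneq k l.
  rewrite (eq_bigr (fun q => prod2 k q * ((q == i) && (q == j))%:R)) => [|q qk]; last first.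
    by rewrite !mxE !eqxx (negbTE qk) /= mul1r mul0r subr0.
  case: (eqVneq i j) => [<-|ij] /=; last first.
    rewrite big1 // => q _; case: eqP => [->|_] /=; last by rewrite mulr0.
    by rewrite (negbTE ij) mulr0.
  case: ifP => ik.
    rewrite (bigD1 i) //= eqxx mulr1 big1 ?addr0 // => q /andP[_ qi].
    by rewrite (negbTE qi) mulr0.
  rewrite big1 // => q qk; case: eqP => [qi|]; last by rewrite mulr0.
  by rewrite -qi qk in ik.
rewrite (eq_bigr (fun q => prod2 k q * - ((q == l) && ((q == i) && (k == j)))%:R)) => [|q qk]; last first.
  by rewrite !mxE !eqxx (negbTE kl) andbF /= mul0r sub0r -natrM mulnb.
rewrite (bigD1 l) 1?eq_sym //= eqxx [X in _ + X]big1 ?addr0 => [|q /andP[_ ql]]; last first.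
  by rewrite (negbTE ql) oppr0 mulr0.
rewrite [i == l]eq_sym [j == k]eq_sym /=.
by case: ((l == i) && (k == j)); rewrite ?mulrN1 ?oppr0 ?mulr0.
Qed.

Variables (o a b : 'I_n).
Hypotheses (ao : a != o) (bo : b != o) (ab : a != b).

(** With [vB], hyperbolic pairs for [hb]: E_(k, o) and E_(o, k) for k <> o, E_(o, o) and E_(b, b)
    for k = o, and E_(b, a) and E_(a, b) for [None], the only pair whose [omega] has the factor d
    o. *)
Definition vA (j : option 'I_n) : 'M[C]_n :=
  if j is Some k then delta_mx k o else delta_mx b a.
Definition vB (j : option 'I_n) : 'M[C]_n :=
  if j is Some k then (if k == o then delta_mx b b else delta_mx o k) else delta_mx a b.

Definition omega (j : option 'I_n) : C :=
  if j is Some k then (if k == o then prod2 o b else - prod2 k o) else - prod2 b a.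

Let ba : b != a. Proof. by rewrite eq_sym. Qed.
Let oa : o != a. Proof. by rewrite eq_sym. Qed.
Let ob : o != b. Proof. by rewrite eq_sym. Qed.

Lemma prod2C k l : prod2 k l = prod2 l k.
Proof. by apply: eq_bigl => r; rewrite andbC. Qed.

Lemma hbAA j j' : hb d (vA j) (vA j') = 0.
Proof.
case: j => [k|]; case: j' => [k'|] /=; rewrite hb_delta.
- case: (eqVneq k o) => [->|ko]; first by case: eqVneq => //= ->; rewrite eqxx.
  by case: eqVneq => //= ->; rewrite eq_sym (negbTE ko).
- case: (eqVneq k o) => [->|ko]; first by rewrite (negbTE ba).
  by rewrite (negbTE bo).
- by rewrite (negbTE ba) (negbTE ob) andbF.
by rewrite (negbTE ba).
Qed.

Lemma hbBB j j' : hb d (vB j) (vB j') = 0.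
Proof.
case: j => [k|]; case: j' => [k'|] /=.
- case: (eqVneq k o) => [_|ko]; case: (eqVneq k' o) => [_|k'o]; rewrite hb_delta.
  + by rewrite !eqxx.
  + by rewrite eqxx eq_sym (negbTE k'o).
  + by rewrite [o == k]eq_sym (negbTE ko) (negbTE bo) andbF.
  + by rewrite [o == k]eq_sym (negbTE ko).
- case: (eqVneq k o) => [_|ko]; rewrite hb_delta.
    by rewrite eqxx (negbTE ab).
  by rewrite [o == k]eq_sym (negbTE ko) (negbTE bo) andbF.
- case: (eqVneq k' o) => [_|ko]; rewrite hb_delta.
    by rewrite (negbTE ab) eqxx (negbTE ba).
  by rewrite (negbTE ab) (negbTE ob).
by rewrite hb_delta (negbTE ab).
Qed.

Lemma hbAB j j' : hb d (vA j) (vB j') = if j == j' then omega j else 0.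
Proof.
case: j => [k|]; case: j' => [k'|] /=.
- rewrite -[Some k == Some k']/(k == k').
  case: (eqVneq k' o) => [->|k'o]; rewrite hb_delta.
    case: (eqVneq k o) => [->|ko]; first by rewrite eqxx bo.
    by rewrite (negbTE bo).
  case: (eqVneq k o) => [->|ko]; first by rewrite [o == k']eq_sym (negbTE k'o).
  by rewrite eqxx eq_sym.
- rewrite hb_delta; case: (eqVneq k o) => [_|_]; first by rewrite (negbTE ab).
  by rewrite (negbTE ao).
- case: (eqVneq k' o) => [_|k'o]; rewrite hb_delta (negbTE ba).
    by [].
  by rewrite (negbTE oa).
by rewrite hb_delta (negbTE ba) !eqxx.
Qed.

Lemma hbBA j j' : hb d (vB j) (vA j') = if j == j' then omega j else 0.
Proof.
case: j => [k|]; case: j' => [k'|] /=.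
- rewrite -[Some k == Some k']/(k == k').
  case: (eqVneq k o) => [->|ko]; rewrite hb_delta.
    rewrite eqxx [o == k']eq_sym; case: (eqVneq k' o) => [->|k'o] //=.
    by rewrite ob prod2C.
  rewrite eqxx [o == k]eq_sym (negbTE ko) andbT eq_sym.
  by case: eqVneq => // _; rewrite prod2C.
- case: (eqVneq k o) => [_|ko]; rewrite hb_delta.
    by rewrite eqxx (negbTE ba).
  by rewrite [o == k]eq_sym (negbTE ko) (negbTE ao) andbF.
- by rewrite hb_delta (negbTE ab) (negbTE oa) andbF.
by rewrite hb_delta (negbTE ab) !eqxx prod2C.
Qed.

Lemma hb_orth j j' (x y : C) :
  hb d (vA j + x *: vB j) (vA j' + y *: vB j') = if j == j' then (x + y) * omega j else 0.
Proof.
rewrite hbDl !hbDr !hbZl !hbZr hbAA hbBB hbAB hbBA !mulr0 addr0 add0r.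
by case: ifP => _; [ring | rewrite !mulr0 addr0].
Qed.

End HbForm.

Section Frame.
Context (n : nat) (o a b : 'I_n).

(** In [frame], an index k < n stands for A_k + B_k, the index n + k for A_k - B_k, and the last
    index 2n for A + sg B in the pair [None]. *)
Definition fidx (i : 'I_(2 * n + 1)) : option 'I_n :=
  if (i < n)%N =P true is ReflectT h then Some (Ordinal h)
  else if (i - n < n)%N =P true is ReflectT h then Some (Ordinal h) else None.

Definition feps (C : comNzRingType) (sg : C) (i : 'I_(2 * n + 1)) : C :=
  if (i < n)%N then 1 else if (i - n < n)%N then -1 else sg.

Definition frame (C : comNzRingType) (sg : C) : (2 * n + 1).-tuple 'M[C]_n :=
  [tuple vA C o a b (fidx i) + feps sg i *: vB C o a b (fidx i) | i < 2 * n + 1].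

Lemma fidx_val i : match fidx i with
  | Some k => if (i < n)%N then (i = k :> nat) else (i = n + k :> nat)
  | None => i = (2 * n)%N :> nat end.
Proof.
rewrite /fidx; case: eqP => h /=; first by rewrite h.
have lt := ltn_ord i; case: eqP => h' /=; first by rewrite (introF idP h); lia.
by lia.
Qed.

(** Two distinct vectors of the frame built on the same pair are A + B and A - B, which are
    orthogonal. *)
Lemma fidx_inj (C : comNzRingType) (sg : C) i i' : fidx i = fidx i' -> i != i' ->
  feps sg i + feps sg i' = 0.
Proof.
move=> e ne; have := fidx_val i; have := fidx_val i'; rewrite -e.
have lt := ltn_ord i; have lt' := ltn_ord i'.
case: (fidx i) => [k|] h h'; last first.
  by case/eqP: ne; apply: val_inj; rewrite /= h h'.
have lk := ltn_ord k.
rewrite /feps; move: h h'; case: ifP => h1; case: ifP => h2 => h h'.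
- by case/eqP: ne; apply: val_inj; rewrite /= h h'.
- by rewrite (_ : (i - n < n)%N) ?addNr // h'; lia.
- by rewrite (_ : (i' - n < n)%N) ?subrr // h; lia.
by case/eqP: ne; apply: val_inj; rewrite /= h h'.
Qed.

Hypotheses (ao : a != o) (bo : b != o) (ab : a != b).

Lemma hb_frame (C : comNzRingType) (d : 'I_n -> C) (sg : C) i i' :
  hb d (tnth (frame sg) i) (tnth (frame sg) i') =
  if i == i' then (feps sg i *+ 2) * omega d o a b (fidx i) else 0.
Proof.
rewrite !tnth_mktuple hb_orth //; have [<-|ne] := eqVneq i i'; first by rewrite eqxx mulr2n.
by case: eqP => // e; rewrite (fidx_inj sg e ne) mul0r.
Qed.

Lemma map_frame (C C' : comNzRingType) (g : {rmorphism C -> C'}) (sg : C) :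
  map_tuple (map_mx g) (frame sg) = frame (g sg).
Proof.
apply: eq_from_tnth => i; rewrite tnth_map !tnth_mktuple.
have gd k l : map_mx g (delta_mx k l) = delta_mx k l :> 'M_n.
  by apply/matrixP => p q; rewrite !mxE; case: (_ && _); rewrite ?rmorph1 ?rmorph0.
have gA j : map_mx g (vA C o a b j) = vA C' o a b j by case: j => [k|] /=; rewrite gd.
have gB j : map_mx g (vB C o a b j) = vB C' o a b j.
  by case: j => [k|] /=; rewrite -?gd //; case: ifP.
rewrite map_mxD map_mxZ gA gB; congr (_ + _ *: _).
by rewrite /feps; do 2 (case: ifP => _; rewrite ?rmorph1 ?rmorphN1 //).
Qed.

Lemma feps_neq0 (K : numFieldType) (sg : K) i : sg != 0 -> feps sg i *+ 2 != 0.
Proof.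
rewrite mulrn_eq0 /= /feps => s0; case: ifP => _; first exact: oner_neq0.
by case: ifP => _ //; rewrite oppr_eq0 oner_neq0.
Qed.

(** At the identity matrix the frame is orthogonal for the Hessian of det, with nonzero squares. *)
Lemma frame_free (K : numFieldType) (sg : K) : sg != 0 -> free (frame sg).
Proof.
move=> s0; apply/freeP => c hc i.
have {}hc : \sum_j c j *: tnth (frame sg) j = 0.
  by rewrite -[RHS]hc; apply: eq_bigr => j _; rewrite (tnth_nth 0).
have := hb0l (fun=> 1 : K) (tnth (frame sg) i).
rewrite -hc hb_suml (bigD1 i) //= [X in _ + X]big1 ?addr0 => [|i' ne].
  rewrite hbZl hb_frame eqxx mulrA => /eqP; rewrite !mulf_eq0.
  rewrite (negbTE (feps_neq0 i s0)) orbF => /orP[/eqP //|].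
  have pd k l : prod2 (fun=> 1 : K) k l = 1 by rewrite /prod2 big1.
  rewrite /omega; case: (fidx i) => [k|]; last by rewrite pd oppr_eq0 oner_eq0.
  by case: ifP => _; rewrite pd ?oppr_eq0 oner_eq0.
by rewrite hbZl hb_frame (negbTE ne) mulr0.
Qed.

End Frame.

Lemma line_diag (A : comNzRingType) n (ud vd : 'I_n -> A) (P : {mpoly A[n * n]}) :
  line (diag_mx (\row_i ud i)) (diag_mx (\row_i vd i)) P =
  mmap (@polyC A) (mxvec (diag_mx (\row_i (ud i *: 'X + (vd i)%:P))) 0) P.
Proof.
rewrite /line; congr (mmap _ _ P); apply: funext => k.
case/mxvec_indexP: k => i j; rewrite !mxvecE !mxE.
case: eqP => [_|_]; first by rewrite !mulr1n.
by rewrite !mulr0n scale0r add0r.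
Qed.

(** Tangency of P1 at P0 to the scheme, written over K[eps] so that it can be transported by
    substitutions. *)
Definition first_order_zero (K : fieldType) n (P0 P1 : {mpoly K[n * n]}) : Prop :=
  forall (f : (2 * n + 1).-tuple 'M[K]_n) u v, free f -> free [:: u; v] ->
  (Defs.eqE (map_tuple (map_mx (@polyC K)) f) (map_mx (@polyC K) u) (map_mx (@polyC K) v)
     (first_order P0 P1))`_1 = 0.

(** * The equation on a line through a corank one matrix *)

Section Core.
Context (K : numFieldType) (n : nat) (o a b : 'I_n) (P : {mpoly K[n * n]}) (c s sg : K).
Hypotheses (n2 : (2 < n)%N) (ao : a != o) (bo : b != o) (ab : a != b).
Hypotheses (c0 : c != 0) (s0 : s != 0) (sg0 : sg != 0).
Hypotheses (hP : P \is n.-homog) (hz : first_order_zero (c *: gdet K n) P).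

(** X u + v is diagonal with entries X at o, s Y at a and Y elsewhere, where Y = X + 1; at X = 0 its
    corank is one. *)
Let wt (r : 'I_n) : K := if r == a then s else 1.
Let vd (r : 'I_n) : K := if r == o then 0 else wt r.
Let u : 'M[K]_n := diag_mx (\row_r wt r).
Let v : 'M[K]_n := diag_mx (\row_r vd r).
Let d (r : 'I_n) : {poly K} := wt r *: 'X + (vd r)%:P.
Let Y : {poly K} := 'X + 1.
Let e := ((2 * n + 1) * (n - 2))%N.
Let f := frame o a b sg.
Let nu := delta_mx b a + sg *: delta_mx a b : 'M[K]_n.
Let m := (2 * n * (n - 2))%N.

Let wt0 r : wt r != 0.
Proof. by rewrite /wt; case: ifP => _ //; exact: oner_neq0. Qed.

Let wto : wt o = 1. Proof. by rewrite /wt eq_sym (negbTE ao). Qed.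

Let dE r : d r = if r == o then 'X else wt r *: Y.
Proof.
rewrite /d /vd; case: eqP => [->|_]; first by rewrite wto scale1r addr0.
by rewrite /Y scalerDr alg_polyC.
Qed.

Let prod_d (Q : pred 'I_n) : ~~ Q o -> \prod_(r | Q r) d r = (\prod_(r | Q r) wt r) *: Y ^+ #|Q|.
Proof.
move=> Qo; rewrite (eq_bigr (fun r => wt r *: Y)) => [|r Qr].
  by rewrite scaler_prod prodr_const.
by rewrite dE; case: eqP => // ro; rewrite -ro Qr in Qo.
Qed.

Let p : {poly K} := (c * s) *: ('X * Y ^+ (n - 1)).

Let card_neq (r : 'I_n) : #|[pred x | x != r]| = (n - 1)%N.
Proof. by rewrite cardC1 card_ord subn1. Qed.

Let card_neq2 (r r' : 'I_n) : r != r' -> #|[pred x | (x != r') && (x != r)]| = (n - 2)%N.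
Proof.
move=> rr; have := cardC [pred x | x \in [:: r'; r]].
rewrite (card_uniqP _) /= ?inE 1?eq_sym ?rr // card_ord => h.
rewrite (@eq_card _ _ [predC [pred x | x \in [:: r'; r]]]); last first.
  by move=> x; rewrite !inE negb_or.
by move: h; set k := #|_|; lia.
Qed.

Let pE : line u v (c *: gdet K n) = p.
Proof.
rewrite line_diag mmapZ mmap_gdet /p.
rewrite (_ : \matrix_(i, j) _ = diag_mx (\row_r d r)); last first.
  by apply/matrixP => i j; rewrite mxE mxvecE.
rewrite det_diag (eq_bigr d) => [|r _]; last by rewrite mxE.
rewrite (bigD1 o) //= dE eqxx prod_d ?eqxx // card_neq mul_polyC -scalerA; congr (_ *: _).
rewrite -scalerAr; congr (_ *: _).
rewrite (bigD1 a) //= {1}/wt eqxx big1 ?mulr1 // => r /andP[_ ra].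
by rewrite /wt (negbTE ra).
Qed.

Let H0 i j : line u v (dirderiv (tnth f i) (dirderiv (tnth f j) (c *: gdet K n))) =
  if i == j then (c * (feps sg i *+ 2)) *: omega d o a b (fidx i) else 0.
Proof.
rewrite !dirderivZ line_diag mmapZ (hess_gdet_diag (@polyC K) d).
have E k : map_mx (@polyC K) (tnth f k) = tnth (frame o a b sg%:P) k.
  by rewrite -(map_frame o a b (@polyC K) sg) [RHS]tnth_map.
rewrite !E hb_frame //; case: ifP => _; last by rewrite mulr0.
rewrite -scalerA -!mul_polyC; congr (_ * (_ * _)).
by rewrite /feps; case: ifP => _; last case: ifP => _; rewrite ?polyCMn ?polyCN ?polyC1.
Qed.

Let w i : {poly K} := (c * (feps sg i *+ 2)) *: omega d o a b (fidx i).

Let l0_lt : (2 * n < 2 * n + 1)%N. Proof. by rewrite addn1. Qed.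
Let l0 : 'I_(2 * n + 1) := Ordinal l0_lt.

Let fidx_l0 : fidx l0 = None.
Proof.
have := fidx_val l0; case: (fidx l0) => [k|//] /=.
by have := ltn_ord k; case: ifP; lia.
Qed.

Let feps_l0 : feps sg l0 = sg.
Proof. by rewrite /feps /= !ifF //; apply/negbTE; rewrite -leqNgt; lia. Qed.

Let w_l0 : w l0 = (- (c * sg *+ 2)) *: ('X * Y ^+ (n - 3)).
Proof.
have E : prod2 d b a = 'X * Y ^+ (n - 3).
  rewrite /prod2 (bigD1 o) /=; last by rewrite ![o == _]eq_sym ao bo.
  rewrite {1}dE eqxx; congr (_ * _).
  rewrite (eq_bigr (fun=> Y)) => [|r /andP[/andP[ra rb] ro]]; last first.
    by rewrite dE (negbTE ro) /wt (negbTE ra) scale1r.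
  rewrite prodr_const; congr (Y ^+ _).
  have := cardC [pred x | x \in [:: o; a; b]].
  have unq : uniq [:: o; a; b] by rewrite /= !inE negb_or ![o == _]eq_sym ao bo ab.
  rewrite (card_uniqP unq) card_ord /= => h.
  rewrite (@eq_card _ _ [predC [pred x | x \in [:: o; a; b]]]); last first.
    by move=> x; rewrite !inE !negb_or [RHS]andbC.
  by move: h; set k := #|_|; lia.
by rewrite /w feps_l0 fidx_l0 /omega E scalerN -scaleNr mulrnAr.
Qed.

Let w_other i : i != l0 -> exists2 g, g != 0 & w i = g *: Y ^+ (n - 2).
Proof.
move=> il; have := fidx_val i; case E : (fidx i) => [k|] h; last first.
  by case/eqP: il; apply: val_inj; rewrite /= h.
have ce : c * (feps sg i *+ 2) != 0 by rewrite mulf_neq0 // feps_neq0.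
rewrite /w E /omega; case: eqP => [_|/eqP ko].
  rewrite /prod2 prod_d /= ?eqxx ?andbF // card_neq2 1?eq_sym // scalerA.
  by eexists; last reflexivity; rewrite mulf_neq0 //; apply/prodf_neq0.
rewrite /prod2 prod_d /= ?eqxx // card_neq2 // -scaleNr scalerA.
by eexists; last reflexivity; rewrite mulf_neq0 // oppr_eq0; apply/prodf_neq0.
Qed.

Let prod_w (Q : pred 'I_(2 * n + 1)) : ~~ Q l0 ->
  exists2 g, g != 0 & \prod_(i | Q i) w i = g *: Y ^+ (#|Q| * (n - 2)).
Proof.
move=> Ql; have [g hg] : exists g : 'I_(2 * n + 1) -> K, forall i, Q i -> g i != 0 /\ w i = g i *: Y ^+ (n - 2).
  have H i : exists g : K, Q i -> g != 0 /\ w i = g *: Y ^+ (n - 2).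
    have [il|il] := eqVneq i l0; first by exists 0 => Qi; rewrite -il Qi in Ql.
    by have [g g1 g2] := w_other il; exists g.
  by have [g hg] := choice H; exists g.
exists (\prod_(i | Q i) g i); first by apply/prodf_neq0 => i /hg[].
rewrite (eq_bigr (fun i => g i *: Y ^+ (n - 2))) => [|i /hg[]//].
by rewrite scaler_prod prodr_const -exprM [(#|Q| * _)%N]mulnC.
Qed.

Let H1 : {poly K} := line u v (dirderiv nu (dirderiv nu P)).

Let f_l0 : tnth f l0 = nu.
Proof. by rewrite tnth_mktuple feps_l0 fidx_l0. Qed.

Let szY k : size (Y ^+ k) = k.+1.
Proof. by rewrite /Y -(opprK (1 : {poly K})) -polyC1 -polyCN size_exp_XsubC. Qed.

Let Ylead k : (Y ^+ k)`_k = 1.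
Proof.
have : Y ^+ k \is monic by rewrite /Y -(opprK (1 : {poly K})) -polyC1 -polyCN monic_exp // monicXsubC.
by rewrite monicE lead_coefE szY => /eqP.
Qed.

Let sz_p : size p = n.+1.
Proof.
rewrite /p size_scale ?mulf_neq0 // mulrC size_mulX -?size_poly_gt0 ?szY //.
by congr (_.+1); lia.
Qed.

Let p_lead : p`_n = c * s.
Proof.
rewrite /p coefZ coefXM gtn_eqF; last by apply: ltnW; apply: ltnW.
by rewrite -subn1 Ylead mulr1.
Qed.

(** The dividend of the first-order equation is Y^(n - 1) Z. Modulo X Y^(n - 1) it is Z (0) Y^(n -
    1), with coefficient Z (0) in degree n - 1; so Z (0) = 0, and C is cancelled. *)
Lemma core_relation :
  (dirderiv nu (dirderiv nu P)).@[mxvec v 0] + (sg *+ 2 / s) * P.@[mxvec v 0] = 0.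
Proof.
have n1 : (1 < n)%N by apply: ltnW.
have en : (n <= e)%N by rewrite /e; nia.
have me : (m + (n - 2) = e)%N by rewrite /m /e; nia.
have mn : (n + 1 <= m)%N by rewrite /m; nia.
have card2n : #|[pred i : 'I_(2 * n + 1) | i != l0]| = (2 * n)%N.
  by rewrite cardC1 card_ord addn1.
have nl0 : ~~ [pred i | i != l0] l0 by rewrite /= eqxx.
have [C C0] := prod_w nl0.
rewrite card2n -/m => CE.
(* The Hessian determinant is a constant times X Y^(n - 3) Y^m, and p is c s X Y^(n - 1). *)
pose h : {poly K} := (- (sg *+ 2 / s) * C) *: Y ^+ (m - 2).
have qE : line u v (hess_det f (c *: gdet K n)) = line u v (c *: gdet K n) * h.
  rewrite pE line_hess.
  rewrite (_ : \matrix_(i, j) _ = diag_mx (\row_i w i)); last first.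
    by apply/matrixP => i j; rewrite !mxE H0; case: eqP => _; rewrite ?mulr1n ?mulr0n.
  rewrite det_diag (eq_bigr w) => [|i _]; last by rewrite mxE.
  rewrite (bigD1 l0) //= CE w_l0 /p /h -!scalerAl -!scalerAr !scalerA -!mulrA -!exprD.
  rewrite (_ : (n - 3 + m)%N = (n - 1 + (m - 2))%N); last by move: (m) mn => m'; clear -n2; lia.
  by congr (_ *: _); field.
have sh : (size h <= (e - n).+1)%N.
  apply: leq_trans (size_scale_leq _ _) _; rewrite szY.
  by move: (m) (e) mn me n2; clear; lia.
have hcP : c *: gdet K n \is n.-homog by rewrite rpredZ // gdet_homog.
have fu : free [:: u; v].
  rewrite -[[:: u; v]]/(val [tuple u; v]); apply/freeP => k.
  rewrite !big_ord_recl big_ord0 addr0 /= => hk.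
  have := congr1 (fun M : 'M[K]_n => M o o) hk; rewrite !mxE eqxx /vd eqxx !mulr1n mulr0 addr0.
  move/eqP; rewrite mulf_eq0 (negbTE (wt0 o)) orbF => /eqP k0.
  have := congr1 (fun M : 'M[K]_n => M b b) hk; rewrite !mxE eqxx /vd (negbTE bo) !mulr1n k0 mul0r add0r.
  move/eqP; rewrite mulf_eq0 (negbTE (wt0 b)) orbF => /eqP k1.
  by move=> i; case: i => -[|[|//]] hi; [rewrite -[RHS]k0|rewrite -[RHS]k1]; congr (k _); apply: val_inj.
have := hz (frame_free ao bo ab sg0) fu.
rewrite (eqE_first_order n1 en hcP hP qE sh) pE.
set q1 := dlp _; set pl := line u v P.
have q1E : q1 = \sum_k line u v (dirderiv (tnth f k) (dirderiv (tnth f k) P)) * \prod_(i | i != k) w i.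
  rewrite /q1 line_hess_first_order (dvn_det_diag (@dlp_derivation K) (w := w)).
    by apply: eq_bigr => k _; rewrite mxE dlp_eps.
  by move=> i j; rewrite mxE [LHS]evp_eps H0.
have szq1 : (size q1 <= e.+1)%N.
  rewrite /q1; apply: leq_trans (size_poly _ _) _.
  apply: size_line; apply: dhomog_hess.
  by apply: rpredD; [apply: dhomog_map | apply: rpredZ; apply: dhomog_map].
have szr : (size (q1 - pl * h)%R <= e.+1)%N.
  apply: leq_trans (size_polyD _ _) _; rewrite geq_max szq1 size_polyN /=.
  apply: leq_trans (size_polyMleq _ _) _.
  have sl : (size pl <= n.+1)%N := size_line u v hP.
  by move: (size h) (size pl) (e) en sh sl n2; clear; lia.
(* For k <> l0 the product retains the entry w l0, a multiple of X Y^(n - 3), and enough other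
   entries to be divisible by X Y^(n - 1). *)
have [S SE] : exists S, q1 - H1 * (C *: Y ^+ m) = 'X * Y ^+ (n - 1) * S.
  rewrite q1E (bigD1 l0) //= f_l0 -/H1 CE [X in X - _]addrC addrK.
  elim/big_rec: _ => [|k x kl [S ->]]; first by exists 0; rewrite mulr0.
  rewrite (bigD1 l0) 1?eq_sym //= w_l0.
  have nkl : ~~ [pred i | (i != k) && (i != l0)] l0 by rewrite /= eqxx andbF.
  have [g _ gE] := prod_w nkl; rewrite [X in _ * (_ * X)]gE.
  have cc : (2 * n <= #|[pred i : 'I_(2 * n + 1) | (i != k) && (i != l0)]|.+1)%N.
    rewrite -ltnS; have := cardC [pred i : 'I_(2 * n + 1) | i \in [:: k; l0]].
    have unq : uniq [:: k; l0] by rewrite /= inE kl.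
    rewrite (card_uniqP unq) card_ord /= (@eq_card _ [predC _] [pred i | (i != k) && (i != l0)]).
      by move: #|_|; clear; lia.
    by move=> i; rewrite !inE negb_or.
  move: cc; set t := #|_| => cc.
  have le : (n - 1 <= n - 3 + t * (n - 2))%N by move: t cc n2; clear; nia.
  exists (line u v (dirderiv (tnth f k) (dirderiv (tnth f k) P)) *
     ((- (c * sg *+ 2)) *: (g *: Y ^+ (n - 3 + t * (n - 2) - (n - 1)))) + S).
  rewrite mulrDr; congr (_ + _).
  rewrite [RHS]mulrCA; congr (_ * _).
  rewrite -!scalerAl -!scalerAr; congr (_ *: (_ *: _)).
  by rewrite -!mulrA -!exprD subnKC.
pose Z := H1 * (C *: Y ^+ (m - (n - 1))) + pl * ((sg *+ 2 / s * C) *: Y ^+ (m - 2 - (n - 1))) + 'X * S.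
have rE : q1 - pl * h = Y ^+ (n - 1) * Z.
  have YE : Y ^+ m = Y ^+ (n - 1) * Y ^+ (m - (n - 1)).
    by rewrite -exprD subnKC //; move: (m) mn; clear; lia.
  have YE2 : Y ^+ (m - 2) = Y ^+ (n - 1) * Y ^+ (m - 2 - (n - 1)).
    by rewrite -exprD subnKC //; move: (m) mn n2; clear; lia.
  rewrite -(subrK (H1 * (C *: Y ^+ m)) q1) SE /Z /h YE YE2 mulNr scaleNr -!mul_polyC.
  ring.
have [Z' ZE] : exists Z', Z = Z.[0]%:P + 'X * Z'.
  have /factor_theorem[Z' E] : root (Z - Z.[0]%:P) 0 by rewrite /root hornerD hornerN hornerC subrr.
  by exists Z'; rewrite mulrC -[X in Z' * X]subr0 -polyC0 -E addrC subrK.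
have rE' : q1 - pl * h = Z.[0] *: Y ^+ (n - 1) + p * ((c * s)^-1 *: Z').
  rewrite rE {1}ZE mulrDr mulrC mul_polyC; congr (_ + _).
  rewrite /p -scalerAl -scalerAr scalerA mulfV ?mulf_neq0 // scale1r.
  by rewrite mulrA [Y ^+ _ * 'X]mulrC.
have p0 : p != 0 by rewrite -size_poly_gt0 sz_p.
have szZ : (size ((c * s)^-1 *: Z') <= (e - n).+1)%N.
  have [->|Zn] := eqVneq ((c * s)^-1 *: Z') 0; first by rewrite size_poly0.
  have : (size (p * ((c * s)^-1 *: Z'))%R <= e.+1)%N.
    have -> : p * ((c * s)^-1 *: Z') = q1 - pl * h - Z.[0] *: Y ^+ (n - 1).
      by rewrite rE' addrC addKr.
    apply: leq_trans (size_polyD _ _) _; rewrite geq_max szr size_polyN /=.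
    by apply: leq_trans (size_scale_leq _ _) _; rewrite szY; move: (e) en n2; clear; lia.
  rewrite size_mul // sz_p; move: (size _) (e) en; clear; lia.
rewrite rE' resED resEZ resE_mul ?sz_p //; [|exact: ltnW (ltnW _)].
have n0 : (0 < n)%N by apply: ltnW.
have ne1 : (n - 1 <= e)%N by apply: leq_trans en; apply: leq_subr.
have sY1 : (size (Y ^+ (n - 1)) <= n)%N by rewrite szY subn1 prednK.
rewrite addr0 (resE_lead _ n0 ne1 sY1).
rewrite -subn1 Ylead p_lead mul1r => /eqP; rewrite mulf_eq0 expf_eq0 mulf_eq0 (negbTE c0) (negbTE s0) andbF orbF.
rewrite /Z !hornerD !hornerM hornerX mul0r addr0 !hornerZ.
have Y0 k : (Y ^+ k).[0] = 1 by rewrite horner_exp /Y hornerD hornerX hornerC add0r expr1n.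
rewrite !Y0 !mulr1 /H1 /pl !horner_line !scale0r !add0r => /eqP Z0.
apply/eqP; rewrite -(mulrI_eq0 _ (mulfI C0)); apply/eqP; rewrite -[RHS]Z0; ring.
Qed.

End Core.

Lemma dirderiv_comb (A : comNzRingType) n (U V : 'M[A]_n) x (P : {mpoly A[n * n]}) :
  dirderiv (U + x *: V) P = dirderiv U P + x *: dirderiv V P.
Proof.
rewrite /dirderiv scaler_sumr -big_split; apply: eq_bigr => i _ /=.
by rewrite linearD linearZ /= !mxE scalerDl scalerA.
Qed.

Lemma dirderivD (A : comNzRingType) n (U : 'M[A]_n) (P Q : {mpoly A[n * n]}) :
  dirderiv U (P + Q) = dirderiv U P + dirderiv U Q.
Proof. exact: (dirderiv_derivation U).1. Qed.

Section Vanish.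
Context (K : numFieldType) (n : nat).
Hypothesis n2 : (2 < n)%N.

(** Subtracting the relation for sg = -1 from that for sg = 1 leaves s T (v) + 2 P (v) = 0. This is
    polynomial in s, and at s = 0 only 2 P (v0) remains. *)
Lemma core_vanish (o a b : 'I_n) (P : {mpoly K[n * n]}) (c : K) :
  a != o -> b != o -> a != b -> c != 0 -> P \is n.-homog ->
  first_order_zero (c *: gdet K n) P ->
  P.@[mxvec (diag_mx (\row_r ((r != o) && (r != a))%:R)) 0] = 0.
Proof.
move=> ao bo ab c0 hP hz; set v0 := diag_mx _.
pose E := delta_mx b a : 'M[K]_n; pose E' := delta_mx a b : 'M[K]_n.
pose T := dirderiv E (dirderiv E' P) + dirderiv E' (dirderiv E P).
pose q := 'X * line (delta_mx a a) v0 T + 2 *: line (delta_mx a a) v0 P.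
have q0 : q = 0.
  apply: (@poly0_dense _ 'X); first by rewrite polyX_eq0.
  move=> s; rewrite hornerX => s0; rewrite hornerD hornerM hornerX hornerZ !horner_line.
  set v := (_ + _ : 'M_n).
  have vE : v = diag_mx (\row_r (if r == o then 0 else if r == a then s else 1)).
    apply/matrixP => i j; rewrite !mxE.
    case: (eqVneq i j) => [<-|ij]; last first.
      case: (eqVneq i a) => [ia|_]; rewrite ?mulr0n ?mulr0 ?addr0 //.
      by rewrite -ia [j == i]eq_sym (negbTE ij) mulr0.
    rewrite !mulr1n; case: (eqVneq i a) => [->|ia] /=.
      by rewrite (negbTE ao) mulr1 addr0.
    by rewrite mulr0 add0r andbT; case: eqP.
  have rel sg : sg != 0 -> ((dirderiv E (dirderiv E P)).@[mxvec v 0] + sg * T.@[mxvec v 0]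
     + sg * sg * (dirderiv E' (dirderiv E' P)).@[mxvec v 0]) + (sg *+ 2 / s) * P.@[mxvec v 0] = 0.
    move=> sg0; have := core_relation n2 ao bo ab c0 s0 sg0 hP hz.
    rewrite -vE !dirderiv_comb !dirderivD !dirderivZ !(mevalD, mevalZ) -/E -/E'.
    rewrite /T ?mevalD.
    move: (meval _ (dirderiv E (dirderiv E P))) (meval _ (dirderiv E (dirderiv E' P)))
      (meval _ (dirderiv E' (dirderiv E P))) (meval _ (dirderiv E' (dirderiv E' P)))
      (meval _ P) => p1 p2 p3 p4 p5 <-; ring.
  have r1 := rel 1 (oner_neq0 _).
  have rm : (-1 : K) != 0 by rewrite oppr_eq0 oner_neq0.
  have r2 := rel (-1) rm.
  have two : (2 : K) != 0 by rewrite pnatr_eq0.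
  have : 2 * (s * T.@[mxvec v 0] + 2 * P.@[mxvec v 0]) = 0.
    move: r1 r2; move: (meval _ (dirderiv E (dirderiv E P))) (meval _ T)
      (meval _ (dirderiv E' (dirderiv E' P))) (meval _ P) => p1 p2 p3 p4 r1 r2.
    rewrite -[RHS](mulr0 s) -[X in _ = s * X](subrr 0) -{1}r1 -r2; field.
    exact: s0.
  by move/eqP; rewrite mulf_eq0 (negbTE two) => /eqP.
have := congr1 (fun r : {poly K} => r.[0]) q0.
rewrite hornerD hornerM hornerX mul0r add0r hornerZ horner_line scale0r add0r horner0.
by move/eqP; rewrite mulf_eq0 pnatr_eq0 => /eqP.
Qed.

Lemma map_lact (A B : comNzRingType) (phi : {rmorphism A -> B}) (h : 'M[A]_(n * n)) (u : 'M[A]_n) :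
  map_mx phi (lact h u) = lact (map_mx phi h) (map_mx phi u).
Proof. by rewrite /lact map_vec_mx map_mxM map_mxvec map_trmx. Qed.

Lemma free_biact (g h : 'M[K]_n) m (f : m.-tuple 'M[K]_n) : g \in unitmx -> h \in unitmx ->
  free f -> free (map_tuple (lact (biact g h)) f).
Proof.
move=> gu hu /freeP ff; apply/freeP => k hk i; apply: ff.
have E : g *m (\sum_i k i *: f`_i) *m h = 0.
  rewrite -[RHS]hk mulmx_sumr mulmx_suml; apply: eq_bigr => j _.
  rewrite -scalemxAr -scalemxAl; congr (_ *: _).
  by rewrite (nth_map 0) ?size_tuple // lact_biact.
have := congr1 (fun M => invmx g *m M *m invmx h) E.
by rewrite mulmx0 mul0mx -mulmxA !mulmxA mulVmx // mul1mx -mulmxA mulmxV // mulmx1.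
Qed.

Lemma first_order_zero_biact (P : {mpoly K[n * n]}) (g h : 'M[K]_n) :
  g \in unitmx -> h \in unitmx -> P \is n.-homog ->
  first_order_zero (gdet K n) P ->
  first_order_zero ((\det g * \det h) *: gdet K n) (lsub (biact g h) P).
Proof.
move=> gu hu hP hz f u v ff fuv.
have n1 : (1 < n)%N by apply: ltnW.
set H := biact g h; pose H' := map_mx (@polyC K) H.
have FO : first_order ((\det g * \det h) *: gdet K n) (lsub H P) =
    lsub H' (first_order (gdet K n) P).
  rewrite -lsub_biact_gdet -/H /first_order !map_lsub -/H'.
  by rewrite /lsub comp_mpolyD comp_mpolyZ.
have hF : first_order (gdet K n) P \is n.-homog.
  by apply: rpredD; [apply/dhomog_map/gdet_homog | apply/rpredZ/dhomog_map].
rewrite FO (eqE_lsub H' _ _ _ hF n1) -!map_lact.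
have -> : map_tuple (lact H') (map_tuple (map_mx (@polyC K)) f) =
    map_tuple (map_mx (@polyC K)) (map_tuple (lact H) f).
  by apply: eq_from_tnth => i; rewrite !tnth_map map_lact.
apply: hz; first exact: free_biact.
exact: (@free_biact g h 2 [tuple u; v]).
Qed.

(** The equations are compatible with equivalence of matrices, so the vanishing at the diagonal v0
    of rank n - 2 gives the vanishing at g v0 h for g and h invertible, and at all smaller ranks by
    density. *)
Lemma tangent_vanish (P : {mpoly K[n * n]}) : P \is n.-homog ->
  first_order_zero (gdet K n) P ->
  forall x : 'M[K]_n, (\rank x + 1 < n)%N -> P.@[mxvec x 0] = 0.
Proof.
move=> hP hz x rx.
have on : (n.-1 < n)%N by case: (n) n2.
have an : (n - 2 < n)%N by lia.
have bn : (0 < n)%N by lia.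
pose o := Ordinal on; pose a := Ordinal an; pose b := Ordinal bn.
have ao : a != o by rewrite -val_eqE /=; lia.
have bo : b != o by rewrite -val_eqE /=; lia.
have ab : a != b by rewrite -val_eqE /=; lia.
pose v0 : 'M[K]_n := pid_mx (n - 2).
have v0E : v0 = diag_mx (\row_r ((r != o) && (r != a))%:R).
  apply/matrixP => i j; rewrite !mxE -!val_eqE /=.
  case: (eqVneq (i : nat) j) => [ij|_] /=; rewrite ?mulr0n // mulr1n.
  by congr (nat_of_bool _)%:R; have := ltn_ord i; lia.
have units g h : g \in unitmx -> h \in unitmx -> P.@[mxvec (g *m v0 *m h) 0] = 0.
  move=> gu hu; rewrite -lact_biact -lsub_meval v0E.
  apply: (core_vanish ao bo ab _ (lsub_homog _ hP) (first_order_zero_biact gu hu hP hz)).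
  by rewrite mulf_neq0 // -unitfE -unitmxE.
have hu := row_ebase_unit x; set h := row_ebase x in hu.
pose g := col_ebase x *m pid_mx (\rank x) : 'M[K]_n.
have xE : x = g *m v0 *m h.
  rewrite -{1}(mulmx_ebase x) /g -[_ *m v0]mulmxA mul_pid_mx; congr (_ *m pid_mx _ *m _).
  by have := rank_leq_row x; lia.
(* Here x = g v0 h with g possibly singular; t + g is invertible for all but finitely many t. *)
have q0 : line (v0 *m h) x P = 0.
  apply: (@poly0_dense _ (char_poly (- g))); first exact/monic_neq0/char_poly_monic.
  move=> t bt; rewrite horner_line.
  have -> : t *: (v0 *m h) + x = (t%:M + g) *m v0 *m h.
    by rewrite !mulmxDl -xE mul_scalar_mx scalemxAl.
  apply: units => //; rewrite unitmxE unitfE.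
  apply: contraNneq bt => d0; rewrite -[X in X == _]/(horner_eval t _) /char_poly -det_map_mx.
  rewrite -d0; apply/eqP; congr (\det _); apply/matrixP => i j.
  by rewrite !mxE /= /horner_eval hornerD hornerN hornerC hornerMn hornerX opprK.
have := horner_line (v0 *m h) x P 0; rewrite q0 horner0 scale0r add0r => <- //.
Qed.

End Vanish.

(** * Additive functions of a permutation *)

Section PermAdditive.
Context (K : comNzRingType) (n : nat).
Implicit Types (s t : 'S_n) (p q : 'I_n) (d : 'S_n -> K).

Local Notation T p q s := (tperm p q * s)%g.

(** T p q s exchanges the values of s at p and q. The condition kills the alternating sum of d over
    the group generated by two disjoint transpositions, translated by s; [exch3] does so for the
    symmetric group of {p, q, a}. *)
Definition exch4 d : Prop := forall s p q a b, uniq [:: p; q; a; b] ->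
  d s + d (T p q (T a b s)) = d (T p q s) + d (T a b s).

Definition exch3 d : Prop := forall s p q a, uniq [:: p; q; a] ->
  d s + d (T p q (T q a s)) + d (T q a (T p q s)) =
  d (T p q s) + d (T q a s) + d (T p a s).

(** By [exch4], exchanging the values at two other places does not affect the difference; such
    exchanges lead from s to t, each one reducing the number of disagreements. *)
Lemma exch4_local d p q s t : exch4 d -> p != q -> s p = t p -> s q = t q ->
  d s - d (T p q s) = d t - d (T p q t).
Proof.
move=> h4 pq; have [N] := ubnP #|[pred x | s x != t x]|.
elim: N s => // N IH s; rewrite ltnS => hN sp sq.
have [/forallP st|] := boolP [forall x, s x == t x].
  by have -> : s = t by apply/permP => x; apply/eqP/st.
rewrite negb_forall => /existsP[a sta].
pose b := (s^-1)%g (t a).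
have sb : s b = t a by rewrite /b permKV.
have ba : b != a by apply: contraNneq sta => e; rewrite -{1}e sb.
have ap : a != p by apply: contraNneq sta => ->; rewrite sp.
have aq : a != q by apply: contraNneq sta => ->; rewrite sq.
have bp : b != p.
  apply: contraNneq ap => e; apply/eqP/(perm_inj (s := t)).
  by rewrite -sb e sp.
have bq : b != q.
  apply: contraNneq aq => e; apply/eqP/(perm_inj (s := t)).
  by rewrite -sb e sq.
have tp : T a b s p = t p by rewrite permM tpermD.
have tq : T a b s q = t q by rewrite permM tpermD.
rewrite -(IH (T a b s)) //.
  have /(h4 s) : uniq [:: p; q; a; b].
    by rewrite /= !inE !negb_or pq ![p == _]eq_sym ![q == _]eq_sym ap bp aq bq eq_sym ba.
  by move=> h; apply/eqP; rewrite subr_eq -addrA [- _ + _]addrC addrA eq_sym subr_eq eq_sym addrC h addrC.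
apply: leq_trans hN; apply: proper_card; apply/properP; split.
  apply/fintype.subsetP => x; rewrite !inE permM; case: tpermP => [->|->|//] _.
    exact: sta.
  by apply: contraNneq ba => e; apply/eqP/(perm_inj (s := t)); rewrite -e sb.
exists a; rewrite !inE //.
by rewrite permM tpermL sb eqxx.
Qed.

Definition addfun (D : 'I_n -> 'I_n -> K) s : K := \sum_i D i (s i).

Lemma addfun_tperm D p q s : p != q ->
  addfun D (T p q s) = addfun D s - D p (s p) - D q (s q) + D p (s q) + D q (s p).
Proof.
move=> pq; rewrite /addfun (bigD1 p) // (bigD1 q) 1?eq_sym //=.
rewrite [\sum_i D i (s i)](bigD1 p) // [X in _ = _ + X - _ - _ + _ + _](bigD1 q) 1?eq_sym //=.
rewrite !permM tpermL tpermR.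
rewrite (eq_bigr (fun i => D i (s i))) => [|i /andP[ip iq]]; last by rewrite permM tpermD // eq_sym.
ring.
Qed.

Lemma addfun_exch4 D : exch4 (addfun D).
Proof.
move=> s p q a b; rewrite /= !inE !negb_or andbT => /and3P[/and3P[pq pa pb] /andP[qa qb] ab].
rewrite !addfun_tperm // !permM.
rewrite (tpermD (z := p)) 1?eq_sym // (tpermD (z := q)) 1?eq_sym //; ring.
Qed.

Lemma addfun_exch3 D : exch3 (addfun D).
Proof.
move=> s p q a; rewrite /= !inE !negb_or andbT => /andP[/andP[pq pa] qa].
rewrite !addfun_tperm // !permM !(tpermL, tpermR).
rewrite (tpermD (z := p)) 1?eq_sym // (tpermD (z := a)) //; ring.
Qed.

Lemma exch4B d d' : exch4 d -> exch4 d' -> exch4 (fun s => d s - d' s).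
Proof. by move=> h h' s p q a b u; rewrite addrACA -opprD h // h' // opprD addrACA. Qed.

Lemma exch3B d d' : exch3 d -> exch3 d' -> exch3 (fun s => d s - d' s).
Proof.
move=> h h' s p q a u; have e := h s p q a u; have e' := h' s p q a u.
transitivity ((d s + d (T p q (T q a s)) + d (T q a (T p q s))) -
   (d' s + d' (T p q (T q a s)) + d' (T q a (T p q s)))); first ring.
rewrite e e'; ring.
Qed.

Definition fixes (k : nat) s : Prop := forall x : 'I_n, (k <= x)%N -> s x = x.

Lemma fixes_tperm k s p q : (p < k)%N -> (q < k)%N -> fixes k s -> fixes k (T p q s).
Proof.
move=> pk qk fs x kx; rewrite permM tpermD ?fs //; apply: contraTneq kx => <-.
  by rewrite -ltnNge.
by rewrite -ltnNge.
Qed.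

Lemma fixes1 k : fixes k 1%g. Proof. by move=> x _; rewrite perm1. Qed.

(** For s moving kk, d s depends only on the place p with s p = kk and on the value s kk: it is g p
    (s kk). On p, q, kk, [exch3] makes g the sum of a function of p and a function of the value,
    which are stored in the column and in the row kk of D. *)
Lemma perm_additive_step d (o : 'I_n) (kk : 'I_n) : exch4 d -> exch3 d ->
  nat_of_ord o = 0%N ->
  (forall s, fixes kk s -> d s = 0) ->
  exists D, forall s, fixes kk.+1 s -> d s = addfun D s.
Proof.
move=> h4 h3 o0 d0.
(* For p, i < kk, this permutation sends p to kk and kk to i. *)
pose tau p i := (tperm p kk * tperm p i)%g.
pose g p i := d (tau p i).
have ltk (p : 'I_n) : (p < kk)%N -> p != kk by move=> h; rewrite -val_eqE /= ltn_eqF.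
have gE s p : fixes kk.+1 s -> (p < kk)%N -> s p = kk -> d s = g p (s kk).
  move=> fs pk sp.
  have skk : s kk != kk by apply: contraNneq (ltk _ pk) => e; apply/eqP/(perm_inj (s := s)); rewrite sp e.
  have lts : (s kk < kk)%N.
    rewrite ltn_neqAle -[nat_of_ord (s kk) != _]/(s kk != kk) skk /= leqNgt.
    apply/negP => lt; have e := fs _ lt; have /perm_inj e' := e.
    by rewrite e' eqxx in skk.
  have t1 : tau p (s kk) p = kk by rewrite permM tpermL tpermD // ?ltk // eq_sym.
  have t2 : tau p (s kk) kk = s kk by rewrite permM tpermR tpermL.
  have z u : fixes kk.+1 u -> u p = kk -> d (T p kk u) = 0.
    move=> fu up; apply: d0 => x; rewrite leq_eqVlt => /predU1P[e|lt].
      by have <- : kk = x by [apply: val_inj]; rewrite permM tpermR.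
    rewrite permM tpermD ?fu // -val_eqE /= neq_ltn ?lt ?orbT //.
    by rewrite (ltn_trans pk lt).
  have ft : fixes kk.+1 (tau p (s kk)).
    rewrite /tau -[tperm p (s kk)]mulg1; apply: fixes_tperm => //; first exact: ltnW.
    by apply: fixes_tperm (@fixes1 _); [apply: ltnW | apply: ltnW].
  have := @exch4_local d p kk s (tau p (s kk)) h4 (ltk _ pk).
  by rewrite sp t1 t2 => /(_ erefl erefl); rewrite (z s fs sp) (z _ ft t1) !subr0.
have gg (p q i j : 'I_n) : (p < kk)%N -> (q < kk)%N -> (i < kk)%N -> (j < kk)%N ->
    p != q -> i != j -> g p j + g q i = g p i + g q j.
  move=> pk qk ik jk pq ij.
  (* s is built to fix kk and to send p to i and q to j. *)
  pose q' := tperm p i q; pose s := (tperm p i * tperm q' j)%g.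
  have q'k : (q' < kk)%N by rewrite /q'; case: tpermP => // ->.
  have q'i : q' != i by rewrite /q' -{2}(tpermL p i) (inj_eq perm_inj) eq_sym.
  have sp : s p = i by rewrite permM tpermL tpermD // eq_sym.
  have sq : s q = j by rewrite permM -/q' tpermL.
  have fs : fixes kk s.
    by rewrite /s -[tperm q' j]mulg1; do 2 apply: fixes_tperm => //; apply: fixes1.
  have sk : s kk = kk by apply: fs.
  have fs1 : fixes kk.+1 s by move=> x /ltnW; apply: fs.
  have pkk := ltk _ pk; have qkk := ltk _ qk.
  have /(h3 s) : uniq [:: p; q; kk] by rewrite /= !inE negb_or pq pkk qkk.
  rewrite (d0 s fs) add0r (d0 _ (fixes_tperm pk qk fs)) add0r.
  have kk1 : (kk < kk.+1)%N by [].
  have pk1 : (p < kk.+1)%N by apply: ltnW.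
  have qk1 : (q < kk.+1)%N by apply: ltnW.
  clearbody s.
  rewrite (gE (T p q (T q kk s)) p); first last.
  - by rewrite !permM !tpermL sk.
  - exact: pk.
  - exact: fixes_tperm pk1 qk1 (fixes_tperm qk1 kk1 fs1).
  rewrite (gE (T q kk (T p q s)) q); first last.
  - by rewrite !permM tpermL (tpermD (z := kk)) ?sk.
  - exact: qk.
  - exact: fixes_tperm qk1 kk1 (fixes_tperm pk1 qk1 fs1).
  rewrite (gE (T q kk s) q); first last.
  - by rewrite !permM tpermL sk.
  - exact: qk.
  - exact: fixes_tperm qk1 kk1 fs1.
  rewrite (gE (T p kk s) p); first last.
  - by rewrite !permM tpermL sk.
  - exact: pk.
  - exact: fixes_tperm pk1 kk1 fs1.
  rewrite !permM (tpermD (z := kk)) // !tpermR sq sp => ->; exact: addrC.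
exists (fun i j : 'I_n => (if (j == kk) && (i < kk)%N then g i o else 0) +
                   (if (i == kk) && (j < kk)%N then g o j - g o o else 0)).
move=> s fs; rewrite /addfun big_split /=.
have [skk|skk] := eqVneq (s kk) kk.
  rewrite d0; last first.
    move=> x; rewrite leq_eqVlt => /predU1P[e|/fs//].
    by have <- : kk = x by [apply: val_inj].
  rewrite !big1 ?addr0 // => i _.
    by case: eqP => [->|//]; rewrite skk ltnn andbF.
  case: eqP => [si|//]; have /perm_inj -> : s i = s kk by rewrite si skk.
  by rewrite ltnn.
have sltk x : s x != x -> (x < kk.+1)%N.
  by apply: contraNT; rewrite -leqNgt => /fs ->.
pose p := (s^-1)%g kk.
have sp : s p = kk by rewrite /p permKV.
have pk : (p < kk)%N.
  have pn : p != kk by apply: contraNneq skk => e; rewrite -{1}e sp.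
  rewrite ltn_neqAle -[nat_of_ord p != _]/(p != kk) pn /= -ltnS; apply: sltk.
  by rewrite sp eq_sym.
have ik : (s kk < kk)%N.
  rewrite ltn_neqAle -[nat_of_ord (s kk) != _]/(s kk != kk) skk /= -ltnS; apply: sltk.
  by rewrite (inj_eq perm_inj).
have ok : (o < kk)%N by rewrite o0; apply: leq_ltn_trans pk.
rewrite (gE s p) // (bigD1 p) //= sp eqxx pk /= [X in _ + X + _]big1 ?addr0 => [|i ip]; last first.
  case: eqP => [si|//]; case/eqP: ip; apply/(perm_inj (s := s)).
  by rewrite sp.
rewrite (bigD1 kk) //= eqxx ik /= big1 ?addr0 => [|i /negbTE -> //].
have [->|po] := eqVneq p o; first by rewrite addrC subrK.
have [->|io] := eqVneq (s kk) o; first by rewrite subrr addr0.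
have := gg _ _ _ _ pk ok ik ok po io.
by move=> e; rewrite addrA e addrK.
Qed.

(** Additive functions satisfy both conditions, so d can be corrected successively to vanish on
    larger and larger symmetric groups. *)
Lemma perm_additive d : (0 < n)%N -> exch4 d -> exch3 d ->
  exists D, forall s, d s = addfun D s.
Proof.
move=> n0 h4 h3; pose o := Ordinal n0.
have H k : (k <= n)%N -> exists D, forall s, fixes k s -> d s = addfun D s.
  elim: k => [_|k IH kn].
    exists (fun i j => if (i == o) && (j == o) then d 1%g else 0) => s fs.
    have -> : s = 1%g by apply/permP => x; rewrite fs // perm1.
    rewrite /addfun (bigD1 o) //= perm1 eqxx big1 ?addr0 // => i /negbTE io.
    by rewrite perm1 io.
  have [D hD] := IH (ltnW kn).
  have [D' hD'] := @perm_additive_step (fun s => d s - addfun D s) o (Ordinal kn)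
    (exch4B h4 (@addfun_exch4 D)) (exch3B h3 (@addfun_exch3 D)) erefl
    (fun s fs => etrans (congr1 (fun x => x - addfun D s) (hD s fs)) (subrr _)).
  exists (fun i j => D i j + D' i j) => s fs.
  by rewrite /addfun big_split -/(addfun D s) -/(addfun D' s) -hD' //= addrC subrK.
have [D hD] := H n (leqnn n); exists D => s; apply: hD => x.
by rewrite leqNgt ltn_ord.
Qed.

End PermAdditive.

(** * Forms vanishing on matrices of corank two *)

Lemma line_coef1 (A : comNzRingType) n (y x : 'M[A]_n) (P : {mpoly A[n * n]}) :
  (line y x P)`_1 = (dirderiv y P).@[mxvec x 0].
Proof.
rewrite /line (dvn_mmap (coef1_derivation A)) => [|c]; last by rewrite coefC.
rewrite /dirderiv raddf_sum; apply: eq_bigr => i _ /=.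
rewrite mevalZ mulrC; congr (_ * _).
  by rewrite coefD coefZ coefX coefC mulr1 addr0.
have := horner_line y x P^`M(i) 0; rewrite scale0r add0r => <- //.
Qed.

Lemma meval_inj (K : numFieldType) n (P Q : {mpoly K[n * n]}) :
  (forall x : 'M[K]_n, P.@[mxvec x 0] = Q.@[mxvec x 0]) -> P = Q.
Proof.
move=> h; apply/eqP; rewrite -subr_eq0; apply/eqP/mpoly0_all => x.
by rewrite -(vec_mxK x) mevalB h subrr.
Qed.

(** * Linear vector fields and polarization *)

Section VectorFields.
Context (K : numFieldType) (n : nat).
Implicit Types (P Q : {mpoly K[n * n]}) (A B : 'M[K]_(n * n)) (x : 'M[K]_n).

(** The derivative of P along the linear vector field x |-> B x. *)
Definition vf B P : {mpoly K[n * n]} := \sum_i (\sum_j B i j *: 'X_j) * P^`M(i).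

Lemma vf_eval B P x : (vf B P).@[mxvec x 0] = (dirderiv (lact B x) P).@[mxvec x 0].
Proof.
rewrite /vf /dirderiv !raddf_sum; apply: eq_bigr => i _ /=.
rewrite mevalM mevalZ lactE raddf_sum; congr (_ * _); apply: eq_bigr => j _ /=.
by rewrite mevalZ mevalXU.
Qed.

Lemma vf_derivation B : derivation idfun (vf B).
Proof.
rewrite /vf; split=> a b.
  by rewrite -big_split; apply: eq_bigr => i _; rewrite mderivD mulrDr.
rewrite /= !mulr_sumr -big_split; apply: eq_bigr => i _ /=.
by rewrite mderivM; ring.
Qed.

Lemma vfC B c : vf B c%:MP = 0.
Proof. by rewrite /vf big1 // => i _; rewrite mderivC mulr0. Qed.

Lemma vfXU B i : vf B 'X_i = \sum_j B i j *: 'X_j.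
Proof.
rewrite /vf (bigD1 i) //= [X in _ + X]big1 ?addr0 => [|k ki].
  by rewrite mderivXU eqxx mulr1.
by rewrite mderivXU eq_sym (negbTE ki) mulr0.
Qed.

Lemma vfZ B c P : vf B (c *: P) = c *: vf B P.
Proof.
rewrite /vf scaler_sumr; apply: eq_bigr => i _.
by rewrite mderivZ -scalerAr.
Qed.

Lemma vf_lin A B c P : vf (A + c *: B) P = vf A P + c *: vf B P.
Proof.
rewrite /vf scaler_sumr -big_split; apply: eq_bigr => i _ /=.
rewrite scalerAl -mulrDl scaler_sumr -big_split; congr (_ * _); apply: eq_bigr => j _ /=.
by rewrite !mxE scalerDl scalerA.
Qed.

Lemma vf_comm A B P : vf B (vf A P) = vf A (vf B P) + vf (A *m B - B *m A) P.
Proof.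
have dA := vf_derivation A; have dB := vf_derivation B; set C := _ - _.
have dC := vf_derivation C.
move: P; apply: mpoly_ring_ind => [c|i|p q hp hq|p q hp hq].
- have z B' : vf B' 0 = 0 by exact: (dvn0 (ev := idfun) (vf_derivation B')).
  by rewrite !vfC ?z ?addr0.
- have lin A' B' : vf B' (\sum_j A' i j *: 'X_j) = \sum_k (A' *m B') i k *: 'X_k.
    rewrite (dvn_sum (ev := idfun) (vf_derivation B')).
    rewrite (eq_bigr (fun j => \sum_k (A' i j * B' j k) *: 'X_k)) => [|j _].
      by rewrite exchange_big; apply: eq_bigr => k _; rewrite mxE scaler_suml.
    by rewrite vfZ vfXU scaler_sumr; apply: eq_bigr => k _; rewrite scalerA.
  rewrite !vfXU !lin -big_split; apply: eq_bigr => k _.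
  have -> : C i k = (A *m B) i k - (B *m A) i k by rewrite /C [LHS]mxE; congr (_ + _); rewrite mxE.
  by rewrite /= -scalerDl addrC subrK.
- by rewrite !(dvnD (ev := idfun) dA, dvnD (ev := idfun) dB, dvnD (ev := idfun) dC) hp hq; ring.
rewrite (dvnM (ev := idfun) dA) (dvnM (ev := idfun) dB) (dvnM (ev := idfun) dC).
rewrite (dvnD (ev := idfun) dA) (dvnD (ev := idfun) dB).
rewrite !(dvnM (ev := idfun) dA) !(dvnM (ev := idfun) dB) hp hq /=; ring.
Qed.

(** The tangent directions at det to its orbit under linear substitutions. *)
Definition orbtan P : Prop := exists A, P = vf A (gdet K n).
Definition lowrank0 P : Prop :=
  P \is n.-homog /\ forall x, (\rank x + 1 < n)%N -> P.@[mxvec x 0] = 0.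

Lemma orbtanD P Q : orbtan P -> orbtan Q -> orbtan (P + Q).
Proof.
by move=> [A ->] [B ->]; exists (A + 1 *: B); rewrite vf_lin scale1r.
Qed.

Lemma orbtan0 : orbtan 0.
Proof.
exists 0; rewrite /vf big1 // => i _; rewrite big1 ?mul0r // => j _.
by rewrite mxE scale0r.
Qed.

Lemma orbtanZ c P : orbtan P -> orbtan (c *: P).
Proof.
move=> [A ->]; exists (0 + c *: A); rewrite vf_lin -[LHS]add0r; congr (_ + _).
rewrite /vf big1 // => i _; rewrite big1 ?mul0r // => j _.
by rewrite mxE scale0r.
Qed.

Lemma orbtan_sum (I : Type) (r : seq I) (F : I -> {mpoly K[n * n]}) (Q : pred I) :
  (forall i, Q i -> orbtan (F i)) -> orbtan (\sum_(i <- r | Q i) F i).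
Proof. by move=> h; elim/big_ind: _ => //; [exact: orbtan0 | exact: orbtanD]. Qed.

(** The commutator formula lets [vf B] act on det, where it is a scalar, at the cost of one more
    tangent direction. *)
Lemma orbtan_vf B c P : vf B (gdet K n) = c *: gdet K n -> orbtan P -> orbtan (vf B P).
Proof.
move=> hB [A ->]; rewrite vf_comm hB vfZ; apply: orbtanD; last by eexists.
by apply: orbtanZ; exists A.
Qed.

Lemma vf_biact_l (g : 'M[K]_n) :
  vf (biact g 1%:M) (gdet K n) = (\det (1%:M + 'X *: map_mx (@polyC K) g))`_1 *: gdet K n.
Proof.
apply: meval_inj => x; rewrite vf_eval -line_coef1 lact_biact mulmx1 line_gdet mevalZ.
have -> : 'X *: map_mx (@polyC K) (g *m x) + map_mx (@polyC K) x =
    (1%:M + 'X *: map_mx (@polyC K) g) *m map_mx (@polyC K) x.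
  by rewrite mulmxDl mul1mx -scalemxAl -map_mxM addrC.
rewrite det_mulmx det_map_mx coefMC /meval mmap_gdet; congr (_ * \det _).
by apply/matrixP => i j; rewrite mxE mxvecE.
Qed.

Lemma vf_biact_r (h : 'M[K]_n) :
  vf (biact 1%:M h) (gdet K n) = (\det (1%:M + 'X *: map_mx (@polyC K) h))`_1 *: gdet K n.
Proof.
apply: meval_inj => x; rewrite vf_eval -line_coef1 lact_biact mul1mx line_gdet mevalZ.
have -> : 'X *: map_mx (@polyC K) (x *m h) + map_mx (@polyC K) x =
    map_mx (@polyC K) x *m (1%:M + 'X *: map_mx (@polyC K) h).
  by rewrite mulmxDr mulmx1 -scalemxAr -map_mxM addrC.
rewrite det_mulmx det_map_mx mulrC coefMC /meval mmap_gdet; congr (_ * \det _).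
by apply/matrixP => i j; rewrite mxE mxvecE.
Qed.

(** P vanishes on the whole line x + t B x, hence so does its derivative in t. *)
Lemma lowrank0_vf B P : (0 < n)%N ->
  (forall x t, (\rank x + 1 < n)%N -> (\rank (t *: lact B x + x)%R + 1 < n)%N) ->
  lowrank0 P -> lowrank0 (vf B P).
Proof.
move=> n0 hB [hP PJ]; split.
  apply: rpred_sum => i _.
  suff : (\sum_j B i j *: 'X_j) * P^`M(i) \is (1 + n.-1).-homog by rewrite add1n prednK.
  apply: dhomogM; last exact: dhomog_mderiv.
  by apply: rpred_sum => j _; rewrite rpredZ // dhomogX /= mdeg1.
move=> x rx; rewrite vf_eval -line_coef1 (_ : line _ _ _ = 0) ?coef0 //.
by apply: poly0_all => t; rewrite horner_line PJ // hB.
Qed.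

(* The boolean exchanges the roles of rows (true) and columns (false). *)
Definition idx (b : bool) (a j : 'I_n) : 'I_(n * n) :=
  if b then mxvec_index a j else mxvec_index j a.

Lemma idx_neg b a j : idx (~~ b) a j = idx b j a.
Proof. by case: b. Qed.

Lemma idx_eq b a j a' j' : (idx b a j == idx b a' j') = (a == a') && (j == j').
Proof. by case: b; rewrite /idx mxvec_index_eq // andbC. Qed.

Lemma sum_idx (R : nmodType) b (F : 'I_(n * n) -> R) : \sum_v F v = \sum_a \sum_j F (idx b a j).
Proof. by rewrite sum_mxvec; case: b => //=; rewrite exchange_big. Qed.

(** Left or right multiplication by an elementary matrix; the field [rop] is the polarization
    operator that replaces a variable of row (or column) a by the corresponding one of a'. *)
Definition rmx (b : bool) (a a' : 'I_n) : 'M[K]_(n * n) :=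
  if b then biact (delta_mx a a') 1%:M else biact 1%:M (delta_mx a' a).

Definition rop b a a' P := vf (rmx b a a') P.

Lemma ropE b a a' P : rop b a a' P = \sum_j 'X_(idx b a' j) * P^`M(idx b a j).
Proof.
apply: meval_inj => x; rewrite /rop vf_eval /dirderiv !raddf_sum (sum_idx b) /=.
rewrite (bigD1 a) //= [X in _ + X]big1 ?addr0 => [|c ca]; last first.
  rewrite big1 // => j _; rewrite mevalZ /rmx; case: b => /=; rewrite lact_biact mxvecE.
    by rewrite mulmx1 mxE big1 ?mul0r // => k _; rewrite mxE (negbTE ca) mul0r.
  by rewrite mul1mx mxE big1 ?mul0r // => k _; rewrite mxE (negbTE ca) andbF mulr0.
apply: eq_bigr => j _; rewrite mevalZ mevalM mevalXU; congr (_ * _).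
rewrite /rmx; case: b => /=; rewrite lact_biact !mxvecE.
  rewrite mulmx1 mxE (bigD1 a') //= big1 ?addr0 => [|k ka]; first by rewrite mxE !eqxx mul1r.
  by rewrite mxE (negbTE ka) andbF mul0r.
rewrite mul1mx mxE (bigD1 a') //= big1 ?addr0 => [|k ka]; first by rewrite mxE !eqxx mulr1.
by rewrite mxE (negbTE ka) mulr0.
Qed.

Lemma lowrank0_rop b a a' P : (0 < n)%N -> lowrank0 P -> lowrank0 (rop b a a' P).
Proof.
move=> n0; apply: lowrank0_vf => // x t rx; apply: leq_ltn_trans rx; rewrite leq_add2r.
rewrite /rmx; case: b; rewrite lact_biact ?mulmx1 ?mul1mx.
  have -> : t *: (delta_mx a a' *m x) + x = (t *: delta_mx a a' + 1%:M) *m x.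
    by rewrite mulmxDl mul1mx scalemxAl.
  exact: mxrankM_maxr.
have -> : t *: (x *m delta_mx a' a) + x = x *m (t *: delta_mx a' a + 1%:M).
  by rewrite mulmxDr mulmx1 scalemxAr.
exact: mxrankM_maxl.
Qed.

Lemma orbtan_rop b a a' P : orbtan P -> orbtan (rop b a a' P).
Proof.
by rewrite /rop /rmx; case: b; apply: orbtan_vf; [exact: vf_biact_l|exact: vf_biact_r].
Qed.

Definition rdeg (b : bool) (m : 'X_{1..n * n}) (a : 'I_n) : nat := (\sum_j m (idx b a j))%N.

(** P is a weight vector of the torus scaling rows and columns: ga true lists its row degrees, ga
    false its column degrees. *)
Definition ht (ga : bool -> 'I_n -> nat) P : Prop :=
  forall m, m \in msupp P -> forall b a, rdeg b m a = ga b a.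

Lemma rdegD b m m' a : rdeg b (m + m')%MM a = (rdeg b m a + rdeg b m' a)%N.
Proof. by rewrite /rdeg -big_split; apply: eq_bigr => j _; rewrite mnmDE. Qed.

Lemma rdegU b a j b' c : rdeg b' U_(idx b a j)%MM c = if b' == b then (c == a) : nat else (c == j).
Proof.
have H a' j' : rdeg b' U_(idx b' a' j')%MM c = (c == a').
  rewrite /rdeg (bigD1 j') //= mnm1E idx_eq eqxx andbT big1 ?addn0 1?eq_sym // => i ij.
  by rewrite mnm1E idx_eq [j' == i]eq_sym (negbTE ij) andbF.
case: eqP => [<-|bb]; first exact: H.
have -> : b = ~~ b' by case: (b) bb; case: (b') => //.
by rewrite idx_neg H.
Qed.

Lemma ht_rop b a a' ga P : a != a' -> ht ga P ->
  ht (fun b' c => if b' == b then (ga b c - (c == a) + (c == a'))%N else ga b' c) (rop b a a' P).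
Proof.
move=> aa hP m; rewrite mcoeff_msupp ropE => hm b' c.
have [j hj] : exists j, m \in msupp ('X_(idx b a' j) * P^`M(idx b a j)).
  apply: contrapT => none; case/eqP: hm; rewrite raddf_sum /= big1 // => j _.
  by apply: memN_msupp_eq0; apply/negP => h; apply: none; exists j.
move: hj; rewrite mulrC (perm_mem (msuppMX _ _)) => /mapP[m1].
rewrite mcoeff_msupp mcoeff_deriv => hm1 ->.
have m0P : (m1 + U_(idx b a j))%MM \in msupp P.
  by rewrite mcoeff_msupp; apply: contraNneq hm1 => ->; rewrite mul0rn.
have := hP _ m0P b' c; rewrite !rdegD !rdegU; case: eqP => [->|_] <-.
  by rewrite addnK addnC.
by rewrite addnC.
Qed.

Lemma mderiv_ht0 b a ga P j : ht ga P -> ga b a = 0%N -> P^`M(idx b a j) = 0.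
Proof.
move=> hP g0; apply/mpolyP => m; rewrite mcoeff_deriv mcoeff0.
have [h|/memN_msupp_eq0->] := boolP ((m + U_(idx b a j))%MM \in msupp P); last by rewrite mul0rn.
by have := hP _ h b a; rewrite rdegD rdegU !eqxx g0 addn1.
Qed.

Lemma rop_euler b a ga P : ht ga P -> rop b a a P = (ga b a)%:R *: P.
Proof.
move=> hP; have E j m : 'X_(idx b a j) * ('X_[m] : {mpoly K[n * n]})^`M(idx b a j) =
    (m (idx b a j))%:R *: 'X_[m].
  rewrite mderivX -scalerAr -mpolyXD; case: (posnP (m (idx b a j))) => [->|m0].
    by rewrite !scale0r.
  congr (_ *: 'X_[_]); rewrite addmC submK //; apply/mnm_lepP => v; rewrite mnm1E.
  by case: eqP => // <-.
rewrite ropE [P in LHS]mpolyE [P in RHS]mpolyE scaler_sumr.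
transitivity (\sum_j \sum_(m <- msupp P) (P@_m * (m (idx b a j))%:R) *: ('X_[m] : {mpoly K[n * n]})).
  apply: eq_bigr => j _; rewrite (raddf_sum (mderiv _)) /= mulr_sumr; apply: eq_bigr => m _.
  by rewrite mderivZ -scalerAr E scalerA.
rewrite exchange_big /= big_seq [RHS]big_seq; apply: eq_bigr => m mP.
rewrite -scaler_suml -mulr_sumr -natr_sum -/(rdeg b m a) (hP m mP) scalerA.
by rewrite mulrC.
Qed.

(** As P has degree 0 in a', the second operator only acts on the factors introduced by the first
    one, and the Euler operator of a results. *)
Lemma rop_back b a a' ga P : a != a' -> ht ga P -> ga b a' = 0%N ->
  rop b a' a (rop b a a' P) = (ga b a)%:R *: P.
Proof.
move=> aa hP g0; rewrite -(rop_euler b a hP) [rop b a a' P]ropE [RHS]ropE.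
have d := vf_derivation (rmx b a' a).
rewrite /rop (dvn_sum (ev := idfun) d); apply: eq_bigr => j _.
rewrite (dvnM (ev := idfun) d) /=.
have -> : vf (rmx b a' a) P^`M(idx b a j) = 0.
  rewrite -/(rop b a' a _) ropE big1 // => i _.
  by rewrite mderiv_comm (mderiv_ht0 _ hP g0) mderiv0 mulr0.
rewrite mulr0 add0r mulrC; congr (_ * _).
rewrite -/(rop b a' a _) ropE (bigD1 j) //= big1 ?addr0 => [|i ij].
  by rewrite mderivXU eqxx mulr1.
by rewrite mderivXU idx_eq [j == i]eq_sym (negbTE ij) andbF mulr0.
Qed.

Lemma ht_sum ga P b : P \is n.-homog -> P != 0 -> ht ga P -> (\sum_a ga b a)%N = n.
Proof.
move=> /dhomogP hP P0 hga.
have [m mP] : exists m, m \in msupp P.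
  case E : (msupp P) => [|m s]; last by exists m; rewrite inE eqxx.
  by move: P0; rewrite -msupp_eq0 E.
by rewrite -[RHS](hP m mP) /= mdegE (sum_idx b); apply: eq_bigr => a _; rewrite -(hga m mP).
Qed.

Lemma rank_kill (R : 'M[K]_(2, n)) (C : 'M[K]_(n, 2)) x :
  R *m C = 1%:M -> R *m x = 0 -> (\rank x + 1 < n)%N.
Proof.
move=> RC Rx; have rR : \rank R = 2 by apply/eqP/row_freeP; exists C.
by have := mulmx0_rank_max Rx; rewrite rR addnC addn1 addn2.
Qed.

(** P is unchanged when the rows a and a' of its argument are set to zero, which leaves a matrix of
    rank at most n - 2. *)
Lemma ht_two_zero ga P b a a' : lowrank0 P -> ht ga P -> a != a' ->
  ga b a = 0%N -> ga b a' = 0%N -> P = 0.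
Proof.
move=> [_ hJ] hP aa g1 g2; apply: meval_inj => x; rewrite meval0.
pose y (v : 'I_(n * n)) : K := if [exists j, (v == idx b a j) || (v == idx b a' j)] then 0 else mxvec x 0 v.
pose x' : 'M[K]_n := vec_mx (\row_v y v).
have x'E v : mxvec x' 0 v = y v by rewrite vec_mxK mxE.
have -> : P.@[mxvec x 0] = P.@[mxvec x' 0].
  rewrite !mevalE big_seq [RHS]big_seq; apply: eq_bigr => m mP; congr (_ * _).
  apply: eq_bigr => v _; rewrite x'E /y; case: existsP => // -[j /orP hv].
  suff -> : m v = 0%N by rewrite !expr0.
  have m0 c : ga b c = 0%N -> v = idx b c j -> m v = 0%N.
    move=> gc ->; apply/eqP; rewrite -leqn0 -gc -(hP m mP b c) /rdeg (bigD1 j) //=.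
    exact: leq_addr.
  by case: hv => /eqP; apply: m0.
apply: hJ.
pose R : 'M[K]_(2, n) := \matrix_(i, j) (if i == ord0 then (j == a)%:R else (j == a')%:R).
have kill (z : 'M[K]_n) : (forall j, z a j = 0) -> (forall j, z a' j = 0) -> (\rank z + 1 < n)%N.
  move=> z1 z2; apply: (@rank_kill R R^T).
    apply/matrixP => i k; rewrite !mxE.
    have e (u w : 'I_n) : \sum_j (j == u)%:R * (j == w)%:R = (u == w)%:R :> K.
      rewrite (bigD1 u) //= eqxx mul1r big1 ?addr0 // => j /negbTE->.
      by rewrite mul0r.
    rewrite (eq_bigr (fun j => (j == (if i == ord0 then a else a'))%:R *
      (j == (if k == ord0 then a else a'))%:R)) => [|j _].
      rewrite e -(val_eqE i ord0) -(val_eqE k ord0) -(val_eqE i k).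
      case: i => -[|[|//]] hi; case: k => -[|[|//]] hk /=; rewrite ?eqxx ?(negbTE aa) //.
      by rewrite eq_sym (negbTE aa).
    by rewrite !mxE; case: ifP => _; case: ifP.
  apply/matrixP => i k; rewrite !mxE.
  case: (eqVneq i ord0) => [i0|i0].
    rewrite (bigD1 a) //= !mxE z1 mulr0 big1 ?addr0 // => j ja.
    by rewrite !mxE i0 /= (negbTE ja) mul0r.
  rewrite (bigD1 a') //= !mxE z2 mulr0 big1 ?addr0 // => j ja.
  by rewrite !mxE (negbTE i0) (negbTE ja) mul0r.
have y0 c j : c = a \/ c = a' -> mxvec x' 0 (idx b c j) = 0.
  move=> hc; rewrite x'E /y; case: existsP => // -[]; exists j.
  by case: hc => ->; rewrite eqxx ?orbT.
case: b @y g1 g2 x' x'E y0 => y g1 g2 x' x'E y0.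
  by apply: kill => j; rewrite -mxvecE; apply: y0; [left|right].
rewrite -mxrank_tr; apply: kill => j; rewrite mxE -mxvecE; apply: (y0 _ j); [by left|by right].
Qed.

(** The n degrees add up to n, and at most one of them is zero. *)
Lemma ht_ones_or ga P b : lowrank0 P -> P != 0 -> ht ga P ->
  (forall a, ga b a = 1%N) \/
  exists a a', [/\ a != a', ga b a' = 0%N, (1 < ga b a)%N & forall c, c != a' -> (0 < ga b c)%N].
Proof.
move=> hJ P0 hP; have hs := ht_sum b hJ.1 P0 hP.
have [/existsP[a' /eqP g0]|/fintype.existsPn pos] := boolP [exists a', ga b a' == 0%N].
  right; have pos c : c != a' -> (0 < ga b c)%N.
    rewrite lt0n => ca; apply: contraNneq P0 => gc.
    by apply/eqP; apply: (ht_two_zero hJ hP ca gc g0).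
  have [/existsP[a ha]|/fintype.existsPn le1] := boolP [exists a, (1 < ga b a)%N].
    by exists a, a'; split=> //; apply: contraTneq ha => ->; rewrite g0.
  suff : (n < n)%N by rewrite ltnn.
  rewrite -{1}hs (bigD1 a') //= g0 add0n.
  apply: leq_ltn_trans (_ : (\sum_(i | i != a') 1 < n)%N).
    by apply: leq_sum => i _; rewrite leqNgt le1.
  rewrite sum1_card cardC1 card_ord; by rewrite ltn_predL (leq_ltn_trans _ (ltn_ord a')).
left => a; apply/eqP; rewrite eqn_leq lt0n pos andbT leqNgt; apply/negP => ha.
suff : (n < n)%N by rewrite ltnn.
rewrite -{2}hs (bigD1 a) //=.
have : (\sum_(i | i != a) 1 <= \sum_(i | i != a) ga b i)%N.
  by apply: leq_sum => i _; rewrite lt0n pos.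
rewrite sum1_card cardC1 card_ord.
have := leq_ltn_trans (leq0n _) (ltn_ord a); move: ha; move: (ga b a) (\sum_(_ | _) _)%N => u w; lia.
Qed.

(* A form of row type (2, 1, ..., 1, 0) is recovered from its polarization. *)
Lemma reduce_line b P ga : (0 < n)%N ->
  (forall Q ga', lowrank0 Q -> ht ga' Q -> (forall a, ga' b a = 1%N) ->
     ga' (~~ b) = ga (~~ b) -> orbtan Q) ->
  lowrank0 P -> ht ga P -> orbtan P.
Proof.
move=> n0 hones hJ hP; have [->|P0] := eqVneq P 0; first exact: orbtan0.
have [ones|[a [a' [aa g0 g2 pos]]]] := ht_ones_or b hJ P0 hP; first exact: hones hP ones erefl.
have hs := ht_sum b hJ.1 P0 hP.
have -> : P = (ga b a)%:R^-1 *: rop b a' a (rop b a a' P).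
  by rewrite (rop_back aa hP g0) scalerA mulVf ?scale1r // pnatr_eq0 -lt0n ltnW.
apply/orbtanZ/orbtan_rop; have hQ := ht_rop aa hP (b := b).
apply: (hones _ _ (lowrank0_rop b a a' n0 hJ) hQ).
  (* After polarization all degrees are positive and still add up to n, so each of them is 1. *)
  have pos' c : (0 < ga b c - (c == a) + (c == a'))%N.
    have [->|ca'] := eqVneq c a'; first by rewrite addn1.
    rewrite addn0; case: eqP => [->|_]; first by rewrite subn1; lia.
    by rewrite subn0 pos.
  move=> c; rewrite eqxx; apply/eqP; rewrite eqn_leq pos' andbT leqNgt; apply/negP => big.
  have sumE : (\sum_c (ga b c - (c == a) + (c == a')) = n)%N.
    have aa' : a' != a by rewrite eq_sym.
    rewrite -[RHS]hs (bigD1 a) //= (bigD1 a') //= [RHS](bigD1 a) //= [X in _ = (_ + X)%N](bigD1 a') //=.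
    rewrite !eqxx (negbTE aa) (negbTE aa') g0.
    rewrite (eq_bigr (fun i => ga b i)) => [|i /andP[/negbTE-> /negbTE->]]; last by rewrite subn0 addn0.
    by move: (\sum_(_ | _) _)%N => u; lia.
  suff : (n < n)%N by rewrite ltnn.
  rewrite -{2}sumE (bigD1 c) //=.
  have : (\sum_(i | i != c) 1 <= \sum_(i | i != c) (ga b i - (i == a) + (i == a')))%N.
    by apply: leq_sum => i _.
  rewrite sum1_card cardC1 card_ord.
  have := leq_ltn_trans (leq0n _) (ltn_ord c); move: big; move: (_ + _)%N (\sum_(_ | _) _)%N => u w; lia.
apply: funext => c; by case: (b).
Qed.

End VectorFields.

(** * Decomposition into torus weights *)

Section WeightSplit.
Context (K : numFieldType) (n : nat).
Implicit Types (P Q : {mpoly K[n * n]}) (x : 'M[K]_n).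

(** The exponents of a one-parameter torus acting on rows and columns. Row and column degrees are at
    most n, so they are the digits in base n + 1 of the weight. *)
Definition wexp (v : 'I_(n * n)) : nat :=
  (\sum_a \sum_j (v == mxvec_index a j) * (n.+1 ^ a + n.+1 ^ (n + j)))%N.

Definition weight (m : 'X_{1..n * n}) : nat :=
  (\sum_(i < n) rdeg true m i * n.+1 ^ i + \sum_(i < n) rdeg false m i * n.+1 ^ (n + i))%N.

Lemma wexpE a j : wexp (mxvec_index a j) = (n.+1 ^ a + n.+1 ^ (n + j))%N.
Proof.
rewrite /wexp (bigD1 a) //= (bigD1 j) //= eqxx mul1n [X in (_ + X + _)%N]big1 ?addn0.
  rewrite [X in (_ + X)%N]big1 ?addn0 // => a' aa; rewrite big1 // => j' _.
  by rewrite mxvec_index_eq eq_sym (negbTE aa).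
by move=> j' jj; rewrite mxvec_index_eq [j == _]eq_sym (negbTE jj) andbF.
Qed.

Lemma weightE m : weight m = (\sum_v wexp v * m v)%N.
Proof.
rewrite sum_mxvec (eq_bigr (fun a : 'I_n => \sum_(j < n) (m (mxvec_index a j) * n.+1 ^ a
   + m (mxvec_index a j) * n.+1 ^ (n + j)))%N) => [|a _]; last first.
  by apply: eq_bigr => j _; rewrite wexpE mulnC mulnDr.
rewrite (eq_bigr _ (fun a _ => big_split _ _ _ _ _)) big_split /=; congr (_ + _)%N.
  by apply: eq_bigr => a _; rewrite /rdeg /= big_distrl.
rewrite exchange_big; apply: eq_bigr => j _; by rewrite /rdeg /= big_distrl.
Qed.

Lemma weight_inj m m' : mdeg m = n -> mdeg m' = n -> weight m = weight m' ->
  forall b a, rdeg b m a = rdeg b m' a.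
Proof.
move=> dm dm' e b a.
pose g (m : 'X_{1..n * n}) (i : 'I_(n + n)) : nat :=
  match split i with inl a => rdeg true m a | inr a => rdeg false m a end.
have rle b' a' u : mdeg u = n -> (rdeg b' u a' < n.+1)%N.
  move=> du; rewrite ltnS -[X in (_ <= X)%N]du mdegE (sum_idx b') (bigD1 a') //=.
  exact: leq_addr.
have gle u i : mdeg u = n -> (g u i < n.+1)%N.
  by move=> du; rewrite /g; case: split => c; apply: rle.
have gw u : (\sum_i g u i * n.+1 ^ i)%N = weight u.
  rewrite big_split_ord /weight /=; congr (_ + _)%N; apply: eq_bigr => i _.
    by rewrite /g (unsplitK (inl i)).
  by rewrite /g (unsplitK (inr i)).
have gg : g m =1 g m'.
  by apply: (digits_inj (b := n.+1)) => [i|i|]; [exact: gle|exact: gle|rewrite !gw].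
case: b; first by have := gg (lshift n a); rewrite /g (unsplitK (inl a)).
by have := gg (rshift n a); rewrite /g (unsplitK (inr a)).
Qed.

Definition wpart P k : {mpoly K[n * n]} :=
  \sum_(m <- msupp P | weight m == k) P@_m *: 'X_[m].

Lemma wpart_supp P k m : m \in msupp (wpart P k) -> m \in msupp P /\ weight m = k.
Proof.
rewrite mcoeff_msupp => h; apply: contrapT => none; case/eqP: h.
rewrite /wpart raddf_sum big_seq_cond big1 //= => m' /andP[m'P /eqP wk].
rewrite mcoeffZ mcoeffX; case: eqP => [e|]; last by rewrite mulr0.
by case: none; rewrite -e.
Qed.

Lemma wpart_sum P : P = \sum_(k < (\max_(m <- msupp P) weight m).+1) wpart P k.
Proof.
rewrite [LHS]mpolyE (exchange_big_dep xpredT) //= big_seq [RHS]big_seq; apply: eq_bigr => m mP.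
have lt : (weight m < (\max_(m <- msupp P) weight m).+1)%N by rewrite ltnS leq_bigmax_seq.
rewrite (big_pred1 (Ordinal lt)) // => i; by rewrite -val_eqE /= eq_sym.
Qed.

(** Scaling rows and columns by powers of t does not increase the rank, and the value of a weight
    component is a coefficient of the resulting polynomial in t. *)
Lemma wpart_lowrank0 P k : lowrank0 P -> lowrank0 (wpart P k).
Proof.
move=> [hP PJ]; split.
  rewrite /wpart big_seq_cond; apply: rpred_sum => m /andP[mP _].
  by rewrite rpredZ // dhomogX /=; apply/eqP/(dhomogP _ _ _ hP).
move=> x rx.
pose q := \sum_(m <- msupp P) (P@_m * \prod_i mxvec x 0 i ^+ m i) *: 'X^(weight m).
have -> : (wpart P k).@[mxvec x 0] = q`_k.
  rewrite coef_sum /wpart raddf_sum /= big_mkcond /=; apply: eq_bigr => m _.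
  rewrite coefZ coefXn [k == _]eq_sym; case: eqP => _; last by rewrite mulr0.
  by rewrite mevalZ mevalX mulr1.
rewrite (_ : q = 0) ?coef0 //; apply: poly0_all => t.
pose y : 'M[K]_n := diag_mx (\row_(i < n) t ^+ (n.+1 ^ i)) *m x *m diag_mx (\row_(j < n) t ^+ (n.+1 ^ (n + j))).
rewrite -[RHS](PJ y); last first.
  apply: leq_ltn_trans rx; rewrite leq_add2r; apply: leq_trans (mxrankM_maxl _ _) _.
  exact: mxrankM_maxr.
have yE v : mxvec y 0 v = t ^+ wexp v * mxvec x 0 v.
  case/mxvec_indexP: v => i j; rewrite !mxvecE wexpE /y mul_mx_diag mxE mul_diag_mx !mxE.
  by rewrite exprD; ring.
rewrite horner_sum mevalE; apply: eq_bigr => m _.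
rewrite hornerZ hornerXn -mulrA; congr (_ * _).
rewrite weightE -prodrXr -big_split /=; apply: eq_bigr => v _.
by rewrite yE exprMn -exprM mulrC.
Qed.

Lemma wpart_ht P k : lowrank0 P -> exists ga, ht ga (wpart P k).
Proof.
move=> [/dhomogP hP _]; case E : (msupp (wpart P k)) => [|m0 s].
  by exists (fun _ _ => 0%N) => m; rewrite E.
exists (fun b a => rdeg b m0 a) => m /wpart_supp[mP wm] b a.
have [m0P w0] : m0 \in msupp P /\ weight m0 = k by apply: wpart_supp; rewrite E mem_head.
by apply: weight_inj; rewrite ?(hP _ mP) ?(hP _ m0P) // w0.
Qed.

End WeightSplit.

(** * Forms of degree one in every row and column *)

Section OnesCase.
Context (K : numFieldType) (n : nat).
Implicit Types (P Q : {mpoly K[n * n]}) (x : 'M[K]_n) (s : 'S_n).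

(** The row vectors e_p - e_q and e_a - e_b are independent and kill x; b may be equal to q, as
    happens for three equal rows. *)
Lemma rank_eq_rows x p q a b : p != q -> p != a -> q != a -> a != b -> b != p ->
  (forall j, x p j = x q j) -> (forall j, x a j = x b j) -> (\rank x + 1 < n)%N.
Proof.
move=> pq pa qa ab bp xpq xab.
pose u (i : 'I_2) := if i == ord0 then p else a.
pose w (i : 'I_2) := if i == ord0 then q else b.
pose R : 'M[K]_(2, n) := \matrix_(i, j) ((j == u i)%:R - (j == w i)%:R).
have Rm m (C : 'M[K]_(n, m)) i k : (R *m C) i k = C (u i) k - C (w i) k.
  have e v : \sum_j (j == v)%:R * C j k = C v k.
    by rewrite (bigD1 v) //= eqxx mul1r big1 ?addr0 // => j /negbTE->; rewrite mul0r.
  rewrite mxE -!e -sumrB; apply: eq_bigr => j _; by rewrite mxE mulrBl.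
apply: (@rank_kill _ _ R (\matrix_(j, k) (j == u k)%:R)); apply/matrixP => i k.
  rewrite Rm !mxE /u /w -(val_eqE i ord0) -(val_eqE k ord0) -(val_eqE i k).
  case: i => -[|[|//]] hi; case: k => -[|[|//]] hk /=; rewrite ?eqxx ?[a == p]eq_sym ?[q == p]eq_sym ?[b == a]eq_sym.
  - by rewrite (negbTE pq) subr0.
  - by rewrite (negbTE pa) (negbTE qa) subr0.
  - by rewrite (negbTE pa) (negbTE bp) subr0.
  by rewrite (negbTE ab) subr0.
by rewrite Rm mxE /u /w; case: ifP => _; rewrite ?xpq ?xab subrr.
Qed.

Definition permmnm s : 'X_{1..n * n} := (\sum_r U_(mxvec_index r (s r)))%MM.

Lemma permmnmE s a j : permmnm s (mxvec_index a j) = (s a == j) :> nat.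
Proof.
rewrite /permmnm mnm_sumE (bigD1 a) //= mnm1E mxvec_index_eq eqxx /= big1 ?addn0 // => r ra.
by rewrite mnm1E mxvec_index_eq (negbTE ra).
Qed.

Lemma permmnm_inj : injective permmnm.
Proof.
move=> s t e; apply/permP => a.
have := permmnmE t a (s a); rewrite -e permmnmE eqxx.
by case: eqP => // ->.
Qed.

Lemma ones_permmnm (m : 'X_{1..n * n}) : (forall b a, rdeg b m a = 1%N) -> exists s, m = permmnm s.
Proof.
move=> h; have ex a : exists j, m (mxvec_index a j) = 1%N /\ forall k, k != j -> m (mxvec_index a k) = 0%N.
  have := h true a; rewrite /rdeg /= => /eqP/sum_nat_eq1.
  by move=> [j [_ hj hk]]; exists j; split=> // k kj; apply: hk.
pose f a := projT1 (cid (ex a)).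
have f1 a : m (mxvec_index a (f a)) = 1%N := (projT2 (cid (ex a))).1.
have f0 a k : k != f a -> m (mxvec_index a k) = 0%N := (projT2 (cid (ex a))).2 k.
have fI : injective f.
  move=> a b e; apply/eqP/negPn/negP => ab.
  have := h false (f a); rewrite /rdeg /= (bigD1 a) //= (bigD1 b) 1?eq_sym //= f1.
  by rewrite {1}e f1.
exists (perm fI); apply/mnmP => v; case/mxvec_indexP: v => a j.
by rewrite permmnmE permE; case: eqP => [<-|/eqP ne]; rewrite ?f1 // f0 // eq_sym.
Qed.

Lemma ones_expand P : ht (fun _ _ => 1%N) P ->
  P = \sum_s P@_(permmnm s) *: \prod_r 'X_(mxvec_index r (s r)).
Proof.
move=> hP; have XE s : \prod_r 'X_(mxvec_index r (s r)) = 'X_[permmnm s] :> {mpoly K[n * n]}.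
  have XD : {morph (fun m : 'X_{1..n * n} => 'X_[K, m]) : m1 m2 / (m1 + m2)%MM >-> m1 * m2}.
    by move=> m1 m2; rewrite mpolyXD.
  by rewrite /permmnm (big_morph _ XD (@mpolyX0 _ _)).
apply/mpolyP => m; rewrite raddf_sum /=.
have E s : (P@_(permmnm s) *: \prod_r 'X_(mxvec_index r (s r)))@_m = P@_(permmnm s) * (permmnm s == m)%:R.
  by rewrite mcoeffZ XE mcoeffX.
rewrite [RHS](eq_bigr _ (fun s _ => E s)).
have [mP|/memN_msupp_eq0 z] := boolP (m \in msupp P).
  have [s ->] := ones_permmnm (hP _ mP).
  rewrite (bigD1 s) //= eqxx mulr1 big1 ?addr0 // => t ts.
  by rewrite (inj_eq permmnm_inj) (negbTE ts) mulr0.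
by rewrite z big1 // => s _; case: eqP => [->|_]; rewrite ?z ?mul0r ?mulr0.
Qed.

Lemma perm_block_sum (c : 'S_n -> K) (y : 'I_n -> 'I_n -> bool) (L : seq 'S_n) s :
  uniq L -> (forall t, (t \in L) = [forall r, y r (t r)]) ->
  \sum_t c t * \prod_r (y r ((s^-1)%g (t r)))%:R = \sum_(t <- L) c (t * s)%g.
Proof.
move=> uL hL; rewrite (reindex_inj (mulIg s)) [\sum_(t <- L) _]big_uniq ?uL // [\sum_(_ in L) _]big_mkcond /=.
apply: eq_bigr => t _; rewrite hL.
rewrite (eq_bigr (fun r => (y r (t r))%:R)) => [|r _]; last by rewrite permM permK.
case: forallP => [h|/forallP].
  by rewrite big1 ?mulr1 // => r _; rewrite h.
rewrite negb_forall => /existsP[r /negbTE hr].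
by rewrite (bigD1 r) //= hr mul0r mulr0.
Qed.

(** P is evaluated at the 0-1 matrix y with its columns permuted by s. The permutations contributing
    are the t * s with t in L, and the two coincidences of rows make the rank at most n - 2. *)
Lemma ones_block P s (y : 'I_n -> 'I_n -> bool) (L : seq 'S_n) p q a b :
  lowrank0 P -> ht (fun _ _ => 1%N) P -> p != q -> p != a -> q != a -> a != b -> b != p ->
  y p =1 y q -> y a =1 y b -> uniq L -> (forall t, (t \in L) = [forall r, y r (t r)]) ->
  \sum_(t <- L) P@_(permmnm (t * s)%g) = 0.
Proof.
move=> [_ hJ] hP pq pa qa ab bp ypq yab uL hL.
rewrite -(perm_block_sum (fun t => P@_(permmnm t)) s uL hL).
rewrite -[RHS](hJ (\matrix_(r, j) (y r ((s^-1)%g j))%:R)); last first.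
  by apply: (rank_eq_rows pq pa qa ab bp) => j; rewrite !mxE ?ypq ?yab.
rewrite [P in RHS](ones_expand hP) raddf_sum; apply: eq_bigr => t _ /=.
rewrite mevalZ rmorph_prod; congr (_ * _); apply: eq_bigr => r _ /=.
by rewrite mevalXU mxvecE mxE.
Qed.

Definition signed P s : K := (-1) ^+ s * P@_(permmnm s).

(** y is the identity matrix with all-ones blocks put on {p, q} and {a, b}; exactly four
    permutations are supported in it. *)
Lemma signed_exch4 P : lowrank0 P -> ht (fun _ _ => 1%N) P -> exch4 (signed P).
Proof.
move=> hJ hP s p q a b; rewrite /= !inE !negb_or => /and4P[/and3P[pq pa pb] /andP[qa qb] ab _].
pose y (r j : 'I_n) := [|| r == j, (r \in [:: p; q]) && (j \in [:: p; q])
                        | (r \in [:: a; b]) && (j \in [:: a; b])].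
pose L : seq 'S_n := [:: 1; tperm p q; tperm a b; tperm p q * tperm a b]%g.
have sym (u v : 'I_n) : u != v -> v != u by rewrite eq_sym.
have [[qp ap] bp] := (sym _ _ pq, sym _ _ pa, sym _ _ pb).
have [[aq bq] ba] := (sym _ _ qa, sym _ _ qb, sym _ _ ab).
have N := (negbTE pq, negbTE pa, negbTE pb, negbTE qa, negbTE qb, negbTE ab,
  negbTE qp, negbTE ap, negbTE bp, negbTE aq, negbTE bq, negbTE ba).
have uL : uniq L.
  (* The four permutations are told apart by their values at p and a. *)
  apply: (map_uniq (f := fun t : 'S_n => [:: t p; t a])).
  by rewrite /= !permM !perm1 !permE /= !N !eqxx /= ?N !inE !eqseq_cons ?eqxx ?N.
have hL t : (t \in L) = [forall r, y r (t r)].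
  apply/idP/forallP => [|h].
    rewrite !inE => /or4P[] /eqP-> r; rewrite /y ?permM ?perm1.
    - by rewrite eqxx.
    - by case: tpermP => [->|->|_ _]; rewrite ?inE !eqxx ?orbT.
    - by case: tpermP => [->|->|_ _]; rewrite ?inE !eqxx ?orbT.
    case: (tpermP p q) => [->|->|_ _]; rewrite ?(tpermD ap bp) ?(tpermD aq bq) ?inE ?eqxx ?orbT //.
    by case: tpermP => [->|->|_ _]; rewrite ?inE !eqxx ?orbT.
  have sw u v : u != v -> t u \in [:: u; v] -> t v \in [:: u; v] ->
      (t u = u /\ t v = v) \/ (t u = v /\ t v = u).
    move=> uv; rewrite !inE => /orP[/eqP e1|/eqP e1] /orP[/eqP e2|/eqP e2]; [|by left|by right|];
      by case/eqP: uv; apply: (perm_inj (s := t)); rewrite e1 e2.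
  have key (u : 'S_n) : u p = t p -> u q = t q -> u a = t a -> u b = t b ->
      (forall r, r != p -> r != q -> r != a -> r != b -> u r = r) -> t = u.
    move=> up uq ua ub ur; apply/permP => r.
    have [->|rp] := eqVneq r p; first by rewrite up.
    have [->|rq] := eqVneq r q; first by rewrite uq.
    have [->|ra] := eqVneq r a; first by rewrite ua.
    have [->|rb] := eqVneq r b; first by rewrite ub.
    rewrite ur //; have := h r; rewrite /y !inE (negbTE rp) (negbTE rq) (negbTE ra) (negbTE rb) /= orbF.
    by move/eqP.
  have hp : t p \in [:: p; q] by have := h p; rewrite /y !inE !N eqxx /= orbF eq_sym orbA orbb.
  have hq : t q \in [:: p; q].
    by have := h q; rewrite /y !inE !N eqxx /= orbF eq_sym; case: (t q == q); rewrite ?orbT.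
  have ha : t a \in [:: a; b] by have := h a; rewrite /y !inE !N eqxx /= eq_sym orbA orbb.
  have hb : t b \in [:: a; b].
    by have := h b; rewrite /y !inE !N eqxx /= eq_sym; case: (t b == b); rewrite ?orbT.
  case: (sw _ _ pq hp hq) => -[tp tq]; case: (sw _ _ ab ha hb) => -[ta tb].
  - have -> : t = 1%g by apply: key => [||||r _ _ _ _]; rewrite perm1.
    by rewrite inE eqxx.
  - have -> : t = tperm a b; last by rewrite !inE eqxx ?orbT.
    apply: key => [||||r *]; rewrite ?ta ?tb ?tp ?tq ?tpermL ?tpermR ?[tperm a b p]tpermD ?[tperm a b q]tpermD //.
    by rewrite tpermD 1?eq_sym.
  - have -> : t = tperm p q; last by rewrite !inE eqxx ?orbT.
    apply: key => [||||r *]; rewrite ?ta ?tb ?tp ?tq ?tpermL ?tpermR ?[tperm p q a]tpermD ?[tperm p q b]tpermD //.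
    by rewrite tpermD 1?eq_sym.
  have -> : t = (tperm p q * tperm a b)%g; last by rewrite !inE eqxx ?orbT.
  apply: key => [||||r *]; rewrite permM.
  - by rewrite tpermL tpermD.
  - by rewrite tpermR tpermD.
  - by rewrite [tperm p q a]tpermD ?tpermL.
  - by rewrite [tperm p q b]tpermD ?tpermR.
  by rewrite [tperm p q r]tpermD 1?tpermD 1?eq_sym.
have := @ones_block P s y L p q a b hJ hP pq pa qa ab bp _ _ uL hL.
rewrite !big_cons big_nil addr0 mul1g -mulgA => h.
have h4 : P@_(permmnm (tperm p q * (tperm a b * s))%g) =
    - (P@_(permmnm s) + P@_(permmnm (tperm p q * s)%g) + P@_(permmnm (tperm a b * s)%g)).
  apply/eqP; rewrite -addr_eq0 addrC; apply/eqP; rewrite -[RHS]h.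
  - by rewrite !addrA.
  - by move=> j; rewrite /y !inE !eqxx !N /= !orbF [p == j]eq_sym [q == j]eq_sym; case: (j == p); case: (j == q).
  by move=> j; rewrite /y !inE !eqxx !N /= [a == j]eq_sym [b == j]eq_sym; case: (j == a); case: (j == b).
rewrite /signed h4 !odd_permM !odd_tperm pq ab.
move: (odd_perm s) P@_(permmnm s) P@_(permmnm (tperm p q * s)%g) P@_(permmnm (tperm a b * s)%g).
move=> e c1 c2 c3; by case: e; rewrite /= ?(expr0, expr1) ?mul1r ?mulN1r; ring.
Qed.

(** y has a single all-ones block, on {p, q, a}, supporting the six permutations of this set; its
    three equal rows are used as the coincidences p, q and a, q. *)
Lemma signed_exch3 P : lowrank0 P -> ht (fun _ _ => 1%N) P -> exch3 (signed P).
Proof.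
move=> hJ hP s p q a; rewrite /= !inE !negb_or => /and3P[/andP[pq pa] qa _].
pose y (r j : 'I_n) := (r == j) || (r \in [:: p; q; a]) && (j \in [:: p; q; a]).
pose L : seq 'S_n := [:: 1; tperm p q * tperm q a; tperm q a * tperm p q;
  tperm p q; tperm q a; tperm p a]%g.
have sym (u v : 'I_n) : u != v -> v != u by rewrite eq_sym.
have [[qp ap] aq] := (sym _ _ pq, sym _ _ pa, sym _ _ qa).
have N := (negbTE pq, negbTE pa, negbTE qa, negbTE qp, negbTE ap, negbTE aq).
have uL : uniq L.
  apply: (map_uniq (f := fun t : 'S_n => [:: t p; t q])).
  by rewrite /= !permM !perm1 !permE /= !N !eqxx /= ?N ?eqxx /= ?N !inE !eqseq_cons ?eqxx ?N.
have hL t : (t \in L) = [forall r, y r (t r)].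
  have tD (u v r : 'I_n) : u != r -> v != r -> tperm u v r = r by apply: tpermD.
  apply/idP/forallP => [tL r|h].
    have [->|rp] := eqVneq r p.
      by move: tL; rewrite !inE => /or4P[/eqP->|/eqP->|/eqP->|/or3P[]/eqP->];
        rewrite /y ?permM ?perm1 ?permE /= ?eqxx /= ?N ?eqxx /= ?inE ?eqxx ?orbT.
    have [->|rq] := eqVneq r q.
      by move: tL; rewrite !inE => /or4P[/eqP->|/eqP->|/eqP->|/or3P[]/eqP->];
        rewrite /y ?permM ?perm1 ?permE /= ?N ?eqxx /= ?N ?eqxx /= ?inE ?eqxx ?orbT.
    have [->|ra] := eqVneq r a.
      by move: tL; rewrite !inE => /or4P[/eqP->|/eqP->|/eqP->|/or3P[]/eqP->];
        rewrite /y ?permM ?perm1 ?permE /= ?N ?eqxx /= ?N ?eqxx /= ?inE ?eqxx ?orbT.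
    by move: tL; rewrite !inE => /or4P[/eqP->|/eqP->|/eqP->|/or3P[]/eqP->];
      rewrite /y ?permM ?perm1 ?(tD _ _ r) ?eqxx // 1?eq_sym.
  have key (u : 'S_n) : t p = u p -> t q = u q -> t a = u a ->
      (forall r, r != p -> r != q -> r != a -> u r = r) -> t = u.
    move=> up uq ua ur; apply/permP => r.
    have [->|rp] := eqVneq r p; first by rewrite up.
    have [->|rq] := eqVneq r q; first by rewrite uq.
    have [->|ra] := eqVneq r a; first by rewrite ua.
    rewrite ur //; have := h r; rewrite /y !inE (negbTE rp) (negbTE rq) (negbTE ra) /= orbF.
    by move/eqP.
  have hp : t p \in [:: p; q; a].
    by have := h p; rewrite /y !inE eqxx /= eq_sym; case: (t p == p).
  have hq : t q \in [:: p; q; a].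
    by have := h q; rewrite /y !inE eqxx orbT /= eq_sym; case: (t q == q); rewrite ?orbT.
  have ha : t a \in [:: p; q; a].
    by have := h a; rewrite /y !inE eqxx !orbT /= eq_sym; case: (t a == a); rewrite ?orbT.
  have I u v : (t u == t v) = (u == v) by rewrite (inj_eq (@perm_inj _ t)).
  have [npq npa nqa] : [/\ t p != t q, t p != t a & t q != t a] by rewrite !I.
  have K6 (u : 'S_n) : u \in L -> t = u -> t \in L by move=> uin ->.
  move: hp hq ha npq npa nqa; rewrite !inE.
  move=> /or3P[]/eqP tp /or3P[]/eqP tq /or3P[]/eqP ta; rewrite !(tp, tq, ta) ?eqxx // => _ _ _.
  - have -> : t = 1%g by apply: key => [|||r *]; rewrite perm1.
    by rewrite eqxx.
  - have -> : t = tperm q a; last by rewrite eqxx ?orbT.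
    apply: key => [|||r *]; rewrite ?tp ?tq ?ta ?tpermL ?tpermR // tD // eq_sym //.
  - have -> : t = tperm p q; last by rewrite eqxx ?orbT.
    apply: key => [|||r *]; rewrite ?tp ?tq ?ta ?tpermL ?tpermR // tD // eq_sym //.
  - have -> : t = (tperm q a * tperm p q)%g; last by rewrite eqxx ?orbT.
    apply: key => [|||r *]; rewrite permM ?tp ?tq ?ta ?tpermL ?tpermR.
    + by rewrite [tperm q a p]tD ?tpermL.
    + by rewrite tD.
    + by rewrite ?tpermR.
    by rewrite [tperm q a r]tD 1?tD 1?eq_sym.
  - have -> : t = (tperm p q * tperm q a)%g; last by rewrite eqxx ?orbT.
    apply: key => [|||r *]; rewrite permM ?tp ?tq ?ta ?tpermL ?tpermR.
    + by rewrite ?tpermL.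
    + by rewrite tD.
    + by rewrite [tperm p q a]tD ?tpermR.
    by rewrite [tperm p q r]tD 1?tD 1?eq_sym.
  have -> : t = tperm p a; last by rewrite eqxx ?orbT.
  apply: key => [|||r *]; rewrite ?tp ?tq ?ta ?tpermL ?tpermR // tD // eq_sym //.
have := @ones_block P s y L p q a q hJ hP pq pa qa aq qp _ _ uL hL.
rewrite !big_cons big_nil addr0 mul1g -!mulgA => h.
have h4 : P@_(permmnm s) = - (P@_(permmnm (tperm p q * (tperm q a * s))%g) +
   (P@_(permmnm (tperm q a * (tperm p q * s))%g) + (P@_(permmnm (tperm p q * s)%g) +
   (P@_(permmnm (tperm q a * s)%g) + P@_(permmnm (tperm p a * s)%g))))).
  apply/eqP; rewrite -addr_eq0; apply/eqP; apply: h => j; rewrite /y !inE !eqxx !N /=.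
    by rewrite [p == j]eq_sym [q == j]eq_sym; case: (j == p); case: (j == q).
  by rewrite [a == j]eq_sym [q == j]eq_sym; case: (j == a); case: (j == q); rewrite ?orbT.
rewrite /signed h4 !odd_permM !odd_tperm pq pa qa.
move: (odd_perm s) P@_(permmnm (tperm p q * (tperm q a * s))%g) P@_(permmnm (tperm q a * (tperm p q * s))%g).
move: P@_(permmnm (tperm p q * s)%g) P@_(permmnm (tperm q a * s)%g) P@_(permmnm (tperm p a * s)%g).
move=> c1 c2 c3 e c4 c5; by case: e; rewrite /= ?(expr0, expr1) ?mul1r ?mulN1r; ring.
Qed.

Lemma vf_prod_eigen B (I : Type) (r : seq I) (F : I -> {mpoly K[n * n]}) (c : I -> K) :
  (forall i, vf B (F i) = c i *: F i) ->
  vf B (\prod_(i <- r) F i) = (\sum_(i <- r) c i) *: \prod_(i <- r) F i.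
Proof.
move=> hF; have d := vf_derivation B; elim: r => [|i r IH].
  by rewrite !big_nil scale0r; apply: (dvn1 (ev := idfun) d).
by rewrite !big_cons (dvnM (ev := idfun) d) /= hF IH scalerDl -!scalerAr addrC [_ * F i]mulrC.
Qed.

(** The diagonal field with entries D multiplies the monomial of s by addfun D s, the signed
    coefficient of P at s; applied to det it gives P. *)
Lemma ones_orbtan P : (0 < n)%N -> lowrank0 P -> ht (fun _ _ => 1%N) P -> orbtan P.
Proof.
move=> n0 hJ hP.
have [D hD] := perm_additive n0 (signed_exch4 hJ hP) (signed_exch3 hJ hP).
pose w (v : 'I_(n * n)) := \sum_i \sum_j (v == mxvec_index i j)%:R * D i j.
have wE i j : w (mxvec_index i j) = D i j.
  rewrite /w (bigD1 i) //= (bigD1 j) //= eqxx mul1r [X in _ + X + _]big1 ?addr0.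
    rewrite big1 ?addr0 // => a ai; rewrite big1 // => b _.
    by rewrite mxvec_index_eq [i == a]eq_sym (negbTE ai) mul0r.
  by move=> b bj; rewrite mxvec_index_eq [j == b]eq_sym (negbTE bj) andbF mul0r.
exists (diag_mx (\row_v w v)).
have hX v : vf (diag_mx (\row_v w v)) 'X_v = w v *: 'X_v.
  rewrite vfXU (bigD1 v) //= !mxE eqxx mulr1n big1 ?addr0 // => u uv.
  by rewrite !mxE eq_sym (negbTE uv) mulr0n scale0r.
have sgn (b : bool) (Q : {mpoly K[n * n]}) : (-1) ^+ b * Q = ((-1) ^+ b : K) *: Q.
  by case: b; rewrite !(expr0, expr1, mul1r, scale1r, mulN1r, scaleN1r).
have d := vf_derivation (diag_mx (\row_v w v)).
rewrite [P in LHS](ones_expand hP) gdetE (dvn_sum (ev := idfun) d); apply: eq_bigr => s _.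
rewrite sgn vfZ (vf_prod_eigen _ (c := fun r => D r (s r))); last by move=> r; rewrite hX wE.
rewrite scalerA -[X in _ * X]/(addfun D s) -hD /signed mulrA -expr2 sqrr_sign mul1r //.
Qed.

(** Normalizing the columns keeps the row degrees, so the two reductions can be composed. *)
Theorem lowrank0_orbtan P : (0 < n)%N -> lowrank0 P -> orbtan P.
Proof.
move=> n0 hJ; rewrite (wpart_sum P); apply: orbtan_sum => k _.
have [ga hga] := wpart_ht k hJ.
apply: (reduce_line (b := true) n0 _ (wpart_lowrank0 k hJ) hga) => Q g1 QJ hQ ones _.
apply: (reduce_line (b := false) n0 _ QJ hQ) => Q' g2 QJ' hQ' ones' e2.
apply: (ones_orbtan n0 QJ') => m mQ b a; rewrite (hQ' m mQ).
by case: b; [rewrite /= in e2; rewrite e2 ones | rewrite ones'].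
Qed.

End OnesCase.

(** * Smoothness at the determinant *)

Lemma mmap_form (A B : comNzRingType) (phi : {rmorphism A -> B}) N d (b : 'I_N -> B)
    (w : 'rV[A]_(nforms N d)) :
  mmap phi b (form w) = \sum_i phi (w 0 i) * mmap1 b (monom i).
Proof.
rewrite /form raddf_sum; apply: eq_bigr => i _ /=.
by rewrite mmapZ mmapX.
Qed.

Lemma lsub_scale (K : numFieldType) n c (h : 'M[K]_(n * n)) :
  lsub (c *: h) (gdet K n) = c ^+ n *: lsub h (gdet K n).
Proof.
apply: meval_inj => x; rewrite mevalZ !lsub_meval.
have -> : lact (c *: h) x = c *: lact h x.
  apply: (can_inj mxvecK); apply/rowP => i; rewrite linearZ [RHS]mxE !lactE mulr_sumr.
  by apply: eq_bigr => j _; rewrite !mxE mulrA.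
rewrite /meval !mmap_gdet -detZ; congr (\det _).
by apply/matrixP => i j; rewrite !mxE linearZ mxE.
Qed.

Section FirstOrder.
Context (K : numFieldType) (n : nat).

Definition tang (A : 'M[K]_(n * n)) : 'rV[K]_(nforms (n * n) n) := coefs n (vf A (gdet K n)).

Lemma tang_is_linear : linear tang.
Proof.
by move=> c A B; rewrite /tang [c *: A + B]addrC vf_lin coefsD coefsZ addrC.
Qed.

HB.instance Definition _ := GRing.isLinear.Build K 'M[K]_(n * n) 'rV[K]_(nforms (n * n) n)
  _ tang tang_is_linear.

(** 1 + eps A, with eps the polynomial variable: det o (1 + eps A) is a curve through det with
    velocity [tang A]. *)
Definition curve (A : 'M[K]_(n * n)) : 'M[{poly K}]_(n * n) :=
  1%:M + 'X *: map_mx (@polyC K) A.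

Lemma coef1_curve (A : 'M[K]_(n * n)) i : (0 < n)%N ->
  (coefs n (lsub (curve A) (gdet {poly K} n)) 0 i)`_1 = tang A 0 i.
Proof.
move=> n0; set c := coefs n (lsub _ _).
suff -> : tang A = \row_i (c 0 i)`_1 by rewrite [RHS]mxE.
rewrite -[RHS]formK /tang; congr (coefs n _); apply: meval_inj => x.
rewrite vf_eval -line_coef1 -(coefsK (gdet_homog K n)).
have -> : line (lact A x) x (form (coefs n (gdet K n))) =
    (lsub (curve A) (gdet {poly K} n)).@[map_mx (@polyC K) (mxvec x) 0].
  rewrite coefsK ?gdet_homog // /meval lsub_morph /line !mmap_gdet; congr (\det _).
  apply/matrixP => i' j'; rewrite mxE [RHS]mxE lactE; set v := mxvec_index i' j'.
  rewrite /curve (eq_bigr (fun j => (v == j)%:R * (mxvec x 0 j)%:P + 'X * (A v j * mxvec x 0 j)%:P)) => [|j _]; last first.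
    by rewrite !mxE polyCM /=; ring.
  rewrite [RHS]big_split /= [X in _ = X + _](bigD1 v) //= eqxx mul1r [X in _ + X + _]big1 ?addr0 => [|j jv]; last first.
    by rewrite eq_sym (negbTE jv) mul0r.
  by rewrite -mulr_sumr -rmorph_sum addrC -mul_polyC [_ * 'X]mulrC.
rewrite -(coefsK (lsub_homog _ (gdet_homog {poly K} n))) -/c /meval !mmap_form coef_sum.
apply: eq_bigr => j _ /=; rewrite mxE.
have -> : mmap1 (map_mx (@polyC K) (mxvec x) 0) (monom j) = (mmap1 (mxvec x 0) (monom j))%:P.
  by rewrite /mmap1 rmorph_prod; apply: eq_bigr => v _; rewrite mxE rmorphXn.
by rewrite coefMC.
Qed.

Lemma coef0_curve (A : 'M[K]_(n * n)) i :
  (coefs n (lsub (curve A) (gdet {poly K} n)) 0 i)`_0 = coefs n (gdet K n) 0 i.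
Proof.
have := map_coefs (horner_eval (0 : K)) n (lsub (curve A) (gdet {poly K} n)).
rewrite map_lsub map_gdet => /(congr1 (fun w : 'rV_ _ => w 0 i)).
rewrite [LHS]mxE /= {1}/horner_eval horner_coef0 => ->; congr ((coefs n _) 0 i).
suff -> : map_mx (horner_eval 0) (curve A) = 1%:M.
  by apply: meval_inj => x; rewrite lsub_meval /lact trmx1 mulmx1 mxvecK.
apply/matrixP => r s; rewrite !mxE /horner_eval hornerD hornerM hornerX mul0r addr0.
by rewrite -polyC_natr hornerC.
Qed.

(** Euler's relation for det, a form of degree n. *)
Lemma tang1 : (0 < n)%N -> tang 1%:M = n%:R *: coefs n (gdet K n).
Proof.
move=> n0; rewrite /tang -coefsZ; congr (coefs n _).
have := @vf_biact_l K n 1%:M; have -> : biact 1%:M 1%:M = 1%:M :> 'M[K]_(n * n).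
  apply/matrixP => r s; have := lactE (biact 1%:M 1%:M : 'M[K]_(n * n)) (vec_mx (delta_mx 0 s)) r.
  rewrite lact_biact mul1mx mulmx1 vec_mxK (bigD1 s) //= big1 => [|j js]; last first.
    by rewrite !mxE (negbTE js) mulr0.
  by rewrite !mxE !eqxx mulr1 addr0.
move=> ->; congr (_ *: _).
have -> : 1%:M + 'X *: map_mx (@polyC K) 1%:M = (1 + 'X)%:M :> 'M_n.
  by rewrite map_mx1 scalemx1 -rmorphD.
rewrite det_scalar; elim: (n) => [|m IH]; first by rewrite expr0 coef1.
rewrite exprS (dvnM (coef1_derivation K)) /= IH /horner_eval !hornerE /= coefD coef1 coefX add0r.
by rewrite ?addr0 ?mul1r expr1n ?mulr1 -natr1.
Qed.

End FirstOrder.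

Section DualScheme.
Context (K : numClosedFieldType) (n : nat).
Hypothesis n0 : (0 < n)%N.
Local Notation x0 := (coefs n (gdet K n)).

(** The independent family of an equation forces 2n + 1 <= n^2. *)
Lemma dual_eqs_gt2 G : dual_eqs K n G -> (2 < n)%N.
Proof.
move=> [f [u [v [/eqP ff _ _]]]].
have := dimvS (subvf <<f>>%VS); rewrite ff size_tuple dimvf /dim /=.
move: n0; clear; nia.
Qed.

(** The scalar c is absorbed into h by an n-th root, det being of degree n. *)
Lemma dual_eqs_orbit0 G c (h : 'M[K]_(n * n)) : dual_eqs K n G ->
  G.@[(c *: coefs n (lsub h (gdet K n))) 0] = 0.
Proof.
move=> SG; have n2 := dual_eqs_gt2 SG; case: SG => f [u [v [_ _ ->]]].
rewrite -{1}(rootCK n0 c) -coefsZ -lsub_scale.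
set y := coefs n _.
have := @dual_eq_morph K K n f u v (meval (y 0)) idfun (ltnW n2) (fun c => mevalC _ c).
rewrite /= => ->.
have -> : \row_i ('X_i : {mpoly K[nforms (n * n) n]}).@[y 0] = y.
  by apply/rowP => i; rewrite mxE mevalXU.
by rewrite /y coefsK ?eqE_gdet_orbit // lsub_homog // gdet_homog.
Qed.

(** For n <= 2 there is no equation and every form is a tangent vector; low rank then means at most
    x = 0, so the general description of [lowrank0] still applies. *)
Lemma lowrank0_low (P : {mpoly K[n * n]}) : (n <= 2)%N -> P \is n.-homog -> lowrank0 P.
Proof.
move=> n2 hP; split=> // x; rewrite addn1 => rx.
have : \rank x == 0%N by move: (\rank x) n2 rx; clear; lia.
rewrite mxrank_eq0 => /eqP->; rewrite mevalE big_seq big1 // => m mP.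
have [i /eqP/negbTE mi] : exists i, m i <> 0%N.
  apply: contrapT => h; have : mdeg m = n := (dhomogP _ _ _ hP) m mP; rewrite mdegE big1 => [e|i _].
    by move: n0; rewrite -e.
  by apply: contrapT => mi; apply: h; exists i.
by rewrite (bigD1 i) //= linear0 mxE expr0n mi mul0r mulr0.
Qed.

(** The generic form is specialized over K[eps] to det + eps form v, where the coefficient of eps of
    an equation is its differential at det applied to v. *)
Lemma first_order_dual (v : 'rV[K]_(nforms (n * n) n)) : (2 < n)%N ->
  (forall G, dual_eqs K n G -> \sum_i G^`M(i).@[x0 0] * v 0 i = 0) ->
  first_order_zero (gdet K n) (form v).
Proof.
move=> n2 hv f u w ff fuw.
pose b i : {poly K} := (x0 0 i)%:P + v 0 i *: 'X.
have := @dual_eq_morph K {poly K} n f u w (mmap (@polyC K) b) (@polyC K) (ltnW n2) _.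
set G := Defs.eqE _ _ _ _; rewrite /= => E.
have -> : first_order (gdet K n) (form v) = form (\row_i mmap (@polyC K) b 'X_i).
  rewrite /first_order -[in LHS](coefsK (gdet_homog K n)) !map_form -formZ -formD.
  congr (form _); apply/rowP => i; rewrite [RHS]mxE mmapX mmap1U /b [LHS]mxE; congr (_ + _); first by rewrite mxE.
  by rewrite mxE [in LHS]mxE mulrC mul_polyC.
rewrite -E => [|c]; last by rewrite mmapC.
rewrite (dvn_mmap (coef1_derivation K)) => [|c]; last by rewrite coefC.
rewrite -[RHS](hv G); last by exists f, u, w.
apply: eq_bigr => i _; congr (_ * _); last first.
  by rewrite /b coefD coefC coefZ coefX /= mulr1 add0r.
apply: (mmap_comp_rmorph (g := horner_eval 0) (g' := idfun)) => [c|j] /=.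
  by rewrite /horner_eval hornerC.
by rewrite /horner_eval /b hornerD hornerC hornerZ hornerX mulr0 addr0.
Qed.

(** The equations vanish along c det o (1 + eps A), whose velocity is c tang A; c is cancelled when
    nonzero, and c = 0 follows by polynomial dependence. *)
Lemma tangent_dual (A : 'M[K]_(n * n)) c G : dual_eqs K n G ->
  \sum_i G^`M(i).@[(c *: x0) 0] * tang A 0 i = 0.
Proof.
move=> SG; pose w := tang A.
pose g : {mpoly K[nforms (n * n) n]} := \sum_i w 0 i *: G^`M(i).
have gE y : g.@[y] = \sum_i G^`M(i).@[y] * w 0 i.
  by rewrite /g raddf_sum; apply: eq_bigr => i _; rewrite /= mevalZ mulrC.
rewrite -gE -horner_scal_poly (_ : scal_poly g x0 = 0) ?horner0 //.
apply: (@poly0_dense _ 'X); first by rewrite polyX_eq0.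
move=> {}c; rewrite hornerX => c0; rewrite horner_scal_poly gE.
pose y i := c%:P * coefs n (lsub (curve A) (gdet {poly K} n)) 0 i.
have Ec s : map_mx (horner_eval s) (curve A) = 1%:M + s *: A.
  apply/matrixP => r r'; rewrite !mxE /horner_eval hornerD hornerM hornerX hornerC.
  by rewrite -polyC_natr hornerC.
have z : mmap (@polyC K) y G = 0.
  apply: poly0_all => s.
  rewrite -(dual_eqs_orbit0 c (1%:M + s *: A) SG) -[LHS]/(horner_eval s _).
  apply: (mmap_comp_rmorph (g := horner_eval s) (g' := idfun)) => [a|i] /=.
    by rewrite /horner_eval hornerC.
  rewrite /y [RHS]mxE rmorphM /= {1}/horner_eval hornerC.
  have := map_coefs (horner_eval s) n (lsub (curve A) (gdet {poly K} n)).
  rewrite map_lsub map_gdet Ec => /(congr1 (fun w : 'rV_ _ => w 0 i)) <-.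
  by rewrite [in RHS]mxE.
have D1 : forall a : K, (a%:P)`_1 = 0 by move=> a; rewrite coefC.
have := dvn_mmap (coef1_derivation K) y G D1.
rewrite z coef0 => h; apply: (mulfI c0); rewrite mulr0 [RHS]h mulr_sumr.
apply: eq_bigr => i _; rewrite mulrCA /y coefCM coef1_curve //; congr (_ * _).
apply/esym/(mmap_comp_rmorph (g := horner_eval 0) (g' := idfun)) => [a|j] /=.
  by rewrite /horner_eval hornerC.
by rewrite /horner_eval /y hornerM hornerC horner_coef0 coef0_curve [RHS]mxE.
Qed.

Definition det_tangent : {vspace 'rV[K]_(nforms (n * n) n)} := limg (linfun (@tang K n)).

Lemma det_tangentP v : reflect (exists A, v = tang A) (v \in det_tangent).
Proof.
apply: (iffP memv_imgP) => [[A _ ->]|[A ->]]; first by exists A; rewrite lfunE.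
by exists A; rewrite ?memvf ?lfunE.
Qed.

Lemma tangent_cone_dual : tangent_cone (dual_eqs K n) (det_point K n) det_tangent.
Proof.
move=> v; split=> [/det_tangentP[A ->] G x SG /vlineP[c ->]|h].
  exact: tangent_dual.
have hv G : dual_eqs K n G -> \sum_i G^`M(i).@[x0 0] * v 0 i = 0.
  by move=> SG; apply: h SG (memv_line _).
have [A hA] : orbtan (form v).
  apply: lowrank0_orbtan => //; have [n2|n2] := leqP n 2; first exact: lowrank0_low n2 (form_homog v).
  by split; [exact: form_homog | exact: (tangent_vanish n2 (form_homog v) (first_order_dual n2 hv))].
by apply/det_tangentP; exists A; rewrite /tang -hA formK.
Qed.

End DualScheme.

(** * Linear families of substitutions *)

Section MatrixFamily.
Context (K : numClosedFieldType) (n : nat).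
Hypothesis n0 : (0 < n)%N.
Local Notation x0 := (coefs n (gdet K n)).
Context (d : nat) (A_ : 'I_d.+1 -> 'M[K]_(n * n)).
Hypothesis A0 : A_ 0 = 1%:M.

Definition fam_mx : 'M[{mpoly K[d.+1]}]_(n * n) :=
  \sum_l 'X_l *: map_mx (@mpolyC d.+1 K) (A_ l).

Definition fam_coefs (i : 'I_(nforms (n * n) n)) : {mpoly K[d.+1]} :=
  coefs n (lsub fam_mx (gdet {mpoly K[d.+1]} n)) 0 i.

Definition fam_at (t : 'rV[K]_d.+1) : 'M[K]_(n * n) := \sum_l t 0 l *: A_ l.

Lemma map_fam_coefs (C : comNzRingType) (g : {rmorphism {mpoly K[d.+1]} -> C}) i :
  g (fam_coefs i) = coefs n (lsub (map_mx g fam_mx) (gdet C n)) 0 i.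
Proof.
have := map_coefs g n (lsub fam_mx (gdet {mpoly K[d.+1]} n)).
by rewrite map_lsub map_gdet => <-; rewrite [RHS]mxE.
Qed.

Lemma map_fam_mx (C : comNzRingType) (g : {rmorphism {mpoly K[d.+1]} -> C})
    (k : {rmorphism K -> C}) : (forall a, g a%:MP = k a) ->
  map_mx g fam_mx = \sum_l g 'X_l *: map_mx k (A_ l).
Proof.
move=> gk; rewrite /fam_mx raddf_sum; apply: eq_bigr => l _ /=.
by apply/matrixP => i j; rewrite !mxE rmorphM /= gk.
Qed.

Lemma meval_fam_mx (t : 'rV[K]_d.+1) : map_mx (meval (t 0)) fam_mx = fam_at t.
Proof.
rewrite (map_fam_mx (k := idfun)) => [|a]; last by rewrite /= mevalC.
by apply: eq_bigr => l _; rewrite /= mevalXU map_mx_id.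
Qed.

Lemma phi_fam t : phi fam_coefs t = coefs n (lsub (fam_at t) (gdet K n)).
Proof.
apply/rowP => i; rewrite [LHS]mxE.
by rewrite (map_fam_coefs (meval (t 0))) meval_fam_mx.
Qed.

Lemma fam_at_delta : fam_at (delta_mx 0 0) = 1%:M.
Proof.
rewrite /fam_at (bigD1 0) //= mxE !eqxx scale1r A0 big1 ?addr0 // => l l0.
by rewrite mxE (negbTE l0) scale0r.
Qed.

Lemma lsub1 : lsub 1%:M (gdet K n) = gdet K n.
Proof. by apply: meval_inj => x; rewrite lsub_meval /lact trmx1 mulmx1 mxvecK. Qed.

Lemma phi_fam0 : phi fam_coefs (delta_mx 0 0) = x0.
Proof. by rewrite phi_fam fam_at_delta lsub1. Qed.

Lemma phi_fam_scale c t : exists c', phi fam_coefs (c' *: t) = c *: phi fam_coefs t.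
Proof.
exists (n.-root c); rewrite !phi_fam.
have -> : fam_at (n.-root c *: t) = n.-root c *: fam_at t.
  by rewrite /fam_at scaler_sumr; apply: eq_bigr => l _; rewrite mxE scalerA.
by rewrite lsub_scale coefsZ rootCK.
Qed.

(** The partial derivative is read off the line through the base point in direction l, on which the
    matrix of the family is 1 + eps A_l. *)
Lemma fam_jac l i : (fam_coefs i)^`M(l).@[(delta_mx 0 0 : 'rV[K]_d.+1) 0] = tang (A_ l) 0 i.
Proof.
pose b (j : 'I_d.+1) : {poly K} := (j == 0)%:R%:P + (j == l)%:R *: 'X.
have := map_fam_coefs (mmap (@polyC K) b) i.
rewrite (map_fam_mx (k := @polyC K)) => [|a]; last by rewrite /= mmapC.
have -> : \sum_j mmap (@polyC K) b 'X_j *: map_mx (@polyC K) (A_ j) = curve (A_ l).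
  rewrite (eq_bigr (fun j => (j == 0)%:R%:P *: map_mx (@polyC K) (A_ j) +
     (j == l)%:R *: 'X *: map_mx (@polyC K) (A_ j))) => [|j _].
    rewrite big_split /=; congr (_ + _).
      rewrite (bigD1 0) //= ?eqxx /= ?polyC1 scale1r A0 map_mx1 big1 ?addr0 // => j /negbTE->.
      by rewrite scale0r.
    rewrite (bigD1 l) //= eqxx scale1r big1 ?addr0 // => j /negbTE->.
    by rewrite scale0r scale0r.
  by rewrite mmapX mmap1U -scalerDl.
move=> /(congr1 (fun p : {poly K} => p`_1)); rewrite coef1_curve // => <-.
have D1 : forall a : K, (a%:P)`_1 = 0 by move=> a; rewrite coefC.
rewrite (dvn_mmap (coef1_derivation K) b _ D1).
rewrite (bigD1 l) //= big1 ?addr0 => [|j /negbTE jl]; last first.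
  by rewrite /b coefD coefC coefZ coefX jl mul0r addr0 mulr0.
rewrite {2}/b coefD coefC coefZ coefX eqxx mulr1 add0r mulr1.
apply/esym/(mmap_comp_rmorph (g := horner_eval 0) (g' := idfun)) => [a|j] /=.
  by rewrite /horner_eval hornerC.
by rewrite /horner_eval /b hornerD hornerC hornerZ hornerX mulr0 addr0 mxE.
Qed.

Lemma fam_orbit t (M : proj K (nforms (n * n) n)) : \det (fam_at t) != 0 ->
  val M = <[phi fam_coefs t]>%VS -> det_orbit K n M.
Proof.
rewrite -unitfE -[_ \is a _]/(fam_at t \in unitmx) phi_fam => tu hM.
by exists (invmx (fam_at t)); rewrite ?unitmx_inv // hM /lin_act invmxK.
Qed.

Lemma Zseq_fam_min B : zclosed B -> (det_orbit K n `<=` B)%classic ->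
  (Zseq fam_coefs d `<=` B)%classic.
Proof.
move=> cB oB.
have dE (t : 'rV[K]_d.+1) : (\det fam_mx).@[t 0] = \det (fam_at t).
  by rewrite -det_map_mx meval_fam_mx.
apply: (Zseq_min phi_fam0 (coefs_detpoly_neq0 K n) (D := \det fam_mx)) => //.
  apply/eqP => D0; have := dE (delta_mx 0 0).
  by rewrite D0 meval0 fam_at_delta det1 => /eqP; rewrite eq_sym oner_eq0.
by move=> t M; rewrite dE => dt hM; apply/oB/(fam_orbit dt hM).
Qed.

End MatrixFamily.

Section SmoothComponent.
Context (K : numClosedFieldType) (n : nat).
Hypothesis n0 : (0 < n)%N.
Local Notation x0 := (coefs n (gdet K n)).
Local Notation T := (det_tangent K n).

Lemma x0_neq0 : x0 != 0. Proof. exact: coefs_detpoly_neq0. Qed.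

Lemma x0_tangent : x0 \in T.
Proof.
apply/det_tangentP; exists (n%:R^-1 *: 1%:M).
by rewrite linearZ /= tang1 // scalerA mulVf ?scale1r // pnatr_eq0 -lt0n.
Qed.

(** The base point imposes A_0 = 1, whose image under [tang] is n x0; the other matrices lift a
    basis of a complement of x0 in T. *)
Lemma tangent_family : exists d (A_ : 'I_d.+1 -> 'M[K]_(n * n)),
  [/\ \dim T = d.+1, A_ 0 = 1%:M &
      row_free (\matrix_(l < d.+1, i < nforms (n * n) n) tang (A_ l) 0 i)].
Proof.
pose U := (T :\: <[x0]>)%VS; pose b := vbasis U.
have bT (j : 'I_(\dim U)) : exists A, b`_j = tang A.
  apply/det_tangentP; apply: (subvP (diffvSl T <[x0]>%VS)).
  by apply: vbasis_mem; rewrite mem_nth // size_tuple.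
pose a j := projT1 (cid (bT j)).
have aE j : tang (a j) = b`_j by rewrite /a; case: cid.
exists (\dim U), (fun l => if unlift 0 l is Some j then a j else 1%:M); split.
- have := dimv_cap_compl T <[x0]>%VS; rewrite (capv_idPr _) ?dim_vline ?x0_neq0 //.
  by rewrite -memvE x0_tangent.
- by rewrite unlift_none.
apply: inj_row_free => c; rewrite mulmx_sum_row big_ord_recl.
have r0 l : row l (\matrix_(l, i) tang (if unlift 0 l is Some j then a j else 1%:M) 0 i) =
    tang (if unlift 0 l is Some j then a j else 1%:M).
  by apply/rowP => i; rewrite !mxE.
rewrite r0 unlift_none tang1 // (eq_bigr (fun j => c 0 (lift 0 j) *: b`_j)) => [|j _]; last first.
  by rewrite r0 liftK aE.
move=> /eqP; rewrite addr_eq0 => /eqP e.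
have sU : \sum_(j < \dim U) c 0 (lift 0 j) *: b`_j \in U.
  apply: rpred_sum => j _; rewrite rpredZ //.
  by apply: vbasis_mem; rewrite mem_nth // size_tuple.
have z : c 0 0 *: (n%:R *: x0) = 0.
  apply/eqP; rewrite -memv0 -(capv_diff T <[x0]>%VS) memv_cap.
  by apply/andP; split; [rewrite e rpredN; exact: sU | rewrite !rpredZ ?memv_line].
have c0 : c 0 0 = 0.
  move/eqP: z; rewrite !scaler_eq0 (negbTE x0_neq0) pnatr_eq0 [n == _]eqn0Ngt n0 !orbF.
  by move/eqP.
have /freeP/(_ (fun j => c 0 (lift 0 j))) := basis_free (vbasisP U).
move: e; rewrite z => /esym/eqP; rewrite oppr_eq0 => /eqP e /(_ e) cj.
apply/rowP => l; rewrite mxE; case: (unliftP 0 l) => [j ->|->] //.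
Qed.

Lemma orbit_sub_zeros : (det_orbit K n `<=` zeros (dual_eqs K n))%classic.
Proof.
move=> L [g gu hL] G x SG; rewrite hL => /vlineP[c ->].
exact: (dual_eqs_orbit0 n0 c (invmx g) SG).
Qed.

(** The family of all matrices reaches the whole orbit; a redundant parameter of index 0 carries the
    identity so that A_0 = 1. *)
Lemma zclosure_orbit_irreducible : zirreducible (zclosure (det_orbit K n)).
Proof.
pose A_ (l : 'I_(n * n * (n * n)).+1) : 'M[K]_(n * n) :=
  if unlift 0 l is Some j then vec_mx (delta_mx 0 j) else 1%:M.
have A0 : A_ 0 = 1%:M by rewrite /A_ unlift_none.
suff -> : zclosure (det_orbit K n) = Zseq (fam_coefs A_) (n * n * (n * n)).
  apply: (Zseq_irr (L := det_point K n) (phi_fam0 A0) (coefs_detpoly_neq0 K n)) => //.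
rewrite eqEsubset; split; last first.
  by apply: (Zseq_fam_min A0 (zclosure_closed _)); apply: sub_zclosure.
apply: zclosure_min; first exact: zeros_zclosed.
move=> L [g gu hL].
pose t : 'rV[K]_(n * n * (n * n)).+1 :=
  \row_l (if unlift 0 l is Some j then mxvec (invmx g) 0 j else 0).
apply: (@pt_in _ _ _ _ _ t); rewrite hL; congr <[_]>%VS.
have -> : ext (n * n * (n * n)) t = t.
  by apply/rowP => l; rewrite mxE -ltnS ltn_ord inord_val.
rewrite phi_fam; suff -> : fam_at A_ t = invmx g by [].
rewrite /fam_at big_ord_recl mxE unlift_none scale0r add0r.
rewrite -[RHS]mxvecK [mxvec _ in RHS]row_sum_delta linear_sum.
by apply: eq_bigr => j _; rewrite mxE /A_ liftK linearZ.
Qed.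

(** A chain of length d inside the orbit closure meets the bound d. An irreducible Z' whose closure
    exceeds the orbit closure would prolong it by one step; the closure is taken because elements of
    a chain are closed. *)
Theorem dual_smooth_component :
  smooth_at (dual_eqs K n) (det_point K n) /\
  irreducible_component (zeros (dual_eqs K n)) (zclosure (det_orbit K n)).
Proof.
have [d [A_ [dT A0 free_A]]] := tangent_family.
have jac : row_free (\matrix_(l < d.+1, i < nforms (n * n) n)
    (fam_coefs A_ i)^`M(l).@[(delta_mx 0 0 : 'rV[K]_d.+1) 0]).
  rewrite (_ : \matrix_(l, i) _ = \matrix_(l, i) tang (A_ l) 0 i) //.
  by apply/matrixP => l i; rewrite [LHS]mxE [RHS]mxE fam_jac.
pose Z := Zseq (fam_coefs A_).
have ZC : (Z d `<=` zclosure (det_orbit K n))%classic.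
  by apply: (Zseq_fam_min A0 (zclosure_closed _)); apply: sub_zclosure.
have CX : (zclosure (det_orbit K n) `<=` zeros (dual_eqs K n))%classic.
  exact: zclosure_min (zeros_zclosed _) orbit_sub_zeros.
have chain : irr_chain (zeros (dual_eqs K n)) (det_point K n) d Z.
  apply: (Zseq_chain (L := det_point K n) (phi_fam_scale n0 A_) (phi_fam0 A0) (coefs_detpoly_neq0 K n) erefl jac).
  exact: subset_trans ZC CX.
have bound e Y : irr_chain (zeros (dual_eqs K n)) (det_point K n) e Y -> (e <= d)%N.
  by move=> /(irr_chain_bound (tangent_cone_dual n0)); rewrite dT.
split.
  split; first by have [+ _] := chain => /(_ 0%N (leq0n _))[_ _ ZL]; apply.
  exists T, d; split; [exact: tangent_cone_dual | by split; [exists Z|] |].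
  by rewrite dT /= dim_vline x0_neq0.
split=> //; first exact: zclosure_orbit_irreducible.
move=> Z' irrZ' Z'X CZ'; have Z'W := @sub_zclosure _ _ Z'.
have [WC|nWC] := pselect (zclosure Z' `<=` zclosure (det_orbit K n))%classic.
  by rewrite eqEsubset; split=> //; apply: subset_trans WC.
have CW := subset_trans CZ' Z'W.
suff : (d.+1 <= d)%N by rewrite ltnn.
apply: (bound _ (fun i => if (i <= d)%N then Z i else zclosure Z')).
case: chain => hZ hlt; split=> i.
  move=> _; case: (leqP i d) => [id|_]; first exact: hZ.
  split; [exact: zclosure_closed | exact: zclosure_irreducible | | exact: zclosure_min (zeros_zclosed _) Z'X].
  have [_ _ ZL _] := hZ d (leqnn d); exact: CW (ZC _ ZL).
rewrite ltnS => id; rewrite id; case: (leqP i.+1 d) => [id'|di]; first exact: hlt.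
have -> : i = d by apply/eqP; rewrite eqn_leq id.
split; first exact: subset_trans ZC CW.
by move=> h; apply: nWC; apply: subset_trans h ZC.
Qed.

End SmoothComponent.

Theorem theorem3p1p1 (R : realType) (n : nat) (hn : (0 < n)%N) :
  smooth_at (dual_eqs R[i] n) (det_point R[i] n) /\
  irreducible_component (zeros (dual_eqs R[i] n)) (zclosure (det_orbit R[i] n)).
Proof. exact: dual_smooth_component hn. Qed.
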